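(* Let $(M,\omega)$ be a compact symplectic manifold without boundary. Then the two spectral sequences $\tilde E$ and $\tilde E'$ associated with the double complex $(\widetilde C^{p,q},-h\delta,d)$, $\widetilde C^{p,q}=h^p\Omega^{q-p}(M)$, $p,q\in\mathbb{Z}$, which abut to $Q_{h,h^{-1}}H^*_{dR}(M)$ and have $\tilde E_1^{p,q}=h^pH^{q-p}_{dR}(M)$ and $(\tilde E_1')^{p,q}=h^pPH_{q-p}(M)$, degenerate at $\tilde E_1$ and $\tilde E_1'$ respectively. Hence $Q_{h,h^{-1}}H^*_{dR}(M)$ is a Laurent deformation quantization of $H^*_{dR}(M)$.
   Context: $w$ is the Poisson bivector field induced by $\omega$: in a local frame $\{e_i\}$ with dual frame $\{e^i\}$, $w^{ij}=w(e^i,e^j)$ is the inverse matrix of $\omega_{ij}=\omega(e_i,e_j)$; repeated indices are summed. For a vector $v$ and a form $\alpha$, $v\vdash\alpha$ is contraction of $v$ into the first slot and $\alpha\dashv v$ contraction into the last slot. The quantum exterior product on $\Omega(M)[h,h^{-1}]$ is the $\mathbb{R}[h,h^{-1}]$-bilinear product $$\alpha\wedge_h\beta=\sum_{n\ge0}\frac{h^n}{n!}w^{i_1j_1}\cdots w^{i_nj_n}(\alpha\dashv e_{i_1}\dashv\cdots\dashv e_{i_n})\wedge(e_{j_n}\vdash\cdots\vdash e_{j_1}\vdash\beta)$$ (contractions on $\alpha$ by $e_{i_1}$ first, on $\beta$ by $e_{j_1}$ first). $\delta\alpha=w\vdash(d\alpha)-d(w\vdash\alpha)$ with $w\vdash\beta=\frac12w^{kl}\,e_k\vdash(e_l\vdash\beta)$;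 $\delta^2=0$, and $PH_*(M)$ (Poisson homology) is the homology of $(\Omega^*(M),\delta)$. $d_h=d-h\delta$ squares to zero and is a derivation for $\wedge_h$. $Q_{h,h^{-1}}H^*_{dR}(M)=\operatorname{Ker}d_h/\operatorname{Im}d_h$ on $\Omega(M)[h,h^{-1}]$, with product induced by $\wedge_h$ and grading in which $h$ has degree $2$. $(\Omega(M)[h,h^{-1}],d_h)$ is the total complex of the double complex above ($-h\delta$ raises $p$ by one, $d$ raises $q$ by one); $\tilde E$ is the standard spectral sequence taking cohomology in $d$ first, $\tilde E'$ the one taking cohomology in $-h\delta$ first. A Laurent deformation (quantization) of an algebra $A$ over $\mathbb{R}$ is an algebra over $\mathbb{R}[h,h^{-1}]$ isomorphic to $A\otimes\mathbb{R}[h,h^{-1}]$ as a module, whose multiplication is determined by an $\mathbb{R}$-linear map $f:A\otimes A\to A[h,h^{-1}]$ of the form $f(a,b)=a\cdot b+\sum_{j\ne0}f_j(a,b)h^j$. *)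

(* Defs.v *)
From mathcomp Require Import all_boot all_order all_algebra.
From mathcomp Require Import all_classical all_reals all_analysis.

Set Implicit Arguments.
Unset Strict Implicit.
Unset Printing Implicit Defensive.
Import Order.TTheory GRing.Theory Num.Theory.
Import numFieldNormedType.Exports.

Local Open Scope classical_set_scope.
Local Open Scope ring_scope.

(* [SubQuot Z B] stands for the quotient module Z / B, for B `<=` Z subsets   *)
(* of an ambient R-module V: elements are represented by elements of [cyc],   *)
(* and equality is equality modulo [bnd].  Scalars are the elements of a set  *)
(* S : set K acting through act; this covers both R (with *:%R) and           *)
(* R[h, h^-1] (with [lscale] below).                                          *)

Record subquot (V : Type) := SubQuot { cyc : set V ; bnd : set V }.

Definition submodule (V : zmodType) (K : Type) (S : set K) (act : K -> V -> V)
    (U : set V) : Prop :=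
  [/\ U 0, forall x y, U x -> U y -> U (x + y)
    & forall c x, S c -> U x -> U (act c x)].

Definition sq_module (V : zmodType) (K : Type) (S : set K) (act : K -> V -> V)
    (X : subquot V) : Prop :=
  [/\ submodule S act (cyc X), submodule S act (bnd X) & bnd X `<=` cyc X].

(* f induces an isomorphism of modules X -> Y *)
Definition sq_iso (V W : zmodType) (K : Type) (S : set K)
    (actV : K -> V -> V) (actW : K -> W -> W)
    (X : subquot V) (Y : subquot W) (f : V -> W) : Prop :=
  [/\ forall x, cyc X x -> cyc Y (f x),
      forall x y, cyc X x -> cyc X y -> bnd Y (f (x + y) - (f x + f y)),
      forall c x, S c -> cyc X x -> bnd Y (f (actV c x) - actW c (f x)),
      forall x, cyc X x -> (bnd Y (f x) <-> bnd X x)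
    & forall y, cyc Y y -> exists2 x, cyc X x & bnd Y (y - f x)].

(* f induces a bilinear map X x X -> Y, i.e. a linear map on X (x) X *)
Definition sq_bilinear (V W : zmodType) (K : Type) (S : set K)
    (actV : K -> V -> V) (actW : K -> W -> W)
    (X : subquot V) (Y : subquot W) (f : V -> V -> W) : Prop :=
  [/\ forall x y, cyc X x -> cyc X y -> cyc Y (f x y),
      forall x y, bnd X x -> cyc X y -> bnd Y (f x y) /\ bnd Y (f y x),
      forall x y z, cyc X x -> cyc X y -> cyc X z ->
        bnd Y (f (x + y) z - (f x z + f y z)) /\
        bnd Y (f z (x + y) - (f z x + f z y))
    & forall c x y, S c -> cyc X x -> cyc X y ->
        bnd Y (f (actV c x) y - actW c (f x y)) /\
        bnd Y (f x (actV c y) - actW c (f x y))].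

(* mul makes X an associative unital algebra *)
Definition sq_algebra (V : zmodType) (K : Type) (S : set K)
    (act : K -> V -> V) (X : subquot V) (mul : V -> V -> V) : Prop :=
  [/\ sq_module S act X,
      sq_bilinear S act act X X mul,
      forall x y z, cyc X x -> cyc X y -> cyc X z ->
        bnd X (mul (mul x y) z - mul x (mul y z))
    & exists2 e, cyc X e & forall x, cyc X x ->
        bnd X (mul e x - x) /\ bnd X (mul x e - x)].

(* a : int -> V stands for \sum_p a_p h^p.                                    *)

Definition laurent (V : zmodType) (U : set V) : set (int -> V) :=
  [set a | (forall p, U (a p)) /\ finite_set [set p | a p != 0]].

Definition hmon (V : zmodType) (p : int) (v : V) : int -> V :=
  fun i => if i == p then v else 0.

(* the action of R[h, h^-1] on V[h, h^-1] *)
Definition lscale (R : realType) (V : lmodType R)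
    (c : int -> R) (a : int -> V) : int -> V :=
  fun n => \sum_(p \in [set: int]) c p *: a (n - p).

(* the R[h, h^-1]-bilinear extension of f : V x V -> W[h, h^-1] *)
Definition lbilin (V W : zmodType) (f : V -> V -> int -> W)
    (a b : int -> V) : int -> W :=
  fun n => \sum_(pq \in [set: int * int])
             f (a pq.1) (b pq.2) (n - pq.1 - pq.2).

Definition sq_laurent (V : zmodType) (X : subquot V) : subquot (int -> V) :=
  SubQuot (laurent (cyc X)) (laurent (bnd X)).

Definition sq_hmon (V : zmodType) (p : int) (X : subquot V) :
    subquot (int -> V) :=
  SubQuot (hmon p @` cyc X) (hmon p @` bnd X).

(* (E, mulE) is a Laurent deformation of the R-algebra (A, mulA); Phi is the  *)
(* module isomorphism A (x) R[h, h^-1] = A[h, h^-1] -> E, and f is the        *)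
(* multiplication of E restricted to A and read through Phi.                  *)
Definition laurent_deformation (R : realType) (V W : lmodType R)
    (A : subquot V) (mulA : V -> V -> V)
    (E : subquot (int -> W)) (mulE : (int -> W) -> (int -> W) -> (int -> W)) :
    Prop :=
  [/\ sq_algebra [set: R] *:%R A mulA,
      sq_algebra (laurent [set: R^o]) (@lscale R W) E mulE
    & exists (Phi : (int -> V) -> (int -> W)) (f : V -> V -> (int -> V)),
      [/\ sq_iso (laurent [set: R^o]) (@lscale R V) (@lscale R W)
            (sq_laurent A) E Phi,
          sq_bilinear [set: R] *:%R *:%R A (sq_laurent A) f,
          forall a b, cyc A a -> cyc A b -> bnd A (f a b 0 - mulA a b)
        & forall a b, cyc A a -> cyc A b ->
            bnd E (mulE (Phi (hmon 0 a)) (Phi (hmon 0 b)) - Phi (f a b))]].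

(* F p n is the p-th step of a decreasing filtration in total degree n, and D *)
(* is the differential, of degree 1.                                          *)

Definition ss_cyc (V : zmodType) (D : V -> V) (F : int -> int -> set V)
    (r p n : int) : set V :=
  [set x | F p n x /\ F (p + r) (n + 1) (D x)].

(* the term of filtration degree p and total degree n of the r-th page,       *)
(*   Z_r^p / (Z_(r-1)^(p+1) + D Z_(r-1)^(p-r+1))                              *)
Definition ss_page (V : zmodType) (D : V -> V) (F : int -> int -> set V)
    (r p n : int) : subquot V :=
  SubQuot (ss_cyc D F r p n)
    [set x | exists y z, [/\ ss_cyc D F (r - 1) (p + 1) n y,
                             ss_cyc D F (r - 1) (p - r + 1) (n - 1) z
                           & x = y + D z]].

(* d_r, the map from the term (p, n) to the term (p + r, n + 1) induced by D, *)
(* is zero for all r >= s                                                     *)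
Definition ss_degenerates (V : zmodType) (D : V -> V)
    (F : int -> int -> set V) (s : int) : Prop :=
  forall r p n : int, s <= r -> forall x, cyc (ss_page D F r p n) x ->
    bnd (ss_page D F r (p + r) (n + 1)) (D x).

(* gr^p of H n for the filtration whose p-th step consists of the classes     *)
(* having a representative in F p n                                           *)
Definition gr_page (V : zmodType) (F : int -> int -> set V)
    (H : int -> subquot V) (p n : int) : subquot V :=
  SubQuot (F p n `&` cyc (H n))
    [set x | (F p n `&` cyc (H n)) x /\
       exists2 y, (F (p + 1) n `&` cyc (H n)) y & bnd (H n) (x - y)].

Definition ss_abuts (R : realType) (V : lmodType R) (D : V -> V)
    (F : int -> int -> set V) (H : int -> subquot V) : Prop :=
  forall n : int,
  (exists a b : int,
    (forall x, cyc (H n) x ->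
       exists2 y, (F a n `&` cyc (H n)) y & bnd (H n) (x - y)) /\
    (forall x, (F b n `&` cyc (H n)) x -> bnd (H n) x)) /\
  (forall p : int, exists r0 : int, forall r, r0 <= r ->
     sq_iso [set: R] *:%R *:%R (gr_page F H p n) (ss_page D F r p n) id).

(* The C p q are independent submodules of an ambient module; dh has bidegree *)
(* (1, 0) and dv has bidegree (0, 1).                                         *)

Definition double_complex (R : realType) (V : lmodType R)
    (C : int -> int -> set V) (dh dv : V -> V) : Prop :=
  forall p q : int,
  [/\ submodule [set: R] *:%R (C p q),
      forall (k : R) x y, C p q x -> C p q y ->
        dh (k *: x + y) = k *: dh x + dh y /\
        dv (k *: x + y) = k *: dv x + dv y,
      forall x, C p q x -> C (p + 1) q (dh x) /\ C p (q + 1) (dv x)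
    & forall x, C p q x ->
        [/\ dh (dh x) = 0, dv (dv x) = 0 & dh (dv x) + dv (dh x) = 0]].

(* the direct sum of the C p (n - p) for p in P *)
Definition dc_sum (V : zmodType) (C : int -> int -> set V) (P : set int)
    (n : int) : set V :=
  [set x | exists c : int -> V,
     [/\ forall p, C p (n - p) (c p),
         finite_set [set p | c p != 0],
         [set p | c p != 0] `<=` P
       & x = \sum_(p \in [set: int]) c p]].

Definition dc_tot (V : zmodType) (C : int -> int -> set V) : int -> set V :=
  dc_sum C [set: int].

(* filtration by p: the E_0 differential is dv *)
Definition dc_filt1 (V : zmodType) (C : int -> int -> set V) (p n : int) :
    set V :=
  dc_sum C [set p' | p <= p'] n.

(* filtration by q: the E_0 differential is dh *)
Definition dc_filt2 (V : zmodType) (C : int -> int -> set V) (q n : int) :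
    set V :=
  dc_sum C [set p' | q <= n - p'] n.

(* A form a is given by its components: a I is the coefficient of             *)
(* e^I = e^i1 /\ .. /\ e^ik for I = {i1 < .. < ik}, that is a(e_i1,..,e_ik).  *)

Notation ext R m := ({set 'I_m} -> R^o).

Definition ewedge (R : realType) (m : nat) (a b : ext R m) : ext R m :=
  fun K => \sum_(I : {set 'I_m} | I \subset K)
    (-1) ^+ #|[set ij : 'I_m * 'I_m |
                [&& ij.1 \in I, ij.2 \in K :\: I & (ij.2 < ij.1)%N]]%SET|
    * a I * b (K :\: I)%SET.

Definition eone (R : realType) (m : nat) : ext R m := fun I => (I == finset.set0)%:R.

Definition ecovec (R : realType) (m : nat) (u : 'I_m -> R) : ext R m :=
  fun I => \sum_(i | I == [set i]%SET) u i.

(* e_i |- a, contraction into the first slot *)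
Definition econtrl (R : realType) (m : nat) (i : 'I_m) (a : ext R m) :
    ext R m :=
  fun I => if i \in I then 0
           else (-1) ^+ #|[set j in I | (j < i)%N]%SET| * a (i |: I)%SET.

(* a -| e_i, contraction into the last slot *)
Definition econtrr (R : realType) (m : nat) (i : 'I_m) (a : ext R m) :
    ext R m :=
  fun I => if i \in I then 0
           else (-1) ^+ #|[set j in I | (i < j)%N]%SET| * a (i |: I)%SET.

(* The algebra morphism e^j |-> \sum_i J i j e^i, i.e. the pullback by the    *)
(* linear map v |-> v *m J; with J = 'J phi y this is dy^j |-> d phi^j.       *)
(* [enum I] is increasing.                                                    *)
Definition epull (R : realType) (m : nat) (J : 'M[R]_m) (a : ext R m) :
    ext R m :=
  fun K => \sum_(I : {set 'I_m})
    a I * foldr (fun j b => ewedge (ecovec (fun i => J i j)) b)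
            (@eone R m) (enum I) K.

Fixpoint Ck_on (R : realType) (m k : nat) (U : set 'rV[R]_m)
    (f : 'rV[R]_m -> R) : Prop :=
  (forall y, U y -> {for y, continuous f}) /\
  if k is k'.+1 then
    forall i : 'I_m,
      (forall y, U y -> derivable f y (delta_mx 0 i)) /\
      Ck_on k' U (fun y => 'D_(delta_mx 0 i) f y)
  else True.

Definition smooth_on (R : realType) (m : nat) (U : set 'rV[R]_m)
    (f : 'rV[R]_m -> R) : Prop :=
  forall k, Ck_on k U f.

(* A smooth atlas of dimension m, with charts onto open subsets of R^m (so    *)
(* without boundary); param c is the inverse of coord c.                      *)
Record atlas (R : realType) (m : nat) (M : topologicalType) := Atlas {
  chart : Type ;
  dom : chart -> set M ;
  coord : chart -> M -> 'rV[R]_m ;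
  param : chart -> 'rV[R]_m -> M ;
  dom_open : forall c, open (dom c) ;
  dom_cover : forall x, exists c, dom c x ;
  coord_open : forall c, open (coord c @` dom c) ;
  coordK : forall c x, dom c x -> param c (coord c x) = x ;
  coord_continuous : forall c x, dom c x -> {for x, continuous (coord c)} ;
  param_continuous : forall c y, (coord c @` dom c) y ->
    {for y, continuous (param c)} ;
  transition_smooth : forall c c' (j : 'I_m),
    smooth_on (coord c @` (dom c `&` dom c'))
              (fun y => coord c' (param c y) 0 j) }.

(* A form is the family of its components in the coordinate frames of the     *)
(* charts: alpha c x I is the component of index I at the point x in the      *)
(* chart c (and 0 if x is not in the domain of c, so that equality of forms   *)
(* is equality of families).                                                  *)

Definition pform (R : realType) (m : nat) (M : topologicalType)
    (A : atlas R m M) : lmodType R :=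
  chart A -> M -> {set 'I_m} -> R^o.

Definition is_form (R : realType) (m : nat) (M : topologicalType)
    (A : atlas R m M) : set (pform A) :=
  [set alpha | [/\
    forall c x, ~ dom c x -> alpha c x = 0,
    forall c I, smooth_on (coord c @` dom c) (fun y => alpha c (param c y) I)
  & forall c c' x, dom c x -> dom c' x ->
      alpha c x =
      epull (jacobian (fun y => coord c' (param c y)) (coord c x))
            (alpha c' x)]].

(* Omega^k(M), zero unless 0 <= k <= m *)
Definition is_kform (R : realType) (m : nat) (M : topologicalType)
    (A : atlas R m M) (k : int) : set (pform A) :=
  [set alpha | is_form alpha /\
    forall c x I, alpha c x I != 0 -> #|I|%:Z = k].

Definition fwedge (R : realType) (m : nat) (M : topologicalType)
    (A : atlas R m M) (alpha beta : pform A) : pform A :=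
  fun c x => ewedge (alpha c x) (beta c x).

(* d alpha = \sum_i dx^i /\ (d alpha / dx^i) in each chart *)
Definition dform (R : realType) (m : nat) (M : topologicalType)
    (A : atlas R m M) (alpha : pform A) : pform A :=
  fun c x K => if x \in dom c then
    \sum_(i < m)
      ewedge (ecovec (fun j => (j == i)%:R))
        (fun I => 'D_(delta_mx 0 i) (fun y => alpha c (param c y) I : R)
                    (coord c x)) K
  else 0.

(* omega_ij = omega(e_i, e_j) in the coordinate frame of the chart c *)
Definition omega_mx (R : realType) (m : nat) (M : topologicalType)
    (A : atlas R m M) (omega : pform A) (c : chart A) (x : M) : 'M[R]_m :=
  \matrix_(i, j) econtrl j (econtrl i (omega c x)) finset.set0.

Definition symplectic (R : realType) (m : nat) (M : topologicalType)
    (A : atlas R m M) (omega : pform A) : Prop :=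
  [/\ is_kform 2 omega, dform omega = 0
    & forall c x, dom c x -> omega_mx omega c x \in unitmx].

Definition poisson_mx (R : realType) (m : nat) (M : topologicalType)
    (A : atlas R m M) (omega : pform A) (c : chart A) (x : M) : 'M[R]_m :=
  invmx (omega_mx omega c x).

(* w |- beta *)
Definition wcontr (R : realType) (m : nat) (M : topologicalType)
    (A : atlas R m M) (omega : pform A) (beta : pform A) : pform A :=
  fun c x => 2^-1 *: \sum_(k < m) \sum_(l < m)
    poisson_mx omega c x k l *: econtrl k (econtrl l (beta c x)).

Definition delta (R : realType) (m : nat) (M : topologicalType)
    (A : atlas R m M) (omega : pform A) (alpha : pform A) : pform A :=
  wcontr omega (dform alpha) - dform (wcontr omega alpha).

(* w^(i1 j1) .. w^(in jn) (alpha -| e_i1 -| .. -| e_in) /\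
                          (e_jn |- .. |- e_j1 |- beta) *)
Definition wcontr_wedge (R : realType) (m : nat) (M : topologicalType)
    (A : atlas R m M) (omega : pform A) (n : nat) (alpha beta : pform A) :
    pform A :=
  fun c x => \sum_(i : n.-tuple 'I_m) \sum_(j : n.-tuple 'I_m)
    (\prod_(t < n) poisson_mx omega c x (tnth i t) (tnth j t)) *:
    ewedge (foldl (fun a k => econtrr k a) (alpha c x) i)
           (foldl (fun b k => econtrl k b) (beta c x) j).

(* the quantum exterior product on Omega(M)[h, h^-1] *)
Definition qwedge (R : realType) (m : nat) (M : topologicalType)
    (A : atlas R m M) (omega : pform A) :
    (int -> pform A) -> (int -> pform A) -> (int -> pform A) :=
  lbilin (fun alpha beta (n : int) =>
    if n is Posz n then (n`!%:R)^-1 *: wcontr_wedge omega n alpha beta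
    else 0).

Definition HdRk (R : realType) (m : nat) (M : topologicalType)
    (A : atlas R m M) (k : int) : subquot (pform A) :=
  SubQuot [set alpha | is_kform k alpha /\ dform alpha = 0]
          (@dform R m M A @` is_kform (k - 1)).
Arguments HdRk {R m M} A k.

Definition HdR (R : realType) (m : nat) (M : topologicalType)
    (A : atlas R m M) : subquot (pform A) :=
  SubQuot [set alpha | is_form alpha /\ dform alpha = 0]
          (@dform R m M A @` @is_form R m M A).
Arguments HdR {R m M} A.

Definition PHk (R : realType) (m : nat) (M : topologicalType)
    (A : atlas R m M) (omega : pform A) (k : int) : subquot (pform A) :=
  SubQuot [set alpha | is_kform k alpha /\ delta omega alpha = 0]
          (delta omega @` is_kform (k + 1)).

Definition ldform (R : realType) (m : nat) (M : topologicalType)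
    (A : atlas R m M) (a : int -> pform A) : int -> pform A :=
  fun p => dform (a p).

Definition lhdelta (R : realType) (m : nat) (M : topologicalType)
    (A : atlas R m M) (omega : pform A) (a : int -> pform A) :
    int -> pform A :=
  fun p => - delta omega (a (p - 1)).

Definition d_h (R : realType) (m : nat) (M : topologicalType)
    (A : atlas R m M) (omega : pform A) (a : int -> pform A) :
    int -> pform A :=
  ldform a + lhdelta omega a.

Definition QHdR (R : realType) (m : nat) (M : topologicalType)
    (A : atlas R m M) (omega : pform A) : subquot (int -> pform A) :=
  SubQuot [set a | laurent (@is_form R m M A) a /\ d_h omega a = 0]
          (d_h omega @` laurent (@is_form R m M A)).

(* C~^(p, q) = h^p Omega^(q - p)(M) *)
Definition qdc (R : realType) (m : nat) (M : topologicalType)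
    (A : atlas R m M) (p q : int) : set (int -> pform A) :=
  hmon p @` @is_kform R m M A (q - p).
Arguments qdc {R m M} A p q _.

(* the part of degree n, where h has degree 2 *)
Definition QHdRn (R : realType) (m : nat) (M : topologicalType)
    (A : atlas R m M) (omega : pform A) (n : int) : subquot (int -> pform A) :=
  SubQuot (cyc (QHdR omega) `&` dc_tot (qdc A) n)
          (bnd (QHdR omega) `&` dc_tot (qdc A) n).

(* E~_r^(p, q) *)
Definition Epage (R : realType) (m : nat) (M : topologicalType)
    (A : atlas R m M) (omega : pform A) (r p q : int) :
    subquot (int -> pform A) :=
  ss_page (d_h omega) (dc_filt1 (qdc A)) r p (p + q).

(* (E~'_r)^(p, q), indexed by the bidegree of the double complex: its         *)
(* filtration degree is q                                                     *)
Definition Epage' (R : realType) (m : nat) (M : topologicalType)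
    (A : atlas R m M) (omega : pform A) (r p q : int) :
    subquot (int -> pform A) :=
  ss_page (d_h omega) (dc_filt2 (qdc A)) r q (p + q).

(* Main.v *)
From HB Require Import structures.
Require Import Defs.
From mathcomp Require Import all_boot all_order all_algebra.
From mathcomp Require Import all_classical all_reals all_analysis.
From mathcomp Require Import ring lra zify.

Set Implicit Arguments.
Unset Strict Implicit.
Unset Printing Implicit Defensive.
Import Order.TTheory GRing.Theory Num.Theory.
Import numFieldNormedType.Exports.

Local Open Scope classical_set_scope.
Local Open Scope ring_scope.

(** Write [Lam] for the contraction with the Poisson bivector and [Lef] for the exterior
    product with [omega]. Up to sign and shift, their commutator is the degree operator
    ([elam_two_form], [Lam_Lef]), so that sl2 acts on forms, hence on operators on forms by
    commutators. As [omega] is closed, [d] commutes with [Lef]; as it raises degrees by one,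
    it is a highest weight vector of weight 1. By nilpotency it generates a
    finite-dimensional representation, which must be the one of dimension two, spanned by
    [d] and [delta = [Lam, d]]. Therefore [[Lam, delta] = 0] and [[Lef, delta] = d]
    ([adLam_eq0], [Lam_delta], [Lef_delta]); the relations [delta^2 = 0] and
    [d delta + delta d = 0] follow.

    Since [Lam] and [Lef] are nilpotent, [h Lam] and [Lef / h] have exponentials, which are
    automorphisms of [Omega(M)[h, h^-1]], homogeneous of degree 0. The commutation relations
    integrate ([nexp_conj]) to
      [d o exp (h Lam) = exp (h Lam) o d_h] and
      [(- h delta) o exp (Lef / h) = exp (Lef / h) o d_h]
    ([ldform_expLam], [lhdelta_expLef]). The first automorphism can only raise the exponent
    of [h], so it respects the filtration by [p]; the second can only lower it, so it
    respects the filtration by [q]. Now [d] and [- h delta] are homogeneous for the bigrading,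
    so the spectral sequences of [(d, filtration by p)] and
    [(- h delta, filtration by q)] have no differentials beyond the zeroth, and
    conjugation transfers this to [d_h] ([conjugate_degenerates]). The abutment and the first
    pages are formal, because forms vanish outside degrees 0 to [m] and each filtration is
    therefore finite in each total degree ([filtered_abuts], [qfilt_page1]).

    For the product, [Lam] is a differential operator of order two with respect to the
    exterior product, and its defect of being a derivation is the first order term [B] of the
    quantum product ([elam_ewedge]). As [B] commutes with [Lam] acting on either factor, the
    relation exponentiates to
      [exp (h Lam) (a /\_h b) = exp (h Lam) a /\ exp (h Lam) b]
    ([expLam_qwedge]). So [exp (h Lam)] is an isomorphism of differential algebras from
    quantum to classical Laurent forms, and it identifies the quantum cohomology with
    [H_dR(M)[h, h^-1]] as an algebra; this is a Laurent deformation whose only term is the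
    classical one.

    All this takes place on families of components in charts, so the operators must be shown
    to preserve the compatible families: for [d] this is naturality under changes of
    coordinates ([dloc_epull]), which rests on the chain rule and on the symmetry of second
    partial derivatives. *)

(** * Differential calculus in several variables *)

Lemma derive_line (R : realType) (V : normedModType R) (f : V -> R) (x v : V) (t : R) :
  derivable f (x + t *: v) v ->
  is_derive t 1 (fun s : R => f (x + s *: v)) ('D_v f (x + t *: v)).
Proof.
move=> df.
have E : (fun h : R => h^-1 *: (((fun s : R => f (x + s *: v)) \o shift t) (h *: 1) -
    f (x + t *: v))) = (fun h => h^-1 *: ((f \o shift (x + t *: v)) (h *: v) - f (x + t *: v))).
  apply/funext => h /=; congr (_ *: (f _ - _)).
  by rewrite [h *: 1]mulr1 scalerDl addrCA.
by split; rewrite /derivable /derive E.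
Qed.

(** The mean value theorem for the restriction of [f] to a line; bounding the
    intermediate parameter by [`|t|] treats both signs of [t] at once. *)
Lemma mean_value_line (R : realType) (V : normedModType R) (f : V -> R) (x v : V)
    (t : R) :
  (forall s, `|s| <= `|t| -> derivable f (x + s *: v) v) ->
  exists2 s : R, `|s| <= `|t| & f (x + t *: v) - f x = t * 'D_v f (x + s *: v).
Proof.
move=> df.
have cont (a b : R) : (forall s, s \in `[a, b] -> `|s| <= `|t|) ->
   {within `[a, b], continuous (fun s : R => f (x + s *: v))}.
  move=> ab; apply: derivable_within_continuous => s /ab/df/derive_line.
  by case.
have dd (a b : R) : (forall s, s \in `[a, b] -> `|s| <= `|t|) ->
    forall s, s \in `]a, b[ ->
    is_derive s 1 (fun s : R => f (x + s *: v)) ('D_v f (x + s *: v)).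
  move=> ab s sab; apply: derive_line; apply/df/ab.
  exact: subset_itv_oo_cc.
have [t0|t0] := leP 0 t.
  have ab s : s \in `[0, t] -> `|s| <= `|t|.
    by rewrite in_itv/= => /andP[s0 st]; rewrite !ger0_norm.
  have [c /ab ct] := MVT_segment t0 (dd _ _ ab) (cont _ _ ab).
  by rewrite scale0r addr0 subr0 mulrC => E; exists c.
have ab s : s \in `[t, 0] -> `|s| <= `|t|.
  by rewrite in_itv/= => /andP[s0 st]; rewrite !ler0_norm ?lerN2// ltW.
have [c /ab ct] := MVT_segment (ltW t0) (dd _ _ ab) (cont _ _ ab).
rewrite scale0r addr0 sub0r mulrN => E; exists c => //.
by rewrite -[LHS]opprB E opprK mulrC.
Qed.

Lemma norm_row_entry (R : realType) m (h : 'rV[R]_m) i : `|h 0 i| <= `|h|.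
Proof.
rewrite [leRHS]/Num.Def.normr/= mx_normrE.
exact: (le_bigmax _ (fun i : 'I_1 * 'I_m => `|h i.1 i.2|) (0, i)).
Qed.

(** The vertices of a path from 0 to [h] along the coordinate directions. *)
Definition row_take (R : realType) m (k : nat) (h : 'rV[R]_m) : 'rV[R]_m :=
  \row_(i < m) if (i < k)%N then h 0 i else 0.

Lemma row_takeS (R : realType) m (k : nat) (h : 'rV[R]_m) (km : (k < m)%N) :
  row_take k.+1 h = row_take k h + h 0 (Ordinal km) *: delta_mx 0 (Ordinal km).
Proof.
apply/rowP => i; rewrite !mxE eqxx /= ltnS leq_eqVlt -val_eqE /=.
case: eqP => [ik|_] /=; last by rewrite mulr0 addr0.
by rewrite ik ltnn add0r mulr1; congr (h _ _); apply: val_inj.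
Qed.

Lemma norm_row_le (R : realType) m (h : 'rV[R]_m) (e : R) :
  0 <= e -> (forall i, `|h 0 i| <= e) -> `|h| <= e.
Proof.
move=> e0 he; rewrite [leLHS]/Num.Def.normr/= mx_normrE bigmax_le// => -[i j] _.
by rewrite /= ord1.
Qed.

(** Go from [x] to [x + h] along the coordinate directions in turn: by the mean value
    theorem, near [x] each of the [m] steps changes [g] by at most [e / m.+1 * `|h|]. *)
Lemma zero_partials_differentiable (R : realType) m (g : 'rV[R]_m -> R) x :
  (forall i, \forall y \near x, derivable g y (delta_mx 0 i)) ->
  (forall i, 'D_(delta_mx 0 i) g y @[y --> x] --> (0 : R)) ->
  is_diff x g (\0).
Proof.
move=> dg cg.
have c0 : continuous (\0 : 'rV[R]_m -> R) by exact: cst_continuous.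
have E : g \o shift x = cst (g x) + \0 +o_ 0 id.
  apply/eqaddoP => _/posnumP[e] /=.
  have em : 0 < e%:num / m.+1%:R :> R by [].
  have [d d0 Hd] : exists2 d : R, 0 < d & forall y, `|y - x| < d -> forall i,
      derivable g y (delta_mx 0 i) /\ `|'D_(delta_mx 0 i) g y| <= e%:num / m.+1%:R.
    have : \forall y \near x, forall i,
      derivable g y (delta_mx 0 i) /\ `|'D_(delta_mx 0 i) g y| <= e%:num / m.+1%:R.
      have H i : \forall y \near x, derivable g y (delta_mx 0 i) /\ `|'D_(delta_mx 0 i) g y| <= e%:num / m.+1%:R; last exact: filter_forall H.
      near=> y; split; first by near: y; exact: dg.
      near: y; have /cvgrPdist_le/(_ _ em) := cg i.
      by apply: filterS => y; rewrite sub0r normrN.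
    move=> /nbhs_ballP[d /= d0 Hd]; exists d => // y yx; apply: Hd.
    by rewrite -ball_normE /= distrC.
  rewrite -nbhs_nearE nbhs_simpl; apply/nbhs_ballP; exists d => // h.
  rewrite -ball_normE /= sub0r normrN => hd.
  have key k : (k <= m)%N -> `|g (x + row_take k h) - g x| <= k%:R * (e%:num / m.+1%:R * `|h|).
    elim: k => [_|k IH km].
      rewrite (_ : row_take 0 h = 0) ?addr0 ?subrr ?normr0 ?mul0r//.
      by apply/rowP => i; rewrite !mxE.
    have tk s : `|s| <= `|h 0 (Ordinal km)| ->
       `|(x + row_take k h + s *: delta_mx 0 (Ordinal km)) - x| < d.
      move=> sh; apply: le_lt_trans hd.
      rewrite addrC -addrA addKr; apply: norm_row_le => // i.
      rewrite !mxE eqxx /=; case: ifPn => [ik|_].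
        have -> : (i == Ordinal km) = false by apply/eqP => E; rewrite E /= ltnn in ik.
        by rewrite mulr0 addr0 norm_row_entry.
      case: eqP => _; rewrite ?mulr1 ?mulr0 add0r ?normr0//.
      by rewrite (le_trans sh)// norm_row_entry.
    have [s sh Es] := @mean_value_line _ _ g (x + row_take k h)
      (delta_mx 0 (Ordinal km)) (h 0 (Ordinal km)) (fun s sh => (Hd _ (tk s sh) _).1).
    rewrite -(subrKA (g (x + row_take k h))) row_takeS [x + (_ + _)]addrA.
    rewrite (le_trans (ler_normD _ _))// [in leRHS]mulrS mulrDl mul1r lerD//.
      rewrite Es normrM mulrC ler_pM// ?norm_row_entry//.
      exact: (Hd _ (tk s sh) _).2.
    exact: IH (ltnW km).
  have hE : row_take m h = h by apply/rowP => i; rewrite mxE ltn_ord.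
  rewrite !fctE /= opprD addrA (addrC h) subr0.
  have := key m (leqnn m); rewrite hE => /le_trans; apply.
  rewrite mulrA ler_wpM2r// mulrC -mulrA ler_piMr//.
  by rewrite mulrC ler_pdivrMr// mul1r ler_nat.
have D := diff_unique c0 E.
split; last exact: D.
apply/diff_locallyP; rewrite D; split => //.
Unshelve. all: by end_near. Qed.

Lemma derive_linear_form (R : realType) m (c : 'I_m -> R) (x v : 'rV[R]_m) :
  is_derive x v (fun y : 'rV[R]_m => \sum_i c i * y 0 i) (\sum_i c i * v 0 i).
Proof.
have E : \forall h \near (0 : R)^', (h^-1 *: (((fun y : 'rV[R]_m => \sum_i c i * y 0 i)
    \o shift x) (h *: v) - \sum_i c i * x 0 i)) = \sum_i c i * v 0 i.
  near=> h; rewrite /= -sumrB scaler_sumr; apply: eq_bigr => i _.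
  have h0 : h != 0 by near: h; exact: nbhs_dnbhs_neq.
  rewrite !mxE mulrDr addrK -[LHS]/(h^-1 * (c i * (h * v 0 i))).
  by rewrite mulrCA mulKf.
split; first by apply: (is_cvg_near_cst (\sum_i c i * v 0 i)) => //.
by apply/lim_near_cst.
Unshelve. all: by end_near. Qed.

Lemma differentiable_sumT (R : realType) (V W : normedModType R) (I : finType)
    (f : I -> V -> W) x :
  (forall i, differentiable (f i) x) ->
  differentiable (fun y => \sum_i f i y) x.
Proof.
move=> df; have -> : (fun y => \sum_i f i y) = \sum_i f i.
  by apply/funext => y; rewrite fct_sumE.
apply: (big_ind (fun g : V -> W => differentiable g x)) => [|g h dg dh|i _].
- exact: (differentiable_cst (0 : W) x).
- exact: differentiableD.
- exact: df.
Qed.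

Lemma differentiable_linear_form (R : realType) m (c : 'I_m -> R) (x : 'rV[R]_m) :
  differentiable (fun y : 'rV[R]_m => \sum_i c i * y 0 i) x.
Proof.
apply: (@differentiable_sumT R _ R^o _ (fun i (y : 'rV[R]_m) => c i * y 0 i)) => i.
exact: (differentiableZ (W := R^o) (c i) (differentiable_coord x 0 i)).
Qed.

(** Subtracting the linear form whose coefficients are the partial derivatives at [x]
    leaves a function whose partial derivatives tend to 0. *)
Lemma partials_differentiable (R : realType) m (f : 'rV[R]_m -> R) x :
  (forall i, \forall y \near x, derivable f y (delta_mx 0 i)) ->
  (forall i, {for x, continuous (fun y => 'D_(delta_mx 0 i) f y)}) ->
  differentiable f x.
Proof.
move=> df cf.
pose l (y : 'rV[R]_m) := \sum_i 'D_(delta_mx 0 i) f x * y 0 i.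
have dl y i : is_derive y (delta_mx 0 i) l ('D_(delta_mx 0 i) f x).
  apply: is_derive_eq (derive_linear_form _ _ _) _.
  rewrite (bigD1 i)//= mxE !eqxx mulr1 big1 ?addr0// => j ji.
  by rewrite mxE eqxx (negbTE ji) mulr0.
have dg i y : derivable f y (delta_mx 0 i) ->
    is_derive y (delta_mx 0 i) (f - l) ('D_(delta_mx 0 i) f y - 'D_(delta_mx 0 i) f x).
  by move=> ?; apply: is_deriveB; exact: derivableP.
have gf : is_diff x (f - l) (\0).
  apply: zero_partials_differentiable => i.
    by have := df i; apply: filterS => y /dg[].
  rewrite -(subrr ('D_(delta_mx 0 i) f x)).
  have E : \forall y \near x, 'D_(delta_mx 0 i) f y - 'D_(delta_mx 0 i) f x =
      'D_(delta_mx 0 i) (f - l) y.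
    by have := df i; apply: filterS => y /dg[_ ->].
  apply: (cvg_trans (near_eq_cvg E)).
  by apply: cvgB; [exact: cf | exact: cvg_cst].
rewrite -(subrK l f); apply: differentiableD; first by case: gf.
exact: differentiable_linear_form.
Qed.

(** The mean value theorem in the direction [u], applied to the increment of [f] along
    [t *: v], followed by the mean value theorem for ['D_u f] in the direction [v]. *)
Lemma double_difference (R : realType) (V : normedModType R) (f : V -> R)
    (x u v : V) (t : R) :
  (forall s r, `|s| <= `|t| -> `|r| <= `|t| ->
     derivable f (x + s *: u + r *: v) u /\
     derivable (fun y => 'D_u f y) (x + s *: u + r *: v) v) ->
  exists s r, [/\ `|s| <= `|t|, `|r| <= `|t| &
    f (x + t *: u + t *: v) - f (x + t *: u) - (f (x + t *: v) - f x) =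
    t ^+ 2 * 'D_v (fun y => 'D_u f y) (x + s *: u + r *: v)].
Proof.
move=> H.
pose g y := f (y + t *: v) - f y.
have dg s : `|s| <= `|t| -> is_derive (x + s *: u) u g
    ('D_u f (x + s *: u + t *: v) - 'D_u f (x + s *: u)).
  move=> st; apply: is_deriveB; last first.
    apply/derivableP; have [] := H s 0 st _; first by rewrite normr0.
    by rewrite scale0r addr0.
  have [d _] := H s t st (lexx _).
  have E : (fun h : R => h^-1 *: (((fun y => f (y + t *: v)) \o shift (x + s *: u)) (h *: u) -
    f (x + s *: u + t *: v))) =
    (fun h => h^-1 *: ((f \o shift (x + s *: u + t *: v)) (h *: u) - f (x + s *: u + t *: v))).
    by apply/funext => h /=; rewrite !addrA.
  by split; rewrite /derivable /derive E.
have [|s st] := @mean_value_line _ _ g x u t; first by move=> s /dg[].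
rewrite {1 2}/g => ->; have [_ ->] := dg _ st.
have [|r rt] := @mean_value_line _ _ (fun y => 'D_u f y) (x + s *: u) v t.
  by move=> r rt; have [] := H s r st rt.
by move=> ->; exists s, r; split; rewrite // mulrA expr2.
Qed.

Lemma square_cancel (R : realType) (a b c d T p q : R) : T != 0 ->
  a - b - (c - d) = T * p -> a - c - (b - d) = T * q -> p = q.
Proof.
by move=> T0 E1 E2; apply: (mulfI T0); rewrite -E1 -E2; ring.
Qed.

Lemma within_halves (R : realType) (a b p q e : R) : p = q ->
  `|a - p| < e / 2 -> `|b - q| < e / 2 -> `|a - b| <= e.
Proof.
move=> <- ap bp; rewrite -(subrKA p) (le_trans (ler_normD _ _))// (splitr e).
by rewrite lerD// ltW// distrC.
Qed.

(** The double difference of [f] over a small square is symmetric in [u] and [v], so it is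
    the same multiple of a value of either mixed derivative near [x]; continuity at [x]
    then identifies the two. *)
Lemma mixed_partials (R : realType) (V : normedModType R) (f : V -> R)
    (x u v : V) :
  (\forall y \near x, [/\ derivable f y u, derivable f y v,
     derivable (fun y => 'D_u f y) y v & derivable (fun y => 'D_v f y) y u]) ->
  {for x, continuous (fun y => 'D_v (fun y => 'D_u f y) y)} ->
  {for x, continuous (fun y => 'D_u (fun y => 'D_v f y) y)} ->
  'D_v (fun y => 'D_u f y) x = 'D_u (fun y => 'D_v f y) x.
Proof.
move=> df /cvgrPdist_lt c1 /cvgrPdist_lt c2.
apply/eqP; rewrite -subr_eq0 -normr_le0; apply/ler_addgt0Pl => e e0; rewrite addr0.
have e2 : 0 < e / 2 by rewrite divr_gt0.
have := filterI df (filterI (c1 _ e2) (c2 _ e2)).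
move=> /(_ _ _)/nbhs_ballP[d /= d0 Hd].
(* This size of [t] keeps the square spanned by [t *: u] and [t *: v] inside the ball. *)
pose K := `|u| + `|v| + 1.
have K0 : 0 < K by rewrite ltr_wpDl// addr_ge0.
pose t := d / 2 / K.
have t0 : 0 < t by rewrite !divr_gt0.
have B s r : `|s| <= `|t| -> `|r| <= `|t| -> ball x d (x + s *: u + r *: v).
  rewrite (gtr0_norm t0) => st rt; rewrite -ball_normE /= opprD opprD addrA addrA subrr add0r.
  rewrite -opprD normrN (le_lt_trans (ler_normD _ _))// !normrZ.
  have : `|s| * `|u| + `|r| * `|v| <= t * K.
    rewrite mulrDr mulr1 mulrDr ler_wpDr ?(ltW t0)//.
    by rewrite lerD// ler_wpM2r.
  move=> /le_lt_trans; apply; rewrite divfK ?gt_eqF//.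
  by rewrite ltr_pdivrMr// ltr_pMr// ltr1n.
have Hs s r st rt := Hd _ (B s r st rt).
have [|s [r [st rt E1]]] := @double_difference _ _ f x u v t.
  by move=> s r st rt; have [[]] := Hs s r st rt.
have sw a b : x + a *: v + b *: u = x + b *: u + a *: v by rewrite addrAC.
have [|s' [r' [st' rt' E2]]] := @double_difference _ _ f x v u t.
  move=> s' r' st' rt'; have [[_ d1 _ d2] _] := Hs r' s' rt' st'.
  by rewrite sw; split; [exact: d1 | exact: d2].
rewrite !sw in E2.
have E := square_cancel (lt0r_neq0 (exprn_gt0 2 t0)) E1 E2.
have [_ [C1 _]] := Hs _ _ st rt.
have [_ [_ C2]] := Hs _ _ rt' st'.
exact: within_halves E C1 C2.
Qed.

Section smooth_functions.
Context (R : realType) (m : nat) (U : set 'rV[R]_m).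
Hypothesis oU : open U.
Implicit Types f g : 'rV[R]_m -> R.
Local Notation D i f := (fun y => 'D_(delta_mx 0 i) f y).

Lemma open_near_eq f g y : {in U, f =1 g} -> U y -> \near y, f y = g y.
Proof.
move=> fg Uy; have : nbhs y U by apply: open_nbhs_nbhs.
by apply: filterS => z Uz; apply: fg; rewrite in_setE.
Qed.

Lemma continuous_on_ext f g y : {in U, f =1 g} -> U y ->
  {for y, continuous f} -> {for y, continuous g}.
Proof.
move=> fg Uy; rewrite /prop_for /continuous_at -(fg y) ?in_setE// => cf.
exact: cvg_trans (near_eq_cvg (open_near_eq fg Uy)) cf.
Qed.

Lemma Ck_on_ext k f g : {in U, f =1 g} -> Ck_on k U f -> Ck_on k U g.
Proof.
elim: k f g => [|k IH] f g fg [cf df].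
  by split=> // y Uy; exact: continuous_on_ext (cf y Uy).
split=> [y Uy|i]; first exact: continuous_on_ext (cf y Uy).
 have [dfi Dfi] := df i; split.
  by move=> y Uy; apply: near_eq_derivable (dfi y Uy); exact: open_near_eq.
apply: IH Dfi => y; rewrite in_setE => Uy.
by apply: near_eq_derive; exact: open_near_eq.
Qed.

Lemma Ck_onW k f : Ck_on k.+1 U f -> Ck_on k U f.
Proof.
elim: k f => [|k IH] f [cf df]; first by split.
by split=> // i; have [dfi Dfi] := df i; split=> //; exact: IH.
Qed.

Lemma Ck_on_cst k c : Ck_on k U (fun=> c).
Proof.
elim: k c => [|k IH] c; first by split=> // y _; exact: cst_continuous.
split=> [y _|i]; first exact: cst_continuous.
split=> [y _|]; first exact: derivable_cst.
by apply: Ck_on_ext (IH 0) => y _; rewrite derive_cst.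
Qed.

Lemma Ck_onD k f g : Ck_on k U f -> Ck_on k U g -> Ck_on k U (fun y => f y + g y).
Proof.
elim: k f g => [|k IH] f g [cf df] [cg dg].
  by split=> // y Uy; apply: continuousD; [exact: cf | exact: cg].
split=> [y Uy|i]; first by apply: continuousD; [exact: cf | exact: cg].
have [dfi Dfi] := df i; have [dgi Dgi] := dg i; split.
  by move=> y Uy; apply: derivableD; [exact: dfi | exact: dgi].
apply: Ck_on_ext (IH _ _ Dfi Dgi) => y; rewrite in_setE => Uy /=.
by rewrite -deriveD//; [exact: dfi | exact: dgi].
Qed.

Lemma Ck_onM k f g : Ck_on k U f -> Ck_on k U g -> Ck_on k U (fun y => f y * g y).
Proof.
elim: k f g => [|k IH] f g Cf Cg.
  case: (Cf) (Cg) => cf df [cg dg].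
  by split=> // y Uy; apply: continuousM; [exact: cf | exact: cg].
case: (Cf) (Cg) => cf df [cg dg].
split=> [y Uy|i]; first by apply: continuousM; [exact: cf | exact: cg].
have [dfi Dfi] := df i; have [dgi Dgi] := dg i; split.
  by move=> y Uy; apply: derivableM; [exact: dfi | exact: dgi].
apply: Ck_on_ext (Ck_onD (IH _ _ (Ck_onW Cf) Dgi) (IH _ _ (Ck_onW Cg) Dfi)).
move=> y; rewrite in_setE => Uy /=.
by rewrite -[LHS](@deriveM _ _ f g)//; [exact: dfi | exact: dgi].
Qed.

Lemma Ck_onV k f : (forall y, U y -> f y != 0) -> Ck_on k U f ->
  Ck_on k U (fun y => (f y)^-1).
Proof.
move=> f0; elim: k => [|k IH] Cf.
  case: (Cf) => cf df.
  by split=> // y Uy; apply: continuousV; [exact: f0 | exact: cf].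
case: (Cf) => cf df.
split=> [y Uy|i]; first by apply: continuousV; [exact: f0 | exact: cf].
have [dfi Dfi] := df i; split.
  by move=> y Uy; apply: derivableV; [exact: f0 | exact: dfi].
have CV := IH (Ck_onW Cf).
apply: Ck_on_ext (Ck_onM (Ck_on_cst k (-1)) (Ck_onM (Ck_onM CV CV) Dfi)).
move=> y; rewrite in_setE => Uy /=.
rewrite deriveV; [|exact: f0|exact: dfi].
by rewrite -[RHS]/(_ * _) !mulNr mul1r expr2 invfM.
Qed.

Lemma smooth_ext f g : {in U, f =1 g} -> smooth_on U f -> smooth_on U g.
Proof. by move=> fg Cf k; exact: Ck_on_ext (Cf k). Qed.

Lemma smooth_cst c : smooth_on U (fun=> c).
Proof. by move=> k; exact: Ck_on_cst. Qed.

Lemma smoothD f g : smooth_on U f -> smooth_on U g -> smooth_on U (fun y => f y + g y).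
Proof. by move=> Cf Cg k; apply: Ck_onD. Qed.

Lemma smoothM f g : smooth_on U f -> smooth_on U g -> smooth_on U (fun y => f y * g y).
Proof. by move=> Cf Cg k; apply: Ck_onM. Qed.

Lemma smoothV f : (forall y, U y -> f y != 0) -> smooth_on U f ->
  smooth_on U (fun y => (f y)^-1).
Proof. by move=> f0 Cf k; apply: Ck_onV. Qed.

Lemma smooth_sum (I : Type) (r : seq I) (P : pred I) (F : I -> 'rV[R]_m -> R) :
  (forall i, P i -> smooth_on U (F i)) -> smooth_on U (fun y => \sum_(i <- r | P i) F i y).
Proof.
move=> SF; have -> : (fun y => \sum_(i <- r | P i) F i y) = \sum_(i <- r | P i) F i.
  by apply/funext => y; rewrite fct_sumE.
by apply: big_ind => //; [exact: smooth_cst | exact: smoothD].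
Qed.

Lemma smooth_prod (I : Type) (r : seq I) (P : pred I) (F : I -> 'rV[R]_m -> R) :
  (forall i, P i -> smooth_on U (F i)) -> smooth_on U (fun y => \prod_(i <- r | P i) F i y).
Proof.
move=> SF; elim: r => [|i r IH].
  by apply: smooth_ext (smooth_cst 1) => y _; rewrite big_nil.
case: (boolP (P i)) => Pi.
  by apply: smooth_ext (smoothM (SF i Pi) IH) => y _; rewrite big_cons Pi.
by apply: smooth_ext IH => y _; rewrite big_cons (negbTE Pi).
Qed.

Lemma smooth_derivable f y i : smooth_on U f -> U y -> derivable f y (delta_mx 0 i).
Proof. by move=> /(_ 1)[_ /(_ i)[+ _]]; apply. Qed.

Lemma smooth_D f i : smooth_on U f -> smooth_on U (D i f).
Proof. by move=> Cf k; have [_ /(_ i)[]] := Cf k.+1. Qed.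

Lemma smooth_continuous f y : smooth_on U f -> U y -> {for y, continuous f}.
Proof. by move=> /(_ 0)[+ _]; apply. Qed.

Lemma smooth_differentiable f y : smooth_on U f -> U y -> differentiable f y.
Proof.
move=> Cf Uy; apply: partials_differentiable => i.
  have : nbhs y U by exact: open_nbhs_nbhs.
  by apply: filterS => z; exact: smooth_derivable.
exact: smooth_continuous (smooth_D i Cf) Uy.
Qed.

Lemma smooth_mixed_partials f y i j : smooth_on U f -> U y ->
  'D_(delta_mx 0 j) (D i f) y = 'D_(delta_mx 0 i) (D j f) y.
Proof.
move=> Cf Uy; apply: mixed_partials.
- have : nbhs y U by exact: open_nbhs_nbhs.
  by apply: filterS => z Uz; split; apply: smooth_derivable => //; exact: smooth_D.
- by apply: smooth_continuous Uy; do 2!apply: smooth_D.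
- by apply: smooth_continuous Uy; do 2!apply: smooth_D.
Qed.

End smooth_functions.

Lemma differentiable_row (R : realType) (V : normedModType R) n (phi : V -> 'rV[R]_n) x :
  (forall j, differentiable (fun y => phi y 0 j) x) -> differentiable phi x.
Proof.
move=> dphi; have -> : phi = (fun y => \sum_j phi y 0 j *: (delta_mx 0 j : 'rV[R]_n)).
  by apply/funext => y; rewrite -row_sum_delta.
apply: (@differentiable_sumT _ _ _ _ (fun j y => phi y 0 j *: (delta_mx 0 j : 'rV[R]_n))).
by move=> j; exact: differentiableZl.
Qed.

Lemma derive_row (R : realType) (V : normedModType R) n (phi : V -> 'rV[R]_n) x v j :
  differentiable phi x -> ('D_v phi x) 0 j = 'D_v (fun y => phi y 0 j) x.
Proof. by move=> /diff_derivable dphi; rewrite derive_mx// mxE. Qed.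

Lemma jacobian_entry (R : realType) n p (phi : 'rV[R]_n -> 'rV[R]_p) x i j :
  differentiable phi x ->
  jacobian phi x i j = 'D_(delta_mx 0 i) (fun y => phi y 0 j) x.
Proof.
move=> dphi; rewrite -derive_row// deriveEjacobian// -rowE.
by rewrite [RHS]mxE.
Qed.

Lemma chain_rule (R : realType) (V : normedModType R) n
    (f : 'rV[R]_n -> R) (phi : V -> 'rV[R]_n) x v :
  differentiable phi x -> differentiable f (phi x) ->
  is_derive x v (fun y => f (phi y))
    (\sum_j 'D_(delta_mx 0 j) f (phi x) * 'D_v (fun y => phi y 0 j) x).
Proof.
move=> dphi df; have dc : differentiable (f \o phi) x by exact: differentiable_comp.
have fE (w : 'rV[R]_n) : 'd f (phi x) w = \sum_j 'D_(delta_mx 0 j) f (phi x) * w 0 j.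
  rewrite [in LHS](row_sum_delta w) linear_sum; apply: eq_bigr => j _.
  by rewrite linearZ deriveE// mulrC.
split; first exact: diff_derivable.
rewrite [LHS](deriveE _ dc) diff_comp//= fE.
by apply: eq_bigr => j _; rewrite -derive_row// (deriveE _ dphi).
Qed.

(** * The exterior algebra of a frame *)

Section exterior_algebra.
Context (R : realType) (m : nat).
Implicit Types (a b c : ext R m) (i j k l : 'I_m) (I J K : {set 'I_m}).

Definition ltsgn i j : R := if (j < i)%N then -1 else 1.
Definition sgn i K : R := (-1) ^+ #|[set j in K | (j < i)%N]%SET|.
(** The product of [e^i] with [a], the sign being that of moving [e^i] past the smaller
    indices. *)
Definition emul i a : ext R m := fun K => if i \in K then sgn i K * a (K :\ i)%SET else 0.

Lemma ltsgnC i j : i != j -> ltsgn j i = - ltsgn i j.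
Proof. by rewrite /ltsgn -val_eqE; case: ltngtP => //; rewrite opprK. Qed.

Lemma ltsgn2 i j : ltsgn i j * ltsgn i j = 1.
Proof. by rewrite /ltsgn; case: ifP; rewrite ?mulrNN mulr1. Qed.

Lemma sgn2 i K : sgn i K * sgn i K = 1.
Proof. by rewrite -expr2 sqrr_sign. Qed.

Lemma sgnU i j K : j \notin K -> sgn i (j |: K)%SET = ltsgn i j * sgn i K.
Proof.
move=> jK; rewrite /sgn /ltsgn; case: ifP => ji.
  rewrite (_ : [set k in _ | _]%SET = j |: [set k in K | (k < i)%N])%SET.
    by rewrite cardsU1 inE (negbTE jK) /= exprS.
  by apply/setP => k; rewrite !inE; case: eqP => // ->; rewrite ji.
rewrite mul1r; congr (_ ^+ #|pred_of_set _|).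
apply/setP => k; rewrite !inE; case: eqP => [->|_] //=; first by rewrite ji andbF.
Qed.

Lemma sgn_setID i I K : I \subset K -> sgn i K = sgn i I * sgn i (K :\: I)%SET.
Proof.
move=> IK; rewrite /sgn -exprD; congr (_ ^+ _).
rewrite -[LHS](cardsID I); congr addn; apply: eq_card => k.
  by rewrite !inE; case: (boolP (k \in I)) => [/(fintype.subsetP IK)->|_]; rewrite ?andbT ?andbF.
by rewrite !inE andbA.
Qed.

Lemma sgnD i j K : j \in K -> sgn i (K :\ j)%SET = ltsgn i j * sgn i K.
Proof.
by move=> jK; rewrite -{2}(finset.setD1K jK) sgnU ?finset.setD11// mulrA ltsgn2 mul1r.
Qed.

Lemma econtrlE i a K :
  econtrl i a K = if i \in K then 0 else sgn i K * a (i |: K)%SET.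
Proof. by []. Qed.

Lemma emul_is_linear i : linear (emul i).
Proof.
move=> x a b; apply/funext => K; rewrite /emul /= !fctE.
case: ifP => _; last by rewrite scaler0 addr0.
by rewrite -[_ *: _]/(_ * _) -[x *: _ in RHS]/(_ * _); ring.
Qed.
HB.instance Definition _ i := GRing.isLinear.Build R (ext R m) (ext R m) *:%R (emul i)
  (emul_is_linear i).

Lemma emulZ i (x : R) a : emul i (x *: a) = x *: emul i a.
Proof. exact: linearZZ. Qed.

Lemma econtrl_is_linear i : linear (@econtrl R m i).
Proof.
move=> x a b; apply/funext => K; rewrite /econtrl /= !fctE.
case: ifP => _; first by rewrite scaler0 addr0.
by rewrite -[_ *: _]/(_ * _) -[x *: _ in RHS]/(_ * _); ring.
Qed.
HB.instance Definition _ i := GRing.isLinear.Build R (ext R m) (ext R m) *:%R (@econtrl R m i)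
  (econtrl_is_linear i).

Lemma econtrlD i a b : econtrl i (a + b) = econtrl i a + econtrl i b.
Proof. exact: linearD. Qed.

Lemma econtrlZ i (x : R) a : econtrl i (x *: a) = x *: econtrl i a.
Proof. exact: linearZZ. Qed.

Lemma ewedge_is_linear a : linear (ewedge a).
Proof.
move=> x b c; apply/funext => K; rewrite /ewedge /= !fctE /=.
rewrite scaler_sumr -big_split; apply: eq_bigr => I _ /=.
by rewrite -[_ *: _]/(_ * _) -[x *: _ in RHS]/(_ * _); ring.
Qed.
HB.instance Definition _ a := GRing.isLinear.Build R (ext R m) (ext R m) *:%R (ewedge a)
  (ewedge_is_linear a).

Definition ewedger b a := ewedge a b.
Lemma ewedger_is_linear b : linear (ewedger b).
Proof.
move=> x a c; apply/funext => K; rewrite /ewedger /ewedge /= !fctE /=.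
rewrite scaler_sumr -big_split; apply: eq_bigr => I _ /=.
by rewrite -[_ *: _]/(_ * _) -[x *: _ in RHS]/(_ * _); ring.
Qed.
HB.instance Definition _ b := GRing.isLinear.Build R (ext R m) (ext R m) *:%R (ewedger b)
  (ewedger_is_linear b).

Lemma ewedgeZr (x : R) a b : ewedge a (x *: b) = x *: ewedge a b.
Proof. exact: linearZZ. Qed.

Lemma ewedgeDl a b c : ewedge (a + b) c = ewedge a c + ewedge b c.
Proof. exact: (linearD (ewedger c)). Qed.
Lemma ewedgeNl a c : ewedge (- a) c = - ewedge a c.
Proof. exact: (linearN (ewedger c)). Qed.
Lemma ewedgeZl x a c : ewedge (x *: a) c = x *: ewedge a c.
Proof. exact: (linearZZ (ewedger c)). Qed.
Lemma ewedge0l c : ewedge 0 c = 0.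
Proof. exact: (linear0 (ewedger c)). Qed.
Lemma ewedge_suml (T : Type) (r : seq T) (P : pred T) (F : T -> ext R m) c :
  ewedge (\sum_(i <- r | P i) F i) c = \sum_(i <- r | P i) ewedge (F i) c.
Proof. exact: (linear_sum (ewedger c)). Qed.

Lemma econtrl_emul i j a :
  econtrl i (emul j a) = (if i == j then a else 0) - emul j (econtrl i a).
Proof.
apply/funext => K; rewrite fctE /=.
rewrite -[(- emul _ _) K]/(- (emul j (econtrl i a) K)) /emul econtrlE econtrlE.
case: eqVneq => [->|ij].
  rewrite !inE eqxx /=.
  case: ifPn => jK.
    by rewrite finset.setD1K// sgnD// /ltsgn ltnn mul1r mulrA sgn2 mul1r subrr.
  by rewrite finset.setU1K// sgnU// /ltsgn ltnn mul1r mulrA sgn2 mul1r subr0.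
rewrite add0r !inE (eq_sym j) (negbTE ij) /=.
case: ifPn => iK; case: ifPn => jK; rewrite ?mulr0 ?oppr0//.
rewrite sgnU// sgnD// ltsgnC// (_ : (i |: K) :\ j = i |: K :\ j)%SET; first by ring.
by apply/setP => k; rewrite !inE; case: (eqVneq k j) => [->|_] //=; rewrite orbF eq_sym (negbTE ij).
Qed.

Lemma emul_emul i j a : emul i (emul j a) = - emul j (emul i a).
Proof.
apply/funext => K; rewrite -[RHS]/(- (emul j (emul i a) K)) /emul !inE.
have [->|ij] := eqVneq i j; first by rewrite /= mulr0 if_same oppr0.
rewrite /=; case: ifPn => iK; case: ifPn => jK; rewrite ?mulr0 ?oppr0//.
by rewrite !sgnD// (ltsgnC ij) finset.setDDl finset.setDDl finset.setUC; ring.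
Qed.

Lemma econtrl_econtrl i j a : econtrl i (econtrl j a) = - econtrl j (econtrl i a).
Proof.
apply/funext => K; rewrite -[RHS]/(- (econtrl j (econtrl i a) K)) !econtrlE !inE.
have [->|ij] := eqVneq i j; first by rewrite /= mulr0 if_same oppr0.
rewrite /=; case: ifPn => iK; case: ifPn => jK; rewrite ?mulr0 ?oppr0//.
by rewrite !sgnU// (ltsgnC ij) finset.setUCA; ring.
Qed.

(** The sign of the shuffle that sorts the concatenation of [I] and [J]. *)
Definition inversions I J : R :=
  (-1) ^+ #|[set ij : 'I_m * 'I_m | [&& ij.1 \in I, ij.2 \in J & (ij.2 < ij.1)%N]]%SET|.

Lemma inversionsU i I J : i \notin I ->
  inversions (i |: I)%SET J = sgn i J * inversions I J.
Proof.
move=> iI; rewrite /inversions /sgn -exprD; congr (_ ^+ _).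
rewrite -(card_imset (pred_of_set [set j in J | (j < i)%N]%SET)
  (fun (x y : 'I_m) (e : (i, x) = (i, y)) => congr1 snd e)) -cardsUI.
rewrite [X in _ = (_ + X)%N]eq_card0 ?addn0.
  apply: eq_card => -[x y]; rewrite !inE /=.
  apply/idP/idP => [/and3P[/orP[/eqP->|xI] yJ yx]|/orP[/imsetP[z]|/and3P[xI yJ yx]]].
  - by apply/orP; left; apply/imsetP; exists y; rewrite ?inE ?yJ.
  - by rewrite xI yJ yx orbT.
  - by rewrite inE => /andP[zJ zi] [-> ->]; rewrite eqxx zJ zi.
  - by rewrite xI yJ yx orbT.
move=> -[x y]; rewrite !inE /=; apply/negbTE/negP => /andP[/imsetP[z _ [-> _]]].
by rewrite (negbTE iI).
Qed.

Lemma ewedgeE a b K :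
  ewedge a b K = \sum_(I : {set 'I_m} | I \subset K) inversions I (K :\: I)%SET * a I * b (K :\: I)%SET.
Proof. by []. Qed.

Lemma ewedge_emull i a b : ewedge (emul i a) b = emul i (ewedge a b).
Proof.
apply/funext => K; rewrite /emul -/(emul i a) -/(emul i (ewedge a b)) !ewedgeE.
case: ifPn => iK; last first.
  apply: big1 => I /fintype.subsetP IK; rewrite /emul; case: ifPn => [/IK iK'|_].
    by rewrite iK' in iK.
  by rewrite mulr0 mul0r.
rewrite (bigID (fun I => i \in I)) /= [X in _ + X]big1 ?addr0; last first.
  by move=> I /andP[_ iI]; rewrite /emul (negbTE iI) mulr0 mul0r.
rewrite mulr_sumr (reindex_onto (fun I => i |: I)%SET (fun I => I :\ i)%SET) /=; last first.
  by move=> I /andP[_ iI]; rewrite finset.setD1K.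
apply: eq_big => I.
  rewrite setU11 andbT finset.subUset finset.sub1set iK /= finset.subsetD1.
  case IK: (I \subset K) => //=.
  apply/eqP/idP => [<-|iI]; first by rewrite !inE eqxx.
  by rewrite finset.setU1K.
move=> /andP[/andP[IK _] /eqP E].
have iI : i \notin I by rewrite -E !inE eqxx.
rewrite /emul setU11 finset.setU1K// inversionsU//.
rewrite (sgn_setID _ IK) sgnU// /ltsgn ltnn mul1r finset.setDDl; ring.
Qed.

Lemma ewedge1l b : ewedge (@eone R m) b = b.
Proof.
apply/funext => K; rewrite ewedgeE (bigD1 finset.set0) ?finset.sub0set//=.
rewrite big1 => [|I /andP[_ I0]]; last by rewrite /eone (negbTE I0) mulr0 mul0r.
rewrite /eone eqxx mulr1 addr0 finset.setD0 /inversions (_ : [set _ | _]%SET = finset.set0).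
  by rewrite cards0 mul1r.
by apply/setP => x; rewrite !inE.
Qed.

Definition edelta I : ext R m := fun K => (K == I)%:R.

Lemma ext_sum_edelta a : a = \sum_I a I *: edelta I.
Proof.
apply/funext => K; rewrite fct_sumE (bigD1 K)//= /edelta.
rewrite -[(a K *: _) K]/(a K * (K == K)%:R) eqxx mulr1 big1 ?addr0// => I IK.
by rewrite -[LHS]/(a I * (K == I)%:R) eq_sym (negbTE IK) mulr0.
Qed.

Lemma edelta0 : edelta finset.set0 = @eone R m.
Proof. by []. Qed.

Lemma edeltaE i I : i \in I -> edelta I = sgn i I *: emul i (edelta (I :\ i)%SET).
Proof.
move=> iI; apply/funext => K.
rewrite -[RHS]/(sgn i I * (if i \in K then sgn i K * edelta (I :\ i)%SET (K :\ i)%SET else 0)).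
rewrite /edelta; case: eqP => [->|KI]; first by rewrite iI eqxx mulr1 sgn2.
case: ifP => iK; last by rewrite mulr0.
case: eqP => [E|_]; last by rewrite !mulr0.
by case: KI; rewrite -(finset.setD1K iK) E finset.setD1K.
Qed.

(** Forms are generated from the constant 1 by exterior multiplication by the
    covectors of the frame, so an identity that is linear in a form need only be
    propagated through [emul]. *)
Lemma ext_ind (P : ext R m -> Prop) :
  (forall a b, P a -> P b -> P (a + b)) -> (forall (x : R) a, P a -> P (x *: a)) ->
  P (@eone R m) -> (forall i a, P a -> P (emul i a)) -> forall a, P a.
Proof.
move=> PD PZ P1 Pe a.
have P0 : P 0 by rewrite -(scale0r (@eone R m)); exact: PZ.
rewrite (ext_sum_edelta a); apply: big_ind => // I _; apply: (PZ).
have [n] := ubnP #|I|; elim: n I => // n IH I In.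
have [->|/set0Pn[i iI]] := eqVneq I finset.set0; first by rewrite edelta0.
rewrite (edeltaE iI); apply/PZ/Pe/IH.
by rewrite (finset.cardsD1 i) iI /= in In.
Qed.

Lemma ewedge1r a : ewedge a (@eone R m) = a.
Proof.
elim/ext_ind: a => [a b Ea Eb|x a Ea||i a Ea]; last by rewrite ewedge_emull Ea.
- by rewrite ewedgeDl Ea Eb.
- by rewrite ewedgeZl Ea.
- exact: ewedge1l.
Qed.

Lemma ewedgeA a b c : ewedge (ewedge a b) c = ewedge a (ewedge b c).
Proof.
elim/ext_ind: a => [a a' Ea Eb|x a Ea||i a Ea]; last by rewrite !ewedge_emull Ea.
- by rewrite !ewedgeDl Ea Eb.
- by rewrite !ewedgeZl Ea.
- by rewrite !ewedge1l.
Qed.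

Lemma ecovecE (u : 'I_m -> R) : ecovec u = \sum_i u i *: emul i (@eone R m).
Proof.
apply/funext => K; rewrite /ecovec fct_sumE big_mkcond; apply: eq_bigr => i _ /=.
rewrite -[RHS]/(u i * (if i \in K then sgn i K * eone R (K :\ i)%SET else 0)) /eone.
case: eqP => [->|Ki].
  rewrite inE eqxx finset.setDv eqxx mulr1 /sgn (_ : [set _ in _ | _]%SET = finset.set0).
    by rewrite cards0 mulr1.
  by apply/setP => k; rewrite !inE; case: eqP => //= ->; rewrite ltnn.
case: ifP => iK; last by rewrite mulr0.
case: eqP => [E|_]; last by rewrite !mulr0.
by case: Ki; rewrite -(finset.setD1K iK) E finset.setU0.
Qed.

Lemma ewedge_ecovec (u : 'I_m -> R) b : ewedge (ecovec u) b = \sum_i u i *: emul i b.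
Proof.
rewrite ecovecE ewedge_suml; apply: eq_bigr => i _.
by rewrite ewedgeZl ewedge_emull ewedge1l.
Qed.

Lemma econtrl1 i : econtrl i (@eone R m) = 0.
Proof.
apply/funext => K; rewrite econtrlE /eone; case: ifP => // _.
case: eqP => [E|_]; last by rewrite mulr0.
by have := setU11 i K; rewrite E inE.
Qed.

(** Operators acting on [k]-forms as multiplication by [f k]: the degree, the parity
    sign and the projections onto the homogeneous parts. *)
Definition ediag (f : nat -> R) a : ext R m := fun I => f #|I| * a I.

Lemma ediag_is_linear f : linear (ediag f).
Proof.
move=> x a b; apply/funext => K; rewrite /ediag /= !fctE /=.
by rewrite -[x *: _]/(_ * _) -[x *: _ in RHS]/(_ * _); ring.
Qed.
HB.instance Definition _ f := GRing.isLinear.Build R (ext R m) (ext R m) *:%R (ediag f)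
  (ediag_is_linear f).

Lemma ediag_emul f i a : ediag f (emul i a) = emul i (ediag (f \o succn) a).
Proof.
apply/funext => K; rewrite /ediag /emul /=; case: ifP => iK; last by rewrite mulr0.
by rewrite (finset.cardsD1 i K) iK; ring.
Qed.

Lemma econtrl_ediag f i a : econtrl i (ediag f a) = ediag (f \o succn) (econtrl i a).
Proof.
apply/funext => K; rewrite /ediag !econtrlE /=; case: ifPn => iK; first by rewrite mulr0.
by rewrite cardsU1 iK; ring.
Qed.

(** The sign in the graded Leibniz rules. *)
Definition sigma := ediag (GRing.exp (-1)).
HB.instance Definition _ := GRing.isLinear.Build R (ext R m) (ext R m) *:%R sigma
  (ediag_is_linear (GRing.exp (-1))).

Lemma sigma_emul i a : sigma (emul i a) = - emul i (sigma a).
Proof.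
rewrite /sigma ediag_emul -linearN; congr (emul i _).
by apply/funext => K; rewrite /ediag /= exprS mulN1r mulNr.
Qed.

Lemma sigma_econtrl i a : sigma (econtrl i a) = - econtrl i (sigma a).
Proof.
rewrite /sigma econtrl_ediag; apply/funext => K.
by rewrite -[RHS]/(- (_ * _)) /ediag /= exprS mulN1r mulNr opprK.
Qed.

Lemma sigmaK a : sigma (sigma a) = a.
Proof. by apply/funext => K; rewrite /sigma /ediag mulrA -expr2 sqrr_sign mul1r. Qed.

Lemma sigma1 : sigma (@eone R m) = @eone R m.
Proof.
apply/funext => K; rewrite /sigma /ediag /eone; case: eqP => [->|_]; last by rewrite mulr0.
by rewrite cards0 mul1r.
Qed.

Lemma econtrl_ewedge i a b :
  econtrl i (ewedge a b) = ewedge (econtrl i a) b + ewedge (sigma a) (econtrl i b).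
Proof.
elim/ext_ind: a => [a a' Ea Eb|x a Ea||j a Ea].
- by rewrite ewedgeDl !linearD /= !ewedgeDl Ea Eb addrACA.
- by rewrite ewedgeZl !linearZZ /= !ewedgeZl Ea scalerDr.
- by rewrite econtrl1 ewedge0l sigma1 !ewedge1l add0r.
- rewrite ewedge_emull !econtrl_emul sigma_emul Ea ewedgeDl !ewedgeNl !ewedge_emull linearD /=.
  by rewrite opprD addrA; case: ifP; rewrite ?ewedge0l.
Qed.

Lemma emul_ewedge i a b : emul i (ewedge a b) = ewedge (sigma a) (emul i b).
Proof.
elim/ext_ind: a => [a a' Ea Eb|x a Ea||j a Ea].
- by rewrite ewedgeDl !linearD /= !ewedgeDl Ea Eb.
- by rewrite ewedgeZl !linearZZ /= !ewedgeZl Ea.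
- by rewrite sigma1 !ewedge1l.
- by rewrite ewedge_emull emul_emul Ea sigma_emul ewedgeNl ewedge_emull.
Qed.

(** Contracting the last slot instead of the first costs one sign for each index of the
    remaining form. *)
Lemma econtrrE i a : econtrr i a = sigma (econtrl i a).
Proof.
apply/funext => K; rewrite /econtrr /sigma /ediag /econtrl.
case: ifPn => iK; first by rewrite mulr0.
have -> : #|K| = (#|[set j in K | (j < i)%N]%SET| + #|[set j in K | (i < j)%N]%SET|)%N.
  rewrite -(cardsID [set j : 'I_m | (j < i)%N]%SET K).
  congr addn; apply: eq_card => k; rewrite !inE//.
  case: (ltngtP i k) => //=; rewrite ?andbT ?andbF //.
  by move=> /val_inj E; rewrite -E (negbTE iK).
by rewrite exprD -!mulrA (mulrCA _ (_ ^+ _) (a _)) !mulrA -[X in X * _ * _]expr2 sqrr_sign mul1r.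
Qed.

Lemma ewedge_ecovecC (u v : 'I_m -> R) b :
  ewedge (ecovec u) (ewedge (ecovec v) b) = - ewedge (ecovec v) (ewedge (ecovec u) b).
Proof.
rewrite !ewedge_ecovec; under eq_bigr => i _ do rewrite linear_sum scaler_sumr.
rewrite exchange_big /= -sumrN; apply: eq_bigr => j _.
rewrite linear_sum scaler_sumr -sumrN; apply: eq_bigr => i _ /=.
by rewrite !emulZ emul_emul scalerN !scalerN scalerA [in RHS]scalerA mulrC.
Qed.

Lemma ewedge_ecovec2 (u : 'I_m -> R) b : ewedge (ecovec u) (ewedge (ecovec u) b) = 0.
Proof.
have /eqP := ewedge_ecovecC u u b; rewrite -addr_eq0 -mulr2n -scaler_nat.
by rewrite scaler_eq0 pnatr_eq0 => /eqP.
Qed.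

Definition ecovecs (J : 'M[R]_m) (s : seq 'I_m) : ext R m :=
  foldr (fun j b => ewedge (ecovec (fun i => J i j)) b) (@eone R m) s.

Lemma ecovecs_mem (J : 'M[R]_m) j s : j \in s -> ewedge (ecovec (fun i => J i j)) (ecovecs J s) = 0.
Proof.
elim: s => // k s IH; rewrite inE /=.
have [<- _|_ /IH E] := eqVneq j k; first exact: ewedge_ecovec2.
by rewrite ewedge_ecovecC E linear0 oppr0.
Qed.

Lemma ecovecs_insert (J : 'M[R]_m) j s1 s2 :
  ewedge (ecovec (fun i => J i j)) (ecovecs J (s1 ++ s2)) =
  (-1) ^+ size s1 *: ecovecs J (s1 ++ j :: s2).
Proof.
elim: s1 => [|k s1 IH] /=; first by rewrite scale1r.
by rewrite ewedge_ecovecC IH ewedgeZr exprS mulN1r scaleNr.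
Qed.

Lemma enum_set_sorted I : sorted (fun k l : 'I_m => (k < l)%N) (enum I).
Proof.
rewrite /enum_mem; apply: sorted_filter; first by move=> ? ? ?; exact: ltn_trans.
have := iota_ltn_sorted 0 m; rewrite -val_enum_ord sorted_map.
by rewrite enumT.
Qed.

Lemma enum_set_eq I (s : seq 'I_m) :
  sorted (fun k l : 'I_m => (k < l)%N) s -> s =i I -> enum I = s.
Proof.
move=> ss sI; apply: (@irr_sorted_eq _ (fun k l : 'I_m => (k < l)%N)) => //.
- by move=> ? ? ?; exact: ltn_trans.
- by move=> ?; exact: ltnn.
- exact: enum_set_sorted.
- by move=> k; rewrite mem_enum sI.
Qed.

(** The covector has to move past the factors of smaller index to reach its place in the
    increasing product, and a repeated factor gives zero. *)
Lemma ecovecs_enum (J : 'M[R]_m) j I :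
  ewedge (ecovec (fun i => J i j)) (ecovecs J (enum I)) =
  if j \in I then 0 else sgn j I *: ecovecs J (enum (j |: I)%SET).
Proof.
case: ifPn => jI; first by rewrite ecovecs_mem// mem_enum.
pose s1 := [seq k : 'I_m <- enum I | (k < j)%N]; pose s2 := [seq k : 'I_m <- enum I | (j < k)%N].
have tr : transitive (fun k l : 'I_m => (k < l)%N) by move=> ? ? ?; exact: ltn_trans.
have pw (A : {set 'I_m}) : pairwise (fun k l : 'I_m => (k < l)%N) (enum A).
  by rewrite -sorted_pairwise//; exact: enum_set_sorted.
have pf p : pairwise (fun k l : 'I_m => (k < l)%N) [seq k : 'I_m <- enum I | p k].
  exact: pairwise_filter (pw I).
have mf p k : (k \in [seq k : 'I_m <- enum I | p k]) = p k && (k \in I).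
  by rewrite mem_filter mem_enum.
have E1 : enum I = s1 ++ s2.
  apply: enum_set_eq.
    rewrite sorted_pairwise// pairwise_cat /s1 /s2 !pf !andbT.
    apply/allrelP => k l; rewrite !mf => /andP[kj _] /andP[jl _].
    exact: ltn_trans jl.
  move=> k; rewrite mem_cat !mf -andb_orl.
  case: (ltngtP k j) => //= /val_inj E.
  by rewrite E (negbTE jI).
have E2 : enum (j |: I)%SET = s1 ++ j :: s2.
  apply: enum_set_eq.
    rewrite sorted_pairwise// pairwise_cat /= /s1 /s2 !pf !andbT.
    rewrite allrel_consr; apply/and3P; split.
    - by apply/andP; split; [exact: filter_all|];
      apply/allrelP => k l; rewrite !mf => /andP[kj _] /andP[jl _]; exact: ltn_trans jl.
    - by [].
    - exact: filter_all.
  move=> k; rewrite mem_cat inE !mf !inE.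
  rewrite -val_eqE /=; case: (ltngtP k j) => //= _; rewrite ?orbF //.
rewrite E1 ecovecs_insert -E2; congr (_ ^+ _ *: _).
rewrite cardE; congr size; apply/esym/enum_set_eq.
  by rewrite sorted_pairwise//; exact: pf.
by move=> k; rewrite mf !inE andbC.
Qed.

Lemma epullE (J : 'M[R]_m) a : epull J a = \sum_I a I *: ecovecs J (enum I).
Proof. by apply/funext => K; rewrite fct_sumE. Qed.

Lemma epull_is_linear (J : 'M[R]_m) : linear (epull J).
Proof.
move=> x a b; rewrite !epullE scaler_sumr -big_split; apply: eq_bigr => I _ /=.
by rewrite scalerDl scalerA.
Qed.
HB.instance Definition _ (J : 'M[R]_m) := GRing.isLinear.Build R (ext R m) (ext R m) *:%R (epull J)
  (epull_is_linear J).

Lemma epullZ (J : 'M[R]_m) (x : R) a : epull J (x *: a) = x *: epull J a.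
Proof. exact: linearZZ. Qed.

(** This and [epull1] make [epull J] a morphism of algebras. *)
Lemma epull_emul (J : 'M[R]_m) j a :
  epull J (emul j a) = ewedge (ecovec (fun i => J i j)) (epull J a).
Proof.
rewrite !epullE linear_sum /= (bigID (fun I => j \in I)) /= addrC big1 ?add0r; last first.
  by move=> I /negbTE jI; rewrite /emul jI scale0r.
rewrite [RHS](bigID (fun I => j \in I)) /= [X in _ = X + _]big1 ?add0r; last first.
  by move=> I jI; rewrite ewedgeZr ecovecs_enum jI scaler0.
rewrite (reindex_onto (fun I => j |: I)%SET (fun I => I :\ j)%SET) /=; last first.
  by move=> I jI; rewrite finset.setD1K.
apply: eq_big => I.
  rewrite setU11 /=; apply/eqP/idP => [<-|jI]; first by rewrite !inE eqxx.
  by rewrite finset.setU1K.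
move=> /andP[_ /eqP E]; have jI : j \notin I by rewrite -E !inE eqxx.
rewrite ewedgeZr ecovecs_enum (negbTE jI) scalerA /emul setU11 finset.setU1K//.
by rewrite sgnU// /ltsgn ltnn mul1r mulrC.
Qed.

Lemma epull1 (J : 'M[R]_m) : epull J (@eone R m) = @eone R m.
Proof.
rewrite epullE (bigD1 finset.set0)//= big1 => [|I I0]; last first.
  by rewrite /eone (negbTE I0) scale0r.
by rewrite enum_set0 /eone eqxx scale1r addr0.
Qed.

Lemma epull_ewedge (J : 'M[R]_m) a b :
  epull J (ewedge a b) = ewedge (epull J a) (epull J b).
Proof.
elim/ext_ind: a => [a a' Ea Eb|x a Ea||j a Ea].
- by rewrite ewedgeDl !linearD /= ewedgeDl Ea Eb.
- by rewrite ewedgeZl !linearZZ /= ewedgeZl Ea.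
- by rewrite epull1 !ewedge1l.
- by rewrite ewedge_emull !epull_emul Ea ewedgeA.
Qed.

Lemma ediag_ecovec f (u : 'I_m -> R) a :
  ediag f (ewedge (ecovec u) a) = ewedge (ecovec u) (ediag (f \o succn) a).
Proof.
rewrite !ewedge_ecovec linear_sum /=; apply: eq_bigr => i _.
by rewrite linearZZ /= ediag_emul.
Qed.

Lemma ediag1 f : ediag f (@eone R m) = f 0 *: @eone R m.
Proof.
apply/funext => K; rewrite -[RHS]/(f 0 * eone R K) /ediag /eone.
by case: eqP => [->|_]; rewrite ?cards0 ?mulr0.
Qed.

Lemma epull_ediag (J : 'M[R]_m) f a : epull J (ediag f a) = ediag f (epull J a).
Proof.
elim/ext_ind: a f => [a a' Ea Eb|x a Ea||j a Ea] f.
- by rewrite !linearD /= Ea Eb.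
- by rewrite !linearZZ /= Ea.
- by rewrite ediag1 linearZZ /= epull1 ediag1.
- by rewrite ediag_emul !epull_emul Ea ediag_ecovec.
Qed.

Lemma econtrl_ecovec i (u : 'I_m -> R) a :
  econtrl i (ewedge (ecovec u) a) = u i *: a - ewedge (ecovec u) (econtrl i a).
Proof.
rewrite !ewedge_ecovec linear_sum -sumrN /= (bigD1 i)//= [in RHS](bigD1 i)//= addrA.
rewrite econtrlZ econtrl_emul eqxx scalerBr; congr (_ + _).
apply: eq_bigr => j ji; rewrite econtrlZ econtrl_emul eq_sym (negbTE ji) sub0r.
by rewrite scalerN.
Qed.

(** Contraction is dual to pull-back: the frame vector [e_i] is carried to the vector
    of components [J i j]. *)
Lemma econtrl_epull (J : 'M[R]_m) i a :
  econtrl i (epull J a) = \sum_j J i j *: epull J (econtrl j a).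
Proof.
elim/ext_ind: a => [a a' Ea Eb|x a Ea||k a Ea].
- rewrite !linearD /= Ea Eb -big_split; apply: eq_bigr => j _ /=.
  by rewrite -scalerDr; congr (_ *: _); rewrite !linearD.
- rewrite !linearZZ /= Ea scaler_sumr; apply: eq_bigr => j _.
  by rewrite econtrlZ epullZ !scalerA [x * _]mulrC.
- by rewrite epull1 econtrl1 big1// => j _; rewrite econtrl1 linear0 scaler0.
- rewrite epull_emul econtrl_ecovec Ea linear_sum /= -sumrN.
  have -> : J i k *: epull J a = \sum_j J i j *: (if j == k then epull J a else 0).
    by rewrite (bigD1 k)//= eqxx big1 ?addr0// => j /negbTE->; rewrite scaler0.
  rewrite -big_split; apply: eq_bigr => j _ /=.
  rewrite econtrl_emul linearB /= epull_emul linearZZ /= scalerBr; congr (_ *: _ - _).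
  by case: eqP => // _; rewrite linear0.
Qed.

Lemma ewedge_ecovec_set0 (u : 'I_m -> R) a : ewedge (ecovec u) a finset.set0 = 0.
Proof.
rewrite ewedge_ecovec fct_sumE big1// => i _.
by rewrite -[LHS]/(u i * emul i a finset.set0) /emul inE mulr0.
Qed.

Lemma epull_set0 (J : 'M[R]_m) a : epull J a finset.set0 = a finset.set0.
Proof.
elim/ext_ind: a => [a a' Ea Eb|x a Ea||k a Ea].
- by rewrite linearD /= !fctE Ea Eb.
- by rewrite linearZZ /= -[LHS]/(x * _) Ea.
- by rewrite epull1.
- by rewrite epull_emul ewedge_ecovec_set0 /emul inE.
Qed.

End exterior_algebra.

(** * Contraction with a bivector *)

Section bivector.
Context (R : realType) (m : nat).
Implicit Types (a b c : ext R m) (i j k l : 'I_m) (I K : {set 'I_m}) (w : 'M[R]_m).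

Lemma half_half : 2^-1 + 2^-1 = 1 :> R.
Proof. by have := splitr (1 : R); rewrite div1r => <-. Qed.

(** Contraction with the bivector of components [w]. *)
Definition elam w a : ext R m :=
  2^-1 *: \sum_k \sum_l w k l *: econtrl k (econtrl l a).

Lemma elam_is_linear w : linear (elam w).
Proof.
move=> x a b; rewrite /elam scalerA mulrC -scalerA -scalerDr; congr (_ *: _).
rewrite scaler_sumr -big_split; apply: eq_bigr => k _ /=.
rewrite scaler_sumr -big_split; apply: eq_bigr => l _ /=.
by rewrite !(econtrlD, econtrlZ) scalerDr !scalerA [x * _]mulrC.
Qed.
HB.instance Definition _ w := GRing.isLinear.Build R (ext R m) (ext R m) *:%R (elam w)
  (elam_is_linear w).

Lemma elamZ w (x : R) a : elam w (x *: a) = x *: elam w a.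
Proof. exact: linearZZ. Qed.

Lemma econtrl_elam w j a : econtrl j (elam w a) = elam w (econtrl j a).
Proof.
rewrite /elam econtrlZ; congr (_ *: _); rewrite linear_sum; apply: eq_bigr => k _ /=.
rewrite linear_sum; apply: eq_bigr => l _ /=.
rewrite econtrlZ; congr (_ *: _).
by rewrite econtrl_econtrl (econtrl_econtrl j l) linearN opprK.
Qed.

Lemma elam_ediag w f a : elam w (ediag f a) = ediag (f \o succn \o succn) (elam w a).
Proof.
rewrite /elam linearZZ; congr (_ *: _); rewrite linear_sum; apply: eq_bigr => k _ /=.
rewrite linear_sum; apply: eq_bigr => l _ /=.
by rewrite linearZZ /= !econtrl_ediag.
Qed.

Lemma elam_sigma w a : elam w (sigma a) = sigma (elam w a).
Proof.
rewrite /sigma elam_ediag; apply/funext => K.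
by rewrite /ediag /= !exprS !mulN1r opprK.
Qed.

Lemma econtrr_elam w j a : econtrr j (elam w a) = elam w (econtrr j a).
Proof. by rewrite !econtrrE econtrl_elam elam_sigma. Qed.

Lemma elam_epull (J w w' : 'M[R]_m) a : w' = J^T *m w *m J ->
  elam w (epull J a) = epull J (elam w' a).
Proof.
move=> ->; rewrite /elam epullZ; congr (_ *: _); rewrite linear_sum /=.
under eq_bigr => k _.
  under eq_bigr => l _.
    rewrite econtrl_epull linear_sum /=.
    under eq_bigr => j _ do rewrite econtrlZ econtrl_epull.
    over.
  over.
under [RHS]eq_bigr => k _ do rewrite linear_sum /=.
under [RHS]eq_bigr => k _ do under eq_bigr => l _ do rewrite epullZ.
transitivity (\sum_k \sum_l \sum_j \sum_i (w k l * J l j * J k i) *: epull J (econtrl i (econtrl j a))).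
  apply: eq_bigr => k _; apply: eq_bigr => l _; rewrite scaler_sumr; apply: eq_bigr => j _.
  rewrite !scaler_sumr; apply: eq_bigr => i _; by rewrite !scalerA.
transitivity (\sum_i \sum_j \sum_k \sum_l (w k l * J l j * J k i) *: epull J (econtrl i (econtrl j a))).
  under eq_bigr => k _ do rewrite exchange_big /=.
  rewrite exchange_big /=.
  under eq_bigr => j _ do under eq_bigr => k _ do rewrite exchange_big /=.
  under eq_bigr => j _ do rewrite exchange_big /=.
  by rewrite exchange_big.
apply: eq_bigr => i _; apply: eq_bigr => j _.
under eq_bigr => k _ do rewrite -scaler_suml.
rewrite -scaler_suml; congr (_ *: _).
rewrite mxE exchange_big /=; apply: eq_bigr => l _.
rewrite mxE mulr_suml; apply: eq_bigr => k _.
by rewrite mxE; ring.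
Qed.

(** Each contraction with [w] lowers the degree by two. *)
Lemma elam_nilpotent w n a I : (m < #|I| + n.*2)%N -> iter n (elam w) a I = 0.
Proof.
elim: n I => [|n IH] I mI.
  by have := max_card (mem I); rewrite card_ord leqNgt -[#|I|]addn0 mI.
rewrite iterS {1}/elam -[LHS]/(2^-1 * _) !fct_sumE big1 ?mulr0// => k _.
rewrite fct_sumE big1// => l _; rewrite -[LHS]/(w k l * _) !econtrlE.
case: ifPn => kI; first by rewrite mulr0.
case: ifPn => lI; first by rewrite !mulr0.
by rewrite IH ?mulr0// !cardsU1 lI kI /= !add1n !addSn -!addnS -doubleS.
Qed.

Lemma iter_elam_eq0 w n a : (m < n.*2)%N -> iter n (elam w) a = 0.
Proof.
by move=> mn; apply/funext => I; apply: elam_nilpotent; rewrite (leq_trans mn)// leq_addl.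
Qed.

Definition ecross w a b : ext R m :=
  \sum_k \sum_l w k l *: ewedge (econtrr k a) (econtrl l b).

(** [elam w] is a second-order operator, and its failure to be a derivation is the
    first-order term of the quantum product. *)
Lemma elam_ewedge w a b : w^T = - w ->
  elam w (ewedge a b) = ewedge (elam w a) b + ewedge a (elam w b) - ecross w a b.
Proof.
move=> wN; have wA k l : w k l = - w l k by have /matrixP/(_ l k) := wN; rewrite !mxE.
have E k l : econtrl k (econtrl l (ewedge a b)) =
  ewedge (econtrl k (econtrl l a)) b + ewedge a (econtrl k (econtrl l b)) +
  (ewedge (econtrr l a) (econtrl k b) - ewedge (econtrr k a) (econtrl l b)).
  rewrite econtrl_ewedge linearD /= !econtrl_ewedge sigmaK !econtrrE.
  rewrite -[econtrl k (sigma a)]opprK -sigma_econtrl ewedgeNl.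
  by rewrite [X in _ + X]addrC addrACA.
rewrite {1}/elam.
under eq_bigr => k _ do under eq_bigr => l _ do rewrite E !scalerDr.
under eq_bigr => k _ do rewrite !big_split /=.
rewrite !big_split /= !scalerDr; congr (_ + _ + _).
- rewrite /elam ewedgeZl ewedge_suml; congr (_ *: _); apply: eq_bigr => k _.
  by rewrite ewedge_suml; apply: eq_bigr => l _; rewrite ewedgeZl.
- rewrite /elam ewedgeZr; congr (_ *: _); rewrite linear_sum; apply: eq_bigr => k _ /=.
  by rewrite linear_sum; apply: eq_bigr => l _ /=; rewrite ewedgeZr.
- have E2 : \sum_k \sum_l w k l *: ewedge (econtrr l a) (econtrl k b) = - ecross w a b.
    rewrite exchange_big -sumrN; apply: eq_bigr => k _; rewrite -sumrN.
    by apply: eq_bigr => l _; rewrite wA scaleNr.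
  have E3 : \sum_k \sum_l w k l *: - ewedge (econtrr k a) (econtrl l b) = - ecross w a b.
    rewrite -sumrN; apply: eq_bigr => k _; rewrite -sumrN.
    by apply: eq_bigr => l _; rewrite scalerN.
  by rewrite E2 E3 -scalerDl half_half scale1r.
Qed.

(** The coefficient of [h^n / n!] in the quantum product, at a point. *)
Definition ecross_iter w (n : nat) a b : ext R m :=
  \sum_(i : n.-tuple 'I_m) \sum_(j : n.-tuple 'I_m)
    (\prod_(t < n) w (tnth i t) (tnth j t)) *:
    ewedge (foldl (fun a k => econtrr k a) a i) (foldl (fun b k => econtrl k b) b j).

Lemma big_tuple_cons (V : zmodType) n (F : n.+1.-tuple 'I_m -> V) :
  \sum_t F t = \sum_k \sum_(t : n.-tuple 'I_m) F [tuple of k :: t].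
Proof.
rewrite pair_big_dep /= (reindex (fun p : 'I_m * n.-tuple 'I_m => [tuple of p.1 :: p.2])) //=.
exists (fun t => (thead t, [tuple of behead t])) => [[k t] _|t _] /=.
  by rewrite theadE; congr pair; apply: val_inj.
exact/esym/tuple_eta.
Qed.

Lemma ecross_iter0 w a b : ecross_iter w 0 a b = ewedge a b.
Proof.
rewrite /ecross_iter (big_pred1 [tuple]) => [|t]; last exact/esym/eqP/tuple0.
rewrite (big_pred1 [tuple]) => [|t]; last exact/esym/eqP/tuple0.
by rewrite big_ord0 scale1r.
Qed.

Lemma ecross_iterS w n a b : ecross_iter w n.+1 a b =
  \sum_k \sum_l w k l *: ecross_iter w n (econtrr k a) (econtrl l b).
Proof.
rewrite /ecross_iter big_tuple_cons; apply: eq_bigr => k _.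
under eq_bigr => i _ do rewrite big_tuple_cons.
rewrite exchange_big; apply: eq_bigr => l _ /=.
rewrite scaler_sumr; apply: eq_bigr => i _; rewrite scaler_sumr; apply: eq_bigr => j _.
rewrite scalerA big_ord_recl /= !tnth0; congr (_ * _ *: _).
by apply: eq_bigr => t _; rewrite !tnthS.
Qed.

(** Contractions commute with [elam w], so the formula of [elam_ewedge] propagates through
    the iterated products. *)
Lemma elam_ecross_iter w n a b : w^T = - w ->
  elam w (ecross_iter w n a b) =
  ecross_iter w n (elam w a) b + ecross_iter w n a (elam w b) - ecross_iter w n.+1 a b.
Proof.
move=> wN; elim: n a b => [|n IH] a b.
  rewrite ecross_iterS !ecross_iter0 elam_ewedge//; congr (_ - _).
  by apply: eq_bigr => k _; apply: eq_bigr => l _; rewrite ecross_iter0.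
rewrite [in LHS]ecross_iterS [X in X + _ - _]ecross_iterS [X in _ + X - _]ecross_iterS.
rewrite [X in _ - X]ecross_iterS linear_sum -sumrN -!big_split; apply: eq_bigr => k _ /=.
rewrite linear_sum /= -sumrN -!big_split; apply: eq_bigr => l _ /=.
by rewrite elamZ IH econtrr_elam econtrl_elam scalerBr scalerDr.
Qed.

Definition ehom (z : int) a := forall I, a I != 0 -> #|I|%:Z = z.

(** The matrix of a two-form in the frame. *)
Definition emx (om : ext R m) : 'M[R]_m :=
  \matrix_(i, j) econtrl j (econtrl i om) finset.set0.

Lemma emx_anti om : (emx om)^T = - emx om.
Proof. by apply/matrixP => i j; rewrite !mxE econtrl_econtrl. Qed.

Lemma invmx_anti (B : 'M[R]_m) : B \in unitmx -> B^T = - B ->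
  (invmx B)^T = - invmx B.
Proof.
move=> u BN; have E : - invmx B *m - B = 1%:M by rewrite mulNmx mulmxN opprK mulVmx.
have [_ u'] := mulmx1_unit E.
by rewrite trmx_inv BN -[RHS](mulmxK u') E mul1mx.
Qed.

Lemma econtrl_two_form om i : ehom 2 om -> econtrl i om = ecovec (fun j => emx om i j).
Proof.
move=> om2; apply/funext => I; rewrite /ecovec.
case: (boolP (#|I| == 1%N)) => [/cards1P[j ->]|I1].
  rewrite (big_pred1 j) => [|k]; last by rewrite /= (inj_eq set1_inj) eq_sym.
  rewrite mxE [RHS]econtrlE inE finset.setU0 /sgn.
  rewrite (_ : [set _ in _ | _]%SET = finset.set0) ?cards0 ?mul1r//.
  by apply/setP => k; rewrite !inE.
rewrite big1 => [|k /eqP E]; last by rewrite E cards1 in I1.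
rewrite econtrlE; case: ifPn => // iI.
have [->|/om2] := eqVneq (om (i |: I)%SET) 0; first by rewrite mulr0.
by rewrite cardsU1 iI add1n => -[E]; rewrite E in I1.
Qed.

Lemma sigma_two_form om : ehom 2 om -> sigma om = om.
Proof.
move=> om2; apply/funext => I; rewrite /sigma /ediag.
have [->|/om2 [->]] := eqVneq (om I) 0; first by rewrite mulr0.
by rewrite expr2 mulrNN mul1r mul1r.
Qed.

Lemma econtrl_emul_two_form om i a : ehom 2 om ->
  econtrl i (ewedge om a) = ewedge om (econtrl i a) + \sum_j emx om i j *: emul j a.
Proof.
by move=> om2; rewrite econtrl_ewedge econtrl_two_form// ewedge_ecovec sigma_two_form// addrC.
Qed.

(** [e^i /\ (e_i |- _)] is the projection onto the components whose index contains [i]. *)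
Lemma emul_econtrl_sum a : \sum_i emul i (econtrl i a) = ediag (fun n => n%:R) a.
Proof.
apply/funext => K; rewrite fct_sumE /ediag.
rewrite (bigID (mem K)) /= [X in _ + X]big1 ?addr0; last by move=> i /negbTE iK; rewrite /emul iK.
rewrite (eq_bigr (fun=> a K)) => [|i iK]; first by rewrite sumr_const mulr_natl.
by rewrite /emul iK econtrlE !inE eqxx finset.setD1K// sgnD// /ltsgn ltnn mul1r mulrA sgn2 mul1r.
Qed.

(** The sl2 relation between the Lefschetz operator and its adjoint. A contraction that
    falls on [om] leaves a covector [emx om k]; as the other contraction is weighted by the
    inverse matrix, what is left are the sums of [e_k |- (e^k /\ a)] and of
    [e^k /\ (e_k |- a)], that is the codegree and the degree. *)
Lemma elam_two_form om a : ehom 2 om -> emx om \in unitmx ->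
  elam (invmx (emx om)) (ewedge om a) =
  ewedge om (elam (invmx (emx om)) a) + ((m%:R / 2) *: a - ediag (fun n => n%:R) a).
Proof.
move=> om2 u; set w := invmx _.
have wA k l : w k l = - w l k.
  have wN : w^T = - w by exact: invmx_anti u (emx_anti om).
  by have /matrixP/(_ l k) := wN; rewrite [LHS]mxE [RHS]mxE.
have E k l : econtrl k (econtrl l (ewedge om a)) = ewedge om (econtrl k (econtrl l a))
   + (\sum_j emx om k j *: emul j (econtrl l a) + \sum_j emx om l j *: econtrl k (emul j a)).
  rewrite econtrl_emul_two_form// linearD /= econtrl_emul_two_form// -addrA; congr (_ + (_ + _)).
  by rewrite [LHS]linear_sum; apply: eq_bigr => j _; rewrite [LHS]econtrlZ.
have wom k j : \sum_l w k l * emx om l j = (k == j)%:R.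
  by have := mulVmx u => /matrixP/(_ k j); rewrite !mxE.
have E1 : \sum_k \sum_l w k l *: \sum_j emx om l j *: econtrl k (emul j a) =
    \sum_k econtrl k (emul k a).
  apply: eq_bigr => k _.
  under eq_bigr => l _ do rewrite scaler_sumr.
  rewrite exchange_big /= (bigD1 k)//= [X in _ + X]big1.
    rewrite addr0; under eq_bigr => l _ do rewrite scalerA.
    by rewrite -scaler_suml wom eqxx scale1r.
  move=> j jk; under eq_bigr => l _ do rewrite scalerA.
  by rewrite -scaler_suml wom eq_sym (negbTE jk) scale0r.
have E2 : \sum_k \sum_l w k l *: \sum_j emx om k j *: emul j (econtrl l a) =
    - \sum_k emul k (econtrl k a).
  rewrite exchange_big -sumrN; apply: eq_bigr => l _ /=.
  under eq_bigr => k _ do rewrite scaler_sumr.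
  rewrite exchange_big /= (bigD1 l)//= [X in _ + X]big1.
    rewrite addr0; under eq_bigr => k _ do rewrite scalerA wA mulNr.
    by rewrite -scaler_suml sumrN wom eqxx scaleN1r.
  move=> j jl; under eq_bigr => k _ do rewrite scalerA wA mulNr.
  by rewrite -scaler_suml sumrN wom eq_sym (negbTE jl) oppr0 scale0r.
have E3 : \sum_k econtrl k (emul k a) = m%:R *: a - \sum_k emul k (econtrl k a).
  rewrite (eq_bigr (fun k => a - emul k (econtrl k a))) => [|k _]; last by rewrite econtrl_emul eqxx.
  by rewrite sumrB sumr_const card_ord scaler_nat.
rewrite {1}/elam.
under eq_bigr => k _ do under eq_bigr => l _ do rewrite E scalerDr scalerDr.
under eq_bigr => k _ do rewrite !big_split /=.
rewrite !big_split /= E1 E2 E3 scalerDr; congr (_ + _).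
  rewrite /elam ewedgeZr; congr (_ *: _); rewrite linear_sum; apply: eq_bigr => k _ /=.
  by rewrite linear_sum; apply: eq_bigr => l _ /=; rewrite ewedgeZr.
rewrite addrCA -opprD scalerBr scalerA [2^-1 * _]mulrC scalerDr -scalerDl half_half scale1r.
by rewrite -emul_econtrl_sum.
Qed.

End bivector.

(** * Forms on an open subset of the coordinate space *)

Section local_forms.
Context (R : realType) (m : nat).
Implicit Types (a b : 'rV[R]_m -> ext R m) (U : set 'rV[R]_m) (y : 'rV[R]_m).

Definition smooth_field U a := forall I, smooth_on U (fun y => a y I : R).

Definition derivable_field a y :=
  forall i I, derivable (fun z => a z I : R) y (delta_mx 0 i).

Definition pd i a y : ext R m := fun I => 'D_(delta_mx 0 i) (fun z => a z I : R) y.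

(** The exterior derivative in coordinates. *)
Definition dloc a y : ext R m := \sum_i emul i (pd i a y).

Definition dfun (g : 'rV[R]_m -> R) y : ext R m := ecovec (fun i => 'D_(delta_mx 0 i) g y).

Lemma smooth_field_derivable U a y : smooth_field U a -> U y -> derivable_field a y.
Proof. by move=> sa Uy i I; exact: smooth_derivable (sa I) Uy. Qed.

Lemma pd_near i a b y : (\near y, a y = b y) -> pd i a y = pd i b y.
Proof.
move=> ab; apply/funext => I; apply: near_eq_derive.
by apply: filterS ab => z ->.
Qed.

Lemma dloc_near a b y : (\near y, a y = b y) -> dloc a y = dloc b y.
Proof. by move=> ab; apply: eq_bigr => i _; rewrite (pd_near i ab). Qed.

Lemma is_derive_sumT (V : normedModType R) (T : finType) (f : T -> V -> R) (df : T -> R) (x v : V) :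
  (forall t, is_derive x v (f t) (df t)) ->
  is_derive x v (fun z => \sum_t f t z) (\sum_t df t).
Proof.
move=> H; have -> : (fun z => \sum_t f t z) = \sum_t f t.
  by apply/funext => z; rewrite fct_sumE.
apply: (big_ind2 (fun g dg => is_derive x v g dg)) => //.
- exact: is_derive_cst.
- by move=> g dg h dh Hg Hh; exact: is_deriveD.
Qed.

Lemma is_derive_pd i a y I : derivable_field a y ->
  is_derive y (delta_mx 0 i) (fun z => a z I : R) (pd i a y I).
Proof. by move=> da; apply: derivableP; exact: da. Qed.

(** Linear operators on the finite-dimensional exterior algebra are given by matrices, hence
    preserve smoothness and commute with partial derivatives. *)
Lemma linear_ext_entry (T : {linear ext R m -> ext R m}) (a : ext R m) K :
  T a K = \sum_I T (edelta R I) K * a I.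
Proof.
rewrite {1}(ext_sum_edelta a) linear_sum fct_sumE; apply: eq_bigr => I _.
by rewrite linearZZ -[LHS]/(_ * _) mulrC.
Qed.

Lemma is_derive_linear_ext (T : {linear ext R m -> ext R m}) i a y K :
  derivable_field a y ->
  is_derive y (delta_mx 0 i) (fun z => T (a z) K : R) (T (pd i a y) K).
Proof.
move=> da; have -> : (fun z => T (a z) K : R) = (fun z => \sum_I T (edelta R I) K * a z I).
  by apply/funext => z; rewrite linear_ext_entry.
rewrite linear_ext_entry; apply: is_derive_sumT => I.
exact: (is_deriveZ (f := fun z => a z I : R) _ (is_derive_pd i I da)).
Qed.

Lemma pd_linear (T : {linear ext R m -> ext R m}) i a y :
  derivable_field a y -> pd i (fun z => T (a z)) y = T (pd i a y).
Proof.
by move=> da; apply/funext => K; have [_] := is_derive_linear_ext T i K da.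
Qed.

Lemma derivable_field_linear (T : {linear ext R m -> ext R m}) a y :
  derivable_field a y -> derivable_field (fun z => T (a z)) y.
Proof. by move=> da i K; have [] := is_derive_linear_ext T i K da. Qed.

Lemma smooth_linear (T : {linear ext R m -> ext R m}) U a : open U ->
  smooth_field U a -> smooth_field U (fun z => T (a z)).
Proof.
move=> oU sa K; have -> : (fun z => T (a z) K : R) = (fun z => \sum_I T (edelta R I) K * a z I).
  by apply/funext => z; rewrite linear_ext_entry.
by apply: smooth_sum => // I _; apply: smoothM => //; exact: smooth_cst.
Qed.

Lemma smooth_fieldD U a b : open U -> smooth_field U a -> smooth_field U b ->
  smooth_field U (fun y => a y + b y).
Proof. by move=> oU sa sb I; exact: smoothD (sa I) (sb I). Qed.

Lemma smooth_fieldZ U (g : 'rV[R]_m -> R) a : open U -> smooth_on U g -> smooth_field U a ->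
  smooth_field U (fun y => g y *: a y).
Proof. by move=> oU sg sa I; exact: smoothM sg (sa I). Qed.

Lemma smooth_field_sum (T : Type) (r : seq T) (P : pred T) U (F : T -> 'rV[R]_m -> ext R m) :
  open U -> (forall t, P t -> smooth_field U (F t)) ->
  smooth_field U (fun y => \sum_(t <- r | P t) F t y).
Proof.
move=> oU sF I; have -> : (fun y => (\sum_(t <- r | P t) F t y) I : R) =
    (fun y => \sum_(t <- r | P t) F t y I) by apply/funext => y; rewrite fct_sumE.
by apply: smooth_sum => // t Pt; exact: sF.
Qed.

Lemma smooth_ewedge U a b : open U -> smooth_field U a -> smooth_field U b ->
  smooth_field U (fun y => ewedge (a y) (b y)).
Proof.
move=> oU sa sb K; apply: smooth_sum => // I _.
by do 2?apply: smoothM => //; exact: smooth_cst.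
Qed.

Lemma is_derive_ewedge i a b y K : derivable_field a y -> derivable_field b y ->
  is_derive y (delta_mx 0 i) (fun z => ewedge (a z) (b z) K : R)
    ((ewedge (pd i a y) (b y) + ewedge (a y) (pd i b y)) K).
Proof.
move=> da db.
have -> : (ewedge (pd i a y) (b y) + ewedge (a y) (pd i b y)) K =
  \sum_(I : {set 'I_m}) (if I \subset K then inversions R I (K :\: I)%SET else 0) *
    (a y I * pd i b y (K :\: I)%SET + b y (K :\: I)%SET * pd i a y I).
  rewrite !fctE !ewedgeE -big_split big_mkcond; apply: eq_bigr => I _ /=.
  by case: ifP => _; [ring | rewrite mul0r].
have -> : (fun z => ewedge (a z) (b z) K : R) = fun z =>
  \sum_(I : {set 'I_m}) (if I \subset K then inversions R I (K :\: I)%SET else 0) *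
    (a z I * b z (K :\: I)%SET).
  apply/funext => z; rewrite ewedgeE big_mkcond; apply: eq_bigr => I _ /=.
  by case: ifP => _; [ring | rewrite mul0r].
apply: is_derive_sumT => I.
apply: (is_deriveZ (f := fun z => a z I * b z (K :\: I)%SET : R)).
exact: (is_deriveM (f := fun z => a z I : R) (g := fun z => b z (K :\: I)%SET : R)
   (is_derive_pd i I da) (is_derive_pd i _ db)).
Qed.

Lemma pd_ewedge i a b y : derivable_field a y -> derivable_field b y ->
  pd i (fun z => ewedge (a z) (b z)) y = ewedge (pd i a y) (b y) + ewedge (a y) (pd i b y).
Proof.
by move=> da db; apply/funext => K; have [_] := is_derive_ewedge i K da db.
Qed.

(** The sign comes from moving [e^i] past the first factor. *)
Lemma dloc_ewedge a b y : derivable_field a y -> derivable_field b y ->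
  dloc (fun z => ewedge (a z) (b z)) y =
  ewedge (dloc a y) (b y) + ewedge (sigma (a y)) (dloc b y).
Proof.
move=> da db; rewrite /dloc ewedge_suml linear_sum -big_split; apply: eq_bigr => i _ /=.
by rewrite pd_ewedge// linearD /= -ewedge_emull emul_ewedge.
Qed.

Lemma pdD i a b y : derivable_field a y -> derivable_field b y ->
  pd i (fun z => a z + b z) y = pd i a y + pd i b y.
Proof. by move=> da db; apply/funext => I; apply: deriveD; [exact: da | exact: db]. Qed.

Lemma pd_sum (T : finType) i (F : T -> 'rV[R]_m -> ext R m) y :
  (forall t, derivable_field (F t) y) ->
  pd i (fun z => \sum_t F t z) y = \sum_t pd i (F t) y.
Proof.
move=> dF; apply/funext => I; rewrite fct_sumE.
have H : is_derive y (delta_mx 0 i) (fun z => \sum_t F t z I : R) (\sum_t pd i (F t) y I).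
  by apply: is_derive_sumT => t; exact: is_derive_pd.
have E : (fun z => \sum_t F t z I : R) = (fun z => (\sum_t F t z) I : R).
  by apply/funext => z; rewrite fct_sumE.
by rewrite E in H; have [_] := H.
Qed.

Lemma dlocD a b y : derivable_field a y -> derivable_field b y ->
  dloc (fun z => a z + b z) y = dloc a y + dloc b y.
Proof.
move=> da db; rewrite /dloc -big_split; apply: eq_bigr => i _ /=.
by rewrite pdD// linearD.
Qed.

Lemma dloc_linear_anti (T T' : {linear ext R m -> ext R m}) a y :
  (forall i (b : ext R m), T (emul i b) = emul i (T' b)) -> derivable_field a y ->
  T (dloc a y) = dloc (fun z => T' (a z)) y.
Proof.
move=> TT da; rewrite /dloc linear_sum; apply: eq_bigr => i _ /=.
by rewrite TT pd_linear.
Qed.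

Lemma smooth_dloc U a : open U -> smooth_field U a -> smooth_field U (dloc a).
Proof.
move=> oU sa; apply: smooth_field_sum => // i _; apply: smooth_linear => // I.
exact: smooth_D (sa I).
Qed.

(** Partial derivatives commute while exterior multiplications anticommute, so the double
    sum equals its opposite. *)
Lemma dloc_dloc U a y : open U -> smooth_field U a -> U y -> dloc (dloc a) y = 0.
Proof.
move=> oU sa Uy; have spd i : smooth_field U (pd i a) by move=> I; exact: smooth_D (sa I).
have E i : pd i (dloc a) y = \sum_j emul j (pd i (pd j a) y).
  rewrite [LHS]pd_sum => [|j].
    by apply: eq_bigr => j _; rewrite pd_linear//; exact: smooth_field_derivable (spd j) Uy.
  apply: derivable_field_linear; exact: smooth_field_derivable (spd j) Uy.
have sym i j : pd i (pd j a) y = pd j (pd i a) y.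
  by apply/funext => I; exact: (smooth_mixed_partials oU j i (sa I) Uy).
have S : dloc (dloc a) y = \sum_i \sum_j emul i (emul j (pd i (pd j a) y)).
  by apply: eq_bigr => i _; rewrite E linear_sum.
have : dloc (dloc a) y = - dloc (dloc a) y.
  rewrite {2}S exchange_big S -sumrN; apply: eq_bigr => i _ /=; rewrite -sumrN.
  apply: eq_bigr => j _; by rewrite emul_emul sym.
move=> /eqP; rewrite -addr_eq0 -mulr2n -scaler_nat scaler_eq0 pnatr_eq0 /= => /eqP.
by [].
Qed.

Lemma is_derive_scale_field i (g : 'rV[R]_m -> R) a y I :
  derivable g y (delta_mx 0 i) -> derivable_field a y ->
  is_derive y (delta_mx 0 i) (fun z => (g z *: a z) I : R)
   (g y * pd i a y I + 'D_(delta_mx 0 i) g y * a y I).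
Proof.
move=> dg da; rewrite [X in _ + X]mulrC.
exact: (is_deriveM (f := g) (g := fun z => a z I : R) (derivableP dg) (is_derive_pd i I da)).
Qed.

Lemma dloc_scale (g : 'rV[R]_m -> R) a y :
  (forall i, derivable g y (delta_mx 0 i)) -> derivable_field a y ->
  dloc (fun z => g z *: a z) y = ewedge (dfun g y) (a y) + g y *: dloc a y.
Proof.
move=> dg da; rewrite /dloc /dfun ewedge_ecovec scaler_sumr -big_split.
apply: eq_bigr => i _ /=; rewrite -!emulZ -linearD; congr (emul i _).
by apply/funext => I; rewrite addrC; have [_] := is_derive_scale_field I (dg i) da.
Qed.

Lemma derivable_scale_field (g : 'rV[R]_m -> R) a y :
  (forall i, derivable g y (delta_mx 0 i)) -> derivable_field a y ->
  derivable_field (fun z => g z *: a z) y.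
Proof. by move=> dg da i I; have [] := is_derive_scale_field I (dg i) da. Qed.

End local_forms.

(** * Naturality of the exterior derivative *)

Section pullback.
Context (R : realType) (m : nat) (W : set 'rV[R]_m) (phi : 'rV[R]_m -> 'rV[R]_m).
Hypothesis oW : open W.
Hypothesis sphi : forall j, smooth_on W (fun y => phi y 0 j).

Lemma smooth_map_differentiable y : W y -> differentiable phi y.
Proof.
by move=> Wy; apply: differentiable_row => j; exact: smooth_differentiable (sphi j) Wy.
Qed.

Lemma jacobian_covec y j : W y ->
  ecovec (fun i => jacobian phi y i j) = dfun (fun z => phi z 0 j) y.
Proof.
move=> Wy; congr ecovec; apply/funext => i.
by rewrite jacobian_entry//; exact: smooth_map_differentiable.
Qed.

Lemma smooth_dfun (g : 'rV[R]_m -> R) : smooth_on W g -> smooth_field W (dfun g).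
Proof.
move=> sg I; rewrite /dfun /ecovec.
by apply: smooth_sum => // i _; exact: smooth_D.
Qed.

(** [dfun g] is the exterior derivative of the form [g *: 1]. *)
Lemma dloc_dfun (g : 'rV[R]_m -> R) y : smooth_on W g -> W y -> dloc (dfun g) y = 0.
Proof.
move=> sg Wy.
have s1 : smooth_field W (fun=> @eone R m) by move=> I; exact: smooth_cst.
have sg1 : smooth_field W (fun z => g z *: @eone R m) by exact: smooth_fieldZ.
rewrite -(dloc_dloc oW sg1 Wy); apply: dloc_near.
have : nbhs y W by exact: open_nbhs_nbhs.
apply: filterS => z Wz; rewrite dloc_scale.
- rewrite ewedge1r /dloc big1 ?scaler0 ?addr0// => i _.
  rewrite (_ : pd _ _ _ = 0) ?linear0//; apply/funext => I.
  exact: derive_cst.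
- by move=> i; exact: smooth_derivable Wz.
- exact: smooth_field_derivable Wz.
Qed.

Lemma smooth_ecovecs s : smooth_field W (fun y => ecovecs (jacobian phi y) s).
Proof.
elim: s => [|j s IH] I; first exact: smooth_cst.
apply: (smooth_ext oW (f := fun y => ewedge (dfun (fun z => phi z 0 j) y) (ecovecs (jacobian phi y) s) I)).
  by move=> y; rewrite in_setE => Wy /=; rewrite jacobian_covec.
by apply: smooth_ewedge => //; exact: smooth_dfun.
Qed.

(** A product of exact 1-forms is closed. *)
Lemma dloc_ecovecs s y : W y -> dloc (fun y => ecovecs (jacobian phi y) s) y = 0.
Proof.
move=> Wy; elim: s => [|j s IH].
  rewrite /dloc big1// => i _; rewrite (_ : pd _ _ _ = 0) ?linear0//.
  by apply/funext => I; exact: derive_cst.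
rewrite (@dloc_near _ _ _ (fun y => ewedge (dfun (fun z => phi z 0 j) y) (ecovecs (jacobian phi y) s))).
  rewrite dloc_ewedge; first by rewrite dloc_dfun// ewedge0l IH linear0 addr0.
    exact: smooth_field_derivable (smooth_dfun (sphi j)) Wy.
  exact: smooth_field_derivable (smooth_ecovecs s) Wy.
have : nbhs y W by exact: open_nbhs_nbhs.
by apply: filterS => z Wz /=; rewrite jacobian_covec.
Qed.

(** The pull-back of [b] is the sum of the products of the functions [b I \o phi] with
    products of the 1-forms [d phi^j]. The latter are closed, so only the functions are
    differentiated, by the chain rule. *)
Lemma dloc_epull (V : set 'rV[R]_m) (b : 'rV[R]_m -> ext R m) y :
  open V -> smooth_field V b -> W y -> V (phi y) ->
  dloc (fun z => epull (jacobian phi z) (b (phi z))) y =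
  epull (jacobian phi y) (dloc b (phi y)).
Proof.
move=> oV sb Wy Vy; set J := jacobian phi.
have dphi := smooth_map_differentiable Wy.
have db I : differentiable (fun z => b z I : R) (phi y) by exact: smooth_differentiable (sb I) Vy.
have ch I i : is_derive y (delta_mx 0 i) (fun z => b (phi z) I : R)
    (\sum_j pd j b (phi y) I * J y i j).
  apply: is_derive_eq (chain_rule _ dphi (db I)) _.
  by apply: eq_bigr => j _; rewrite jacobian_entry.
have dch I i : derivable (fun z => b (phi z) I : R) y (delta_mx 0 i) by have [] := ch I i.
have dT I : derivable_field (fun z => ecovecs (J z) (enum I)) y.
  exact: smooth_field_derivable (smooth_ecovecs _) Wy.
have dbT I : derivable_field (fun z => b (phi z) I *: ecovecs (J z) (enum I)) y.
  exact: (derivable_scale_field (g := fun z => b (phi z) I)).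
have -> : (fun z => epull (J z) (b (phi z))) =
    fun z => \sum_I b (phi z) I *: ecovecs (J z) (enum I).
  by apply/funext => z; rewrite epullE.
rewrite /dloc linear_sum /=.
under eq_bigr => i _ do rewrite pd_sum// linear_sum.
rewrite exchange_big /=.
transitivity (\sum_I \sum_j pd j b (phi y) I *: ewedge (ecovec (fun i => J y i j)) (ecovecs (J y) (enum I))).
  apply: eq_bigr => I _.
  rewrite -/(dloc (fun z => b (phi z) I *: ecovecs (J z) (enum I)) y).
  rewrite dloc_scale// dloc_ecovecs// scaler0 addr0.
  rewrite /dfun ewedge_ecovec; under [RHS]eq_bigr => j _ do rewrite ewedge_ecovec scaler_sumr.
  rewrite exchange_big /=; apply: eq_bigr => i _.
  have [_ ->] := ch I i; rewrite scaler_suml; apply: eq_bigr => j _.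
  by rewrite scalerA.
rewrite exchange_big; apply: eq_bigr => j _ /=.
rewrite epull_emul epullE linear_sum /=; apply: eq_bigr => I _.
by rewrite ewedgeZr.
Qed.

End pullback.

Section smooth_matrices.
Context (R : realType) (m : nat) (U : set 'rV[R]_m).
Hypothesis oU : open U.

Lemma smooth_det n (F : 'rV[R]_m -> 'M[R]_n) :
  (forall i j, smooth_on U (fun y => F y i j)) -> smooth_on U (fun y => \det (F y)).
Proof.
move=> sF; apply: smooth_sum => // s _; apply: smoothM => //; first exact: smooth_cst.
by apply: smooth_prod => // i _; exact: sF.
Qed.

(** Cramer's formula. *)
Lemma smooth_invmx n (F : 'rV[R]_m -> 'M[R]_n) :
  (forall i j, smooth_on U (fun y => F y i j)) -> (forall y, U y -> F y \in unitmx) ->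
  forall i j, smooth_on U (fun y => invmx (F y) i j).
Proof.
move=> sF uF i j.
apply: (smooth_ext oU (f := fun y => (\det (F y))^-1 * ((-1) ^+ (j + i) * \det (row' j (col' i (F y)))))).
  by move=> y; rewrite in_setE => Uy; rewrite /invmx uF// !mxE.
apply: smoothM => //.
  apply: smoothV => //; last exact: smooth_det.
  by move=> y Uy; rewrite -unitfE -unitmxE uF.
apply: smoothM => //; first exact: smooth_cst.
apply: smooth_det => k l.
by apply: smooth_ext (sF (lift j k) (lift i l)) => // y _; rewrite !mxE.
Qed.

End smooth_matrices.

(** * Differential forms on a manifold *)

Local Notation coord := Defs.coord.

Section forms.
Context (R : realType) (m : nat) (M : topologicalType) (A : atlas R m M).
Implicit Types (alpha beta : pform A) (c : chart A) (x : M).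

Local Notation cimage c := (coord c @` dom c).
Local Notation overlap c c' := (coord c @` (dom c `&` dom c')).
Local Notation transition c c' := (fun y => coord c' (param c y)).
Local Notation field alpha c := (fun y => alpha c (param c y)).

Lemma coord_param c y : cimage c y -> dom c (param c y) /\ coord c (param c y) = y.
Proof. by move=> [x cx <-]; rewrite coordK. Qed.

Lemma coord_image c x : dom c x -> cimage c (coord c x).
Proof. by move=> cx; exists x. Qed.

Lemma open_overlap c c' : open (overlap c c').
Proof.
rewrite openE => y [x [cx cx'] xy].
have iy : cimage c y by exists x.
have n1 : nbhs y (cimage c) by apply: open_nbhs_nbhs; split => //; exact: coord_open.
have n2 : nbhs y (param c @^-1` dom c').
  apply: (param_continuous iy); apply: open_nbhs_nbhs; split; first exact: dom_open.
  by rewrite -xy coordK.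
apply: filterS (filterI n1 n2) => z [[x' cx1 <-]] /=.
by rewrite coordK// => cx2; exists x'.
Qed.

Lemma pform_eq alpha beta :
  (forall c x, ~ dom c x -> alpha c x = beta c x) ->
  (forall c x, dom c x -> alpha c x = beta c x) -> alpha = beta.
Proof.
move=> H1 H2; apply/funext => c; apply/funext => x.
by have [/H2|/H1] := pselect (dom c x).
Qed.

Lemma pformDE alpha beta c x : (alpha + beta) c x = alpha c x + beta c x.
Proof. by []. Qed.

Lemma pformZE (k : R) alpha c x : (k *: alpha) c x = k *: alpha c x.
Proof. by []. Qed.

Lemma form_out alpha c x : is_form alpha -> ~ dom c x -> alpha c x = 0.
Proof. by move=> [+ _ _]; apply. Qed.

Lemma form_smooth alpha c : is_form alpha -> smooth_field (cimage c) (field alpha c).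
Proof. by move=> [_ + _] I; apply. Qed.

Lemma form_derivable alpha c x : is_form alpha -> dom c x ->
  derivable_field (field alpha c) (coord c x).
Proof.
move=> /form_smooth s cx; exact: smooth_field_derivable (s c) (coord_image cx).
Qed.

Lemma form_change alpha c c' x : is_form alpha -> dom c x -> dom c' x ->
  alpha c x = epull (jacobian (transition c c') (coord c x)) (alpha c' x).
Proof. by move=> [_ _]; apply. Qed.

(** In a chart, only the values on the domain matter: smoothness may be tested on any field
    that represents the components there. *)
Lemma is_formI alpha :
  (forall c x, ~ dom c x -> alpha c x = 0) ->
  (forall c, exists2 a, smooth_field (cimage c) a & forall x, dom c x -> alpha c x = a (coord c x)) ->
  (forall c c' x, dom c x -> dom c' x ->
      alpha c x = epull (jacobian (transition c c') (coord c x)) (alpha c' x)) ->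
  is_form alpha.
Proof.
move=> H1 H2 H3; split=> // c I; have [a sa aE] := H2 c.
apply: (smooth_ext (@coord_open _ _ _ A c) _ (sa I)) => y; rewrite in_setE => /coord_param[cy yE].
by rewrite aE// yE.
Qed.

Lemma dformE alpha c x : dom c x -> dform alpha c x = dloc (field alpha c) (coord c x).
Proof.
move=> cx; apply/funext => K; rewrite /dform ifT ?in_setE//.
rewrite /dloc fct_sumE; apply: eq_bigr => i _.
rewrite ewedge_ecovec (bigD1 i)//= eqxx scale1r big1 ?addr0// => j /negbTE->.
by rewrite scale0r.
Qed.

Lemma dform_out alpha c x : ~ dom c x -> dform alpha c x = 0.
Proof. by move=> cx; apply/funext => K; rewrite /dform ifF// memNset. Qed.

Lemma transition_smooth_on c c' j : smooth_on (overlap c c') (fun y => transition c c' y 0 j).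
Proof. exact: transition_smooth. Qed.

Lemma overlap_change alpha c c' y : is_form alpha -> overlap c c' y ->
  field alpha c y = epull (jacobian (transition c c') y) (field alpha c' (transition c c' y)).
Proof.
move=> fa [x [cx cx'] <-] /=; rewrite !coordK//.
exact: form_change.
Qed.

(** The components in two charts are pull-backs of each other on the overlap, and the
    exterior derivative is natural. *)
Lemma is_form_dform alpha : is_form alpha -> is_form (dform alpha).
Proof.
move=> fa; apply: is_formI => [c x|c|c c' x cx cx']; first exact: dform_out.
  exists (dloc (field alpha c)); last by move=> x; exact: dformE.
  by apply: smooth_dloc; [exact: coord_open | exact: form_smooth].
rewrite !dformE//.
have oW := @open_overlap c c'.
have Wx : overlap c c' (coord c x) by exists x.
rewrite (@dloc_near _ _ _ (fun y => epull (jacobian (transition c c') y)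
   (field alpha c' (transition c c' y)))); last first.
  have : nbhs (coord c x) (overlap c c') by exact: open_nbhs_nbhs.
  by apply: filterS => y; exact: overlap_change.
have E : transition c c' (coord c x) = coord c' x by rewrite coordK.
rewrite (dloc_epull oW (@transition_smooth_on c c') (V := cimage c') (b := field alpha c')) ?E//.
- exact: coord_open.
- exact: form_smooth.
Qed.

Lemma is_form0 : is_form (0 : pform A).
Proof.
apply: is_formI => // [c|c c' x _ _]; last by rewrite linear0.
by exists (fun=> 0) => // I; apply: smooth_cst; exact: coord_open.
Qed.

Lemma is_formD alpha beta : is_form alpha -> is_form beta -> is_form (alpha + beta).
Proof.
move=> fa fb; apply: is_formI => [c x cx|c|c c' x cx cx'].
- by rewrite !pformDE !form_out// addr0.
- exists (fun y => field alpha c y + field beta c y).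
    by apply: smooth_fieldD; [exact: coord_open | exact: form_smooth..].
  by move=> x cx; rewrite !pformDE /= coordK.
- by rewrite !pformDE linearD /= -!form_change.
Qed.

Lemma is_formZ (k : R) alpha : is_form alpha -> is_form (k *: alpha).
Proof.
move=> fa; apply: is_formI => [c x cx|c|c c' x cx cx'].
- by rewrite pformZE form_out// scaler0.
- exists (fun y => k *: field alpha c y).
    have oc := @coord_open _ _ _ A c.
    by apply: smooth_fieldZ => //; [exact: smooth_cst | exact: form_smooth].
  by move=> x cx; rewrite /= coordK.
- by rewrite !pformZE epullZ -form_change.
Qed.

Lemma is_formN alpha : is_form alpha -> is_form (- alpha).
Proof. by rewrite -scaleN1r; exact: is_formZ. Qed.

Lemma is_formB alpha beta : is_form alpha -> is_form beta -> is_form (alpha - beta).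
Proof. by move=> fa /is_formN; exact: is_formD. Qed.

Lemma is_form_fwedge alpha beta : is_form alpha -> is_form beta -> is_form (fwedge alpha beta).
Proof.
move=> fa fb; apply: is_formI => [c x cx|c|c c' x cx cx'].
- by rewrite /fwedge form_out// ewedge0l.
- exists (fun y => ewedge (field alpha c y) (field beta c y)).
    by apply: smooth_ewedge; [exact: coord_open | exact: form_smooth..].
  by move=> x cx; rewrite /= coordK.
- by rewrite /fwedge epull_ewedge -!form_change.
Qed.

Definition fdiag (f : nat -> R) alpha : pform A := fun c x => ediag f (alpha c x).

Lemma is_form_fdiag f alpha : is_form alpha -> is_form (fdiag f alpha).
Proof.
move=> fa; apply: is_formI => [c x cx|c|c c' x cx cx'].
- by rewrite /fdiag form_out// linear0.
- exists (fun y => ediag f (field alpha c y)).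
    by apply: smooth_linear; [exact: coord_open | exact: form_smooth..].
  by move=> x cx; rewrite /fdiag /= coordK.
- by rewrite /fdiag epull_ediag -!form_change.
Qed.

Definition fone : pform A := fun c x => if x \in dom c then @eone R m else 0.

Lemma fone_in c x : dom c x -> fone c x = @eone R m.
Proof. by move=> cx; rewrite /fone ifT ?in_setE. Qed.

Lemma is_form_fone : is_form fone.
Proof.
apply: is_formI => [c x cx|c|c c' x cx cx'].
- by rewrite /fone ifF// memNset.
- exists (fun=> @eone R m) => [I|x]; last exact: fone_in.
  by apply: smooth_cst; exact: coord_open.
- by rewrite !fone_in// epull1.
Qed.

Section poisson.
Variable omega : pform A.
Hypothesis sympl : symplectic omega.

Lemma omega_form : is_form omega. Proof. by case: sympl => -[]. Qed.

Lemma omega_unit c x : dom c x -> omega_mx omega c x \in unitmx.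
Proof. by case: sympl => _ _; apply. Qed.

Lemma omega_two c x : ehom 2 (omega c x).
Proof. by case: sympl => -[_ +] _ _ I; apply. Qed.

Lemma omega_mxE c x : omega_mx omega c x = emx (omega c x).
Proof. by apply/matrixP => i j; rewrite !mxE. Qed.

Lemma wcontrE alpha c x : wcontr omega alpha c x = elam (poisson_mx omega c x) (alpha c x).
Proof. by []. Qed.

Lemma emx_epull (J : 'M[R]_m) (a : ext R m) : emx (epull J a) = J *m emx a *m J^T.
Proof.
apply/matrixP => i j; rewrite !mxE econtrl_epull linear_sum fct_sumE /=.
transitivity (\sum_k \sum_l J i k * J j l * econtrl l (econtrl k a) finset.set0).
  apply: eq_bigr => k _; rewrite econtrlZ econtrl_epull scaler_sumr fct_sumE.
  apply: eq_bigr => l _; rewrite scalerA.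
  by rewrite -[LHS]/(J i k * J j l * epull J (econtrl l (econtrl k a)) finset.set0) epull_set0.
rewrite exchange_big; apply: eq_bigr => l _ /=; rewrite !mxE mulr_suml.
by apply: eq_bigr => k _; rewrite !mxE mulrAC.
Qed.

(** The matrix of [omega] changes by congruence, so its inverse changes by the inverse
    congruence: this is what makes [w] a bivector. *)
Lemma poisson_change c c' x : dom c x -> dom c' x ->
  let J := jacobian (transition c c') (coord c x) in
  poisson_mx omega c' x = J^T *m poisson_mx omega c x *m J.
Proof.
move=> cx cx' J; have E : omega_mx omega c x = J *m omega_mx omega c' x *m J^T.
  by rewrite !omega_mxE -emx_epull -form_change//; exact: omega_form.
have uc := omega_unit cx; have uc' := omega_unit cx'.
have /andP[uJ1 uJ] : (J *m omega_mx omega c' x \in unitmx) && (J^T \in unitmx).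
  by rewrite -unitmx_mul -E.
have uJJ : J \in unitmx by rewrite -unitmx_tr.
rewrite /poisson_mx; set Om := omega_mx omega c x in E uc *.
set Om' := omega_mx omega c' x in E uc' uJ1 *.
have JX : J *m (Om' *m (J^T *m invmx Om *m J)) = J.
  by rewrite !mulmxA -E mulmxV// mul1mx.
have X1 : Om' *m (J^T *m invmx Om *m J) = 1%:M.
  by rewrite -[LHS](mulKmx uJJ) JX mulVmx.
by rewrite -[RHS](mulKmx uc') X1 mulmx1.
Qed.

Lemma poisson_smooth c i j :
  smooth_on (cimage c) (fun y => poisson_mx omega c (param c y) i j).
Proof.
apply: smooth_invmx; first exact: coord_open.
  move=> k l; rewrite (_ : (fun y => _) = fun y => (@econtrl R m l \o @econtrl R m k)
      (omega c (param c y)) finset.set0); last by apply/funext => y; rewrite mxE.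
  apply: smooth_linear; first exact: coord_open.
  exact: form_smooth omega_form.
by move=> y /coord_param[cy _]; exact: omega_unit.
Qed.

Lemma is_form_wcontr alpha : is_form alpha -> is_form (wcontr omega alpha).
Proof.
move=> fa; have oc c := @coord_open _ _ _ A c.
apply: is_formI => [c x cx|c|c c' x cx cx'].
- by rewrite wcontrE form_out// linear0.
- exists (fun y => wcontr omega alpha c (param c y)); last by move=> x cx; rewrite coordK.
  apply: (smooth_fieldZ (g := fun=> 2^-1)) => //; first exact: smooth_cst.
  apply: smooth_field_sum => // k _; apply: smooth_field_sum => // l _.
  apply: (smooth_fieldZ (g := fun y => poisson_mx omega c (param c y) k l)) => //.
    exact: poisson_smooth.
  apply: (smooth_linear (@econtrl R m k \o @econtrl R m l)) => //.
  exact: form_smooth.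
- rewrite !wcontrE (form_change fa cx cx').
  exact: elam_epull (poisson_change cx cx').
Qed.

Lemma poisson_anti c x : dom c x -> (poisson_mx omega c x)^T = - poisson_mx omega c x.
Proof.
move=> cx; apply: invmx_anti; first exact: omega_unit.
by rewrite omega_mxE emx_anti.
Qed.

End poisson.

(** * The calculus of differential forms *)

Lemma dformD alpha beta : is_form alpha -> is_form beta ->
  dform (alpha + beta) = dform alpha + dform beta.
Proof.
move=> fa fb; apply: pform_eq => c x cx; first by rewrite !pformDE !dform_out// addr0.
by rewrite !pformDE !dformE// -dlocD//; exact: form_derivable.
Qed.

Lemma dformZ (k : R) alpha : is_form alpha -> dform (k *: alpha) = k *: dform alpha.
Proof.
move=> fa; apply: pform_eq => c x cx; first by rewrite !pformZE !dform_out// scaler0.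
rewrite pformZE !dformE//.
rewrite (@dloc_scale _ _ (fun=> k) (field alpha c)); last 2 first.
- by move=> i; exact: derivable_cst.
- exact: form_derivable.
rewrite (_ : dfun _ _ = 0) ?ewedge0l ?add0r//.
by apply/funext => I; rewrite /dfun /ecovec big1// => i _; exact: derive_cst.
Qed.

Lemma dform0 : dform (0 : pform A) = 0.
Proof. by have := dformZ 0 is_form0; rewrite !scale0r. Qed.

Lemma dform_dform alpha : is_form alpha -> dform (dform alpha) = 0.
Proof.
move=> fa; apply: pform_eq => c x cx; first by rewrite !dform_out.
have oc := @coord_open _ _ _ A c.
transitivity (dloc (dloc (field alpha c)) (coord c x)).
  rewrite dformE//.
  apply: dloc_near; have : nbhs (coord c x) (cimage c).
    by apply: open_nbhs_nbhs; split=> //; exact: coord_image.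
  by apply: filterS => y /coord_param[cy yE]; rewrite dformE// yE.
exact: (dloc_dloc oc (form_smooth c fa) (coord_image cx)).
Qed.

Definition fsigma alpha : pform A := fun c x => sigma (alpha c x).

Lemma dform_fwedge alpha beta : is_form alpha -> is_form beta ->
  dform (fwedge alpha beta) = fwedge (dform alpha) beta + fwedge (fsigma alpha) (dform beta).
Proof.
move=> fa fb; apply: pform_eq => c x cx.
  by rewrite !pformDE /fwedge !dform_out// ewedge0l linear0 addr0.
rewrite !pformDE /fwedge !dformE// (dloc_ewedge (form_derivable fa cx) (form_derivable fb cx)).
by rewrite /fsigma coordK.
Qed.

(** The exterior derivative raises the degree by one. *)
Lemma dform_fdiag f alpha : is_form alpha ->
  fdiag f (dform alpha) = dform (fdiag (f \o succn) alpha).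
Proof.
move=> fa; apply: pform_eq => c x cx; first by rewrite /fdiag !dform_out// linear0.
rewrite /fdiag !dformE//.
apply: (@dloc_linear_anti _ _ (ediag f) (ediag (f \o succn))).
  by move=> i b; exact: ediag_emul.
exact: form_derivable.
Qed.

Lemma dform_fone : dform fone = 0.
Proof.
apply: pform_eq => c x cx; first by rewrite dform_out.
rewrite dformE//.
rewrite (@dloc_near _ _ _ (fun=> @eone R m)).
  rewrite /dloc big1// => i _; rewrite (_ : pd _ _ _ = 0) ?linear0//.
  by apply/funext => I; exact: derive_cst.
have : nbhs (coord c x) (cimage c).
  by apply: open_nbhs_nbhs; split; [exact: coord_open | exact: coord_image].
by apply: filterS => y /coord_param[cy yE]; rewrite fone_in.
Qed.

End forms.

(** * The action of sl2 and the Poisson differential *)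

Section sl2.
Context (R : realType) (m : nat) (M : topologicalType) (A : atlas R m M).
Variable omega : pform A.
Hypothesis sympl : symplectic omega.
Implicit Types (a b : pform A).

Local Notation Lam := (wcontr omega).
Local Notation Lef := (fwedge omega).
Local Notation deg := (fdiag (fun n => n%:R)).

Lemma wcontr_is_linear : linear Lam.
Proof.
move=> k a b; apply/funext => c; apply/funext => x.
exact: (linearP (elam (poisson_mx omega c x))).
Qed.
HB.instance Definition _ := GRing.isLinear.Build R (pform A) (pform A) *:%R Lam wcontr_is_linear.

Lemma fdiag_is_linear f : linear (@fdiag R m M A f).
Proof.
move=> k a b; apply/funext => c; apply/funext => x.
exact: (linearP (ediag f)).
Qed.
HB.instance Definition _ f := GRing.isLinear.Build R (pform A) (pform A) *:%R (@fdiag R m M A f) (fdiag_is_linear f).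

Lemma fwedge_is_linear a : linear (fwedge a).
Proof.
move=> k b b'; apply/funext => c; apply/funext => x.
exact: (linearP (ewedge (a c x))).
Qed.
HB.instance Definition _ a := GRing.isLinear.Build R (pform A) (pform A) *:%R (fwedge a) (fwedge_is_linear a).

Lemma pformDK a b c x K : (a + b) c x K = a c x K + b c x K. Proof. by []. Qed.
Lemma pformNK a c x K : (- a) c x K = - a c x K. Proof. by []. Qed.
Lemma pformZK (k : R) a c x K : (k *: a) c x K = k * a c x K. Proof. by []. Qed.
Definition pformE := (pformDK, pformNK, pformZK).

Lemma dformB a b : is_form a -> is_form b -> dform (a - b) = dform a - dform b.
Proof.
by move=> fa fb; rewrite -(scaleN1r b) dformD ?dformZ ?scaleN1r//; exact: is_formN.
Qed.

Lemma Lef_form a : is_form a -> is_form (Lef a).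
Proof. by move=> fa; apply: is_form_fwedge => //; case: sympl => -[]. Qed.

Lemma Lam_form a : is_form a -> is_form (Lam a).
Proof. exact: is_form_wcontr. Qed.

Lemma dform_Lef a : is_form a -> dform (Lef a) = Lef (dform a).
Proof.
move=> fa; rewrite dform_fwedge//; last by case: sympl => -[].
case: (sympl) => _ -> _; rewrite (_ : fwedge 0 a = 0) ?add0r.
  by congr fwedge; apply/funext => c; apply/funext => x; apply: sigma_two_form; exact: omega_two.
by apply/funext => c; apply/funext => x; exact: ewedge0l.
Qed.

Lemma Lam_Lef a : is_form a -> Lam (Lef a) = Lef (Lam a) + ((m%:R / 2) *: a - deg a).
Proof.
move=> fa; apply: pform_eq => c x cx.
  rewrite pformDE wcontrE /fwedge (form_out fa cx) /fdiag linear0 [LHS]linear0 wcontrE.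
  rewrite pformDE pformZE (form_out fa cx) linear0 linear0 scaler0 add0r.
  by rewrite -[(- fdiag _ a) c x]/(- ediag _ (a c x)) (form_out fa cx) linear0 oppr0 addr0.
rewrite wcontrE /poisson_mx omega_mxE elam_two_form -?omega_mxE//; first exact: omega_two.
exact: omega_unit.
Qed.

Lemma deg_dform a : is_form a -> deg (dform a) = dform (deg a) + dform a.
Proof.
move=> fa; rewrite dform_fdiag// -dformD//; last exact: is_form_fdiag.
congr dform; apply/funext => c; apply/funext => x; apply/funext => K.
by rewrite pformE /fdiag /ediag /= -natr1 mulrDl mul1r.
Qed.

Lemma Lam_deg a : Lam (deg a) = deg (Lam a) + 2 *: Lam a.
Proof.
apply/funext => c; apply/funext => x; apply/funext => K.
rewrite !pformE wcontrE /fdiag elam_ediag /ediag /= -wcontrE -addn2 natrD; ring.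
Qed.

Lemma iter_Lam a n : (m < n.*2)%N -> iter n Lam a = 0.
Proof.
move=> mn; apply/funext => c; apply/funext => x.
rewrite -[RHS](@iter_elam_eq0 _ _ (poisson_mx omega c x) n (a c x))//.
by elim: n {mn} => //= n IH; rewrite wcontrE IH.
Qed.

(** The iterated brackets of the adjoint Lefschetz operator with the exterior
    derivative. *)
Fixpoint adLam k a : pform A :=
  if k is k'.+1 then Lam (adLam k' a) - adLam k' (Lam a) else dform a.

Lemma adLam_form k a : is_form a -> is_form (adLam k a).
Proof.
elim: k a => [|k IH] a fa /=; first exact: is_form_dform.
by apply: is_formB; [apply/Lam_form/IH | apply/IH/Lam_form].
Qed.

Lemma adLam_linear k (t : R) a b : is_form a -> is_form b ->
  adLam k (t *: a + b) = t *: adLam k a + adLam k b.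
Proof.
elim: k a b => [|k IH] a b fa fb /=.
  by rewrite dformD ?dformZ//; exact: is_formZ.
rewrite linearP /= IH// linearP /= IH; [|exact: Lam_form..].
by apply/funext => c; apply/funext => x; apply/funext => K; rewrite !pformE; ring.
Qed.

Lemma adLamD k a b : is_form a -> is_form b -> adLam k (a + b) = adLam k a + adLam k b.
Proof. by move=> fa fb; rewrite -[a]scale1r adLam_linear// !scale1r. Qed.

Lemma adLamZ k t a : is_form a -> adLam k (t *: a) = t *: adLam k a.
Proof.
move=> fa; rewrite -[t *: a]addr0 adLam_linear//; last exact: is_form0.
suff -> : adLam k 0 = 0 by rewrite addr0.
by have := @adLam_linear k (-1) _ _ (is_form0 A) (is_form0 A); rewrite !scaleN1r !addNr.
Qed.

Lemma adLamB k a b : is_form a -> is_form b -> adLam k (a - b) = adLam k a - adLam k b.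
Proof.
by move=> fa fb; rewrite -(scaleN1r b) adLamD ?adLamZ ?scaleN1r//; exact: is_formN.
Qed.

(** Each bracket with [Lam] lowers the degree of an operator by two. *)
Lemma deg_adLam k a : is_form a ->
  deg (adLam k a) = adLam k (deg a) + (1 - 2 * k%:R) *: adLam k a.
Proof.
elim: k a => [|k IH] a fa.
  by rewrite mulr0 subr0 scale1r; exact: deg_dform.
have fdg : is_form (deg a) by exact: is_form_fdiag.
have E1 : deg (Lam (adLam k a)) = Lam (deg (adLam k a)) - 2 *: Lam (adLam k a).
  by rewrite Lam_deg addrK.
have E2 : adLam k (deg (Lam a)) = adLam k (Lam (deg a)) - 2 *: adLam k (Lam a).
  have fL := Lam_form fa; have fdL : is_form (deg (Lam a)) by exact: is_form_fdiag.
  by rewrite Lam_deg (adLamD k fdL (is_formZ 2 fL)) (adLamZ k 2 fL) addrK.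
rewrite /= linearB /= E1 (IH a fa) IH ?E2; last exact: Lam_form.
rewrite linearD linearZZ /= -natr1.
by apply/funext => c; apply/funext => x; apply/funext => K; rewrite !pformE; ring.
Qed.

(** [dform] is a highest weight vector of weight 1 for the adjoint action of sl2 on
    operators, since it commutes with [Lef] and has degree 1; the coefficient is the usual
    one for the [k]-th lowering of a vector of highest weight 1. *)
Lemma Lef_adLam k a : is_form a ->
  Lef (adLam k.+1 a) = adLam k.+1 (Lef a) + (k.+1%:R * (1 - k%:R)) *: adLam k a.
Proof.
have LL b : is_form b -> Lef (Lam b) = Lam (Lef b) - ((m%:R / 2) *: b - deg b).
  by move=> fb; rewrite Lam_Lef// addrK.
(* The Jacobi identity for [Lef], [Lam] and the [k']-th bracket. *)
have step k' b (e : R) : is_form b ->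
    (forall b, is_form b -> Lef (adLam k' b) = adLam k' (Lef b) + e *: adLam k'.-1 b) ->
    Lef (adLam k'.+1 b) = adLam k'.+1 (Lef b) + ((1 - 2 * k'%:R) *: adLam k' b +
      e *: (Lam (adLam k'.-1 b) - adLam k'.-1 (Lam b))).
  move=> fb H; have fL := Lam_form fb; have fLb := Lef_form fb.
  have fdg : is_form (deg b) by exact: is_form_fdiag.
  rewrite [adLam k'.+1 b]/= linearB /= (LL _ (adLam_form k' fb)) (H b fb) (H _ fL) LL//.
  have fs : is_form ((m%:R / 2) *: b - deg b) by apply: is_formB => //; exact: is_formZ.
  rewrite (adLamB k' (Lam_form fLb) fs) (adLamB k' (is_formZ _ fb) fdg) (adLamZ k' (m%:R / 2) fb).
  rewrite deg_adLam// linearD linearZZ /=.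
  by apply/funext => c; apply/funext => x; apply/funext => K; rewrite !pformE; ring.
elim: k a => [|k IH] a fa.
  rewrite (step 0%N a 0)//; last by move=> b fb /=; rewrite scale0r addr0 dform_Lef.
  by rewrite scale0r addr0 mulr0 subr0 mul1r.
rewrite (step k.+1 a _ fa IH) -[Lam (adLam k.+1.-1 a) - _]/(adLam k.+1 a) -scalerDl.
by congr (_ + _ *: _); rewrite -!natr1; ring.
Qed.

(** In the expansion of the brackets, every term has more than [m] factors [Lam] on one side
    of [dform]. *)
Lemma adLam_nilpotent k i j a : is_form a -> (m.+1.*2 <= i + j + k)%N ->
  iter i Lam (adLam k (iter j Lam a)) = 0.
Proof.
move=> fa; have it0 n (b : pform A) : (m < n)%N -> iter n Lam b = 0.
  by move=> mn; apply: iter_Lam; rewrite (leq_trans mn)// -addnn leq_addr.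
have iform n (b : pform A) : is_form b -> is_form (iter n Lam b).
  by move=> fb; elim: n => //= n IH; exact: Lam_form.
have itB n (b b' : pform A) : iter n Lam (b - b') = iter n Lam b - iter n Lam b'.
  by elim: n => //= n ->; rewrite linearB.
elim: k i j => [|k IH] i j ijk.
  have [mi|mj] : (m < i)%N \/ (m < j)%N by lia.
    exact: it0.
  by rewrite (it0 j)//= dform0; elim: i {ijk} => //= i ->; rewrite linear0.
rewrite [adLam _ _]/= itB -iterSr -iterS IH; last by lia.
by rewrite IH ?subrr//; lia.
Qed.

(** The representation generated by [dform] is finite-dimensional, of highest weight 1, hence
    it is spanned by [dform] and [delta omega]. By descending induction from the nilpotency:
    if the next bracket vanishes, then so does [k.+1%:R * (1 - k%:R)] times this one, and the
    coefficient is not zero. *)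
Lemma adLam_eq0 k a : is_form a -> (2 <= k)%N -> adLam k a = 0.
Proof.
move=> fa k2; have [n kn] : exists n, (m.+1.*2 <= k + n)%N by exists m.+1.*2; rewrite leq_addl.
elim: n k kn a fa k2 => [|n IH] k kn a fa k2.
  by have := @adLam_nilpotent k 0 0 a fa; rewrite addn0 in kn; apply.
have k1 b : is_form b -> adLam k.+1 b = 0.
  by move=> fb; apply: IH => //; [rewrite addSnnS | rewrite (leq_trans k2)].
have := Lef_adLam k fa; rewrite !k1//; last exact: Lef_form.
rewrite linear0 add0r => /esym/eqP; rewrite scaler_eq0 => /orP[|/eqP//].
rewrite mulf_eq0 pnatr_eq0 /= subr_eq0 eq_sym pnatr_eq1.
by move=> /eqP E; rewrite E in k2.
Qed.

Lemma delta_form a : is_form a -> is_form (delta omega a).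
Proof. exact: (adLam_form 1). Qed.

Lemma deltaD a b : is_form a -> is_form b -> delta omega (a + b) = delta omega a + delta omega b.
Proof. exact: (adLamD 1). Qed.

Lemma deltaZ t a : is_form a -> delta omega (t *: a) = t *: delta omega a.
Proof. exact: (adLamZ 1). Qed.

Lemma Lam_delta a : is_form a -> Lam (delta omega a) = delta omega (Lam a).
Proof. by move=> fa; apply/eqP; rewrite -subr_eq0; apply/eqP; exact: (adLam_eq0 fa (leqnn 2)). Qed.

Lemma Lef_delta a : is_form a -> Lef (delta omega a) = delta omega (Lef a) + dform a.
Proof. by move=> fa; have := Lef_adLam 0 fa; rewrite subr0 mulr1 scale1r. Qed.

Lemma Lam_dform a : Lam (dform a) = dform (Lam a) + delta omega a.
Proof. by rewrite /delta addrC subrK. Qed.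

Lemma delta_dform a : is_form a -> delta omega (dform a) = - dform (delta omega a).
Proof.
move=> fa; rewrite /delta dform_dform// linear0 sub0r dformB ?dform_dform ?subr0//.
- exact: Lam_form.
- exact/Lam_form/is_form_dform.
- exact/is_form_dform/Lam_form.
Qed.

(** Bracketing [d delta + delta d = 0] with [Lam] gives twice the square of [delta], as [Lam]
    commutes with [delta] and its bracket with [d] is [delta]. *)
Lemma delta_delta a : is_form a -> delta omega (delta omega a) = 0.
Proof.
move=> fa; have fd := delta_form fa; have fL := Lam_form fa.
have E1 := Lam_dform (delta omega a).
have E2 := Lam_delta (is_form_dform fa).
rewrite Lam_dform deltaD// ?delta_dform// in E2; last exact: is_form_dform.
have LN : Lam (- dform (delta omega a)) = - Lam (dform (delta omega a)) by exact: linearN.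
rewrite LN E1 (Lam_delta fa) opprD in E2.
move: E2 => /addrI /esym/eqP; rewrite -addr_eq0 -mulr2n -scaler_nat.
by rewrite scaler_eq0 pnatr_eq0 => /eqP.
Qed.

Lemma wcontr_wedgeE n a b c x :
  wcontr_wedge omega n a b c x = ecross_iter (poisson_mx omega c x) n (a c x) (b c x).
Proof. by []. Qed.

Lemma wcontr_wedge0 a b : wcontr_wedge omega 0 a b = fwedge a b.
Proof.
by apply/funext => c; apply/funext => x; rewrite wcontr_wedgeE ecross_iter0.
Qed.

Lemma ecross_iter0l (w : 'M[R]_m) n (b : ext R m) : ecross_iter w n 0 b = 0.
Proof.
elim: n b => [|n IH] b; first by rewrite ecross_iter0 ewedge0l.
rewrite ecross_iterS big1// => k _; rewrite big1// => l _.
by rewrite econtrrE !linear0 IH scaler0.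
Qed.

Lemma Lam_wcontr_wedge n a b : is_form a ->
  Lam (wcontr_wedge omega n a b) =
  wcontr_wedge omega n (Lam a) b + wcontr_wedge omega n a (Lam b) - wcontr_wedge omega n.+1 a b.
Proof.
move=> fa; apply: pform_eq => c x cx.
  rewrite -[RHS]/(wcontr_wedge omega n (Lam a) b c x + wcontr_wedge omega n a (Lam b) c x -
    wcontr_wedge omega n.+1 a b c x).
  rewrite wcontrE !wcontr_wedgeE wcontrE (form_out fa cx) linear0.
  by rewrite !ecross_iter0l linear0 subr0 addr0.
exact: elam_ecross_iter (poisson_anti sympl cx).
Qed.

End sl2.

(** * Exponentials of nilpotent operators *)

Section nilpotent_exponential.
Context (R : realType) (W : lmodType R) (T : {linear W -> W}) (K : nat).
Hypothesis TK : forall a, iter K T a = 0.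

Lemma iter_linear n k (a b : W) : iter n T (k *: a + b) = k *: iter n T a + iter n T b.
Proof. by elim: n => //= n ->; rewrite linearP. Qed.

Lemma iter0 n : iter n T 0 = 0.
Proof. by elim: n => //= n ->; rewrite linear0. Qed.

(** The last term is zero; it is there so that the factor [j] that a derivation produces in
    the [j]-th term leaves a full exponential. *)
Definition nexp (a : W) : W := \sum_(j < K.+1) (j`!%:R)^-1 *: iter j T a.

Lemma nexp_is_linear : linear nexp.
Proof.
move=> k a b; rewrite /nexp scaler_sumr -big_split; apply: eq_bigr => j _ /=.
by rewrite iter_linear scalerDr !scalerA mulrC.
Qed.
HB.instance Definition _ := GRing.isLinear.Build R W W *:%R nexp nexp_is_linear.

(** The part of the exponential without constant term. *)
Definition nexp1 (a : W) : W := nexp a - a.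

Lemma nexp1_is_linear : linear nexp1.
Proof. by move=> k a b; rewrite /nexp1 linearP scalerBr opprD addrACA. Qed.
HB.instance Definition _ := GRing.isLinear.Build R W W *:%R nexp1 nexp1_is_linear.

Lemma nexp1E a : nexp1 a = \sum_(j < K) (j.+1`!%:R)^-1 *: iter j T (T a).
Proof.
rewrite /nexp1 /nexp big_ord_recl /= fact0 invr1 scale1r addrC addKr.
by apply: eq_bigr => j _; rewrite -iterSr.
Qed.

(** [nexp1] is divisible by [T]. *)
Lemma nexp1_annihilates s a : iter s.+1 T a = 0 -> iter s T (nexp1 a) = 0.
Proof.
move=> Ta; rewrite nexp1E (big_morph (iter s T) (id1 := 0) (op1 := +%R)) //=.
- apply: big1 => j _; rewrite -[_ *: _]addr0 iter_linear iter0 addr0.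
  by rewrite -iterD addnC iterD -iterSr Ta iter0 scaler0.
- by move=> x y; rewrite -[x]scale1r iter_linear !scale1r.
- exact: iter0.
Qed.

Lemma iter_nexp1_eq0 a : iter K nexp1 a = 0.
Proof.
suff H s b : iter s T b = 0 -> iter s nexp1 b = 0 by apply: H; exact: TK.
elim: s b => // s IH b Tb; rewrite iterSr; apply: IH.
exact: nexp1_annihilates.
Qed.

(** The inverse of the exponential, as a geometric series in the nilpotent [nexp1]. *)
Definition ninv (a : W) : W := \sum_(k < K) (-1) ^+ k *: iter k nexp1 a.

Lemma nexpE a : nexp a = a + nexp1 a.
Proof. by rewrite /nexp1 addrC subrK. Qed.

Lemma geometric_sum a :
  \sum_(k < K) ((-1) ^+ k *: iter k nexp1 a + (-1) ^+ k *: iter k.+1 nexp1 a) = a.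
Proof.
pose f k := - ((-1) ^+ k *: iter k nexp1 a).
rewrite (eq_bigr (fun k : 'I_K => f k.+1 - f k)).
  rewrite -(big_mkord xpredT (fun k => f k.+1 - f k)) telescope_sumr//.
  by rewrite /f iter_nexp1_eq0 scaler0 oppr0 sub0r opprK scale1r.
by move=> k _; rewrite /f opprK exprS mulN1r scaleNr opprK addrC.
Qed.

Lemma nexp_ninv a : nexp (ninv a) = a.
Proof.
rewrite nexpE {2}/ninv linear_sum /= -big_split -[RHS]geometric_sum /=.
by apply: eq_bigr => k _; rewrite linearZZ.
Qed.

Lemma ninv_nexp a : ninv (nexp a) = a.
Proof.
rewrite /ninv -[RHS]geometric_sum; apply: eq_bigr => k _.
rewrite -scalerDr nexpE; congr (_ *: _).
by elim: (k : nat) => //= n ->; rewrite linearD.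
Qed.

Lemma nexp_inj a b : nexp a = nexp b -> a = b.
Proof. by move=> ab; rewrite -(ninv_nexp a) ab ninv_nexp. Qed.

Section stability.
Variable P : set W.
Hypotheses (P0 : P 0) (PD : forall a b, P a -> P b -> P (a + b))
  (PZ : forall (k : R) a, P a -> P (k *: a)) (PT : forall a, P a -> P (T a)).

Lemma iter_stable (S : W -> W) n a : (forall a, P a -> P (S a)) -> P a -> P (iter n S a).
Proof. by move=> PS Pa; elim: n => //= n; exact: PS. Qed.

Lemma nexp_stable a : P a -> P (nexp a).
Proof.
move=> Pa; rewrite /nexp; apply: big_ind => // j _; apply: (PZ).
exact: iter_stable.
Qed.

Lemma ninv_stable a : P a -> P (ninv a).
Proof.
move=> Pa; rewrite /ninv; apply: big_ind => // j _; apply: (PZ).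
apply: iter_stable => // b Pb; apply: (PD); first exact: nexp_stable.
by rewrite -scaleN1r; apply: (PZ).
Qed.

(** The conjugate of [X] by [exp T] is the sum of its iterated brackets with [- T], divided by
    factorials; they vanish beyond the first one when [T] commutes with [Y = T X - X T]. *)
Lemma nexp_conj (X Y : W -> W) :
  (forall a b, P a -> P b -> X (a + b) = X a + X b) ->
  (forall (k : R) a, P a -> X (k *: a) = k *: X a) ->
  (forall a, P a -> T (X a) = X (T a) + Y a) ->
  (forall a, P a -> T (Y a) = Y (T a)) ->
  forall a, P a -> X (nexp a) = nexp (X a - Y a).
Proof.
move=> XD XZ XT YT a Pa.
have PI n : P (iter n T a) by exact: iter_stable.
have YI n : iter n T (Y a) = Y (iter n T a).
  by elim: n => //= n ->; rewrite YT.
have XI n : X (iter n T a) = iter n T (X a) - n%:R *: iter n.-1 T (Y a).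
  elim: n => [|n IH]; first by rewrite scale0r subr0.
  have -> : X (iter n.+1 T a) = T (X (iter n T a)) - Y (iter n T a) by rewrite XT//= addrK.
  rewrite IH linearB linearZZ -YI -addrA -opprD /=; congr (_ - _).
  case: n {IH} => [|n]; first by rewrite scale0r add0r scale1r.
  by rewrite -[n.+2%:R]natr1 scalerDl scale1r.
have X0 : X 0 = 0 by have := XZ 0 _ P0; rewrite !scale0r.
have XS n (c : 'I_n -> R) : X (\sum_(j < n) c j *: iter j T a) = \sum_(j < n) c j *: X (iter j T a).
  have PS : P (\sum_(j < n) c j *: iter j T a) /\
      X (\sum_(j < n) c j *: iter j T a) = \sum_(j < n) c j *: X (iter j T a).
    apply: (big_ind2 (fun u v => P u /\ X u = v)) => //.
    - by move=> u v u' v' [Pu <-] [Pu' <-]; split; [apply: (PD) | rewrite XD].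
    - by move=> j _; split; [apply: (PZ) | rewrite XZ].
  by case: PS.
rewrite {1}/nexp XS linearB /=.
rewrite (eq_bigr (fun j : 'I_K.+1 => (j`!%:R)^-1 *: iter j T (X a) -
   (j`!%:R)^-1 * j%:R *: iter j.-1 T (Y a))); last by move=> j _; rewrite XI scalerBr scalerA.
rewrite sumrB; congr (_ - _).
rewrite big_ord_recl mulr0 scale0r add0r {1}/nexp big_ord_recr /= TK scaler0 addr0.
apply: eq_bigr => j _; congr (_ *: _).
by rewrite factS natrM invfM mulrAC mulVf ?mul1r// pnatr_eq0.
Qed.

End stability.
End nilpotent_exponential.

(** * Spectral sequences of bounded filtrations *)

Section filtered_complex.
Context (R : realType) (W : lmodType R) (D X U Uinv : W -> W) (F : int -> int -> set W) (Tot : int -> set W).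

Hypothesis FZ : forall p n, submodule [set: R] *:%R (F p n).
Hypothesis Fdecr : forall p p' n, p <= p' -> F p' n `<=` F p n.
Hypothesis Ftot : forall p n, F p n `<=` Tot n.
Hypothesis Ftop : forall n, exists a, forall p, p <= a -> Tot n `<=` F p n.
Hypothesis Fbot : forall n, exists b, forall p, b <= p -> F p n `<=` [set 0].
Hypothesis DB : forall n x y, Tot n x -> Tot n y -> D (x - y) = D x - D y.
Lemma filtration0 p n : F p n 0. Proof. by have [] := FZ p n. Qed.
Lemma filtrationB p n x y : F p n x -> F p n y -> F p n (x - y).
Proof.
have [_ FD FS] := FZ p n => Fx Fy; apply: FD => //.
by rewrite -scaleN1r; apply: FS.
Qed.

(** If [X] is homogeneous for a grading that induces the filtration and [X y] has
    filtration [t], then the part of [y] of degree less than [t] is closed for [X]: this is the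
    last hypothesis. Conjugating back, [Uinv z] has filtration [p + r] and the same boundary as
    [x], so the differential of the page kills the class of [x]. *)
Lemma conjugate_degenerates :
  (forall p n x, F p n x -> F p n (U x)) ->
  (forall p n x, F p n x -> F p n (Uinv x)) ->
  (forall x, U (Uinv x) = x) ->
  (forall x y, U x = U y -> x = y) ->
  (forall n x, Tot n x -> X (U x) = U (D x)) ->
  (forall n x y, Tot n x -> Tot n y -> X (x - y) = X x - X y) ->
  (forall p t n y, F p n y -> exists2 z, F t n z & F p n (y - z) /\
      (F t (n + 1) (X y) -> X (y - z) = 0)) ->
  ss_degenerates D F 1.
Proof.
move=> FU FUi UK UI XU XB split r p n r1 x [Fx FDx].
have Fy := FU _ _ _ Fx.
have [z Fz [Fyz Xz]] := split p (p + r) n (U x) Fy.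
have XUx : F (p + r) (n + 1) (X (U x)) by rewrite (XU n)//; [exact: FU | exact: Ftot Fx].
have := Xz XUx; rewrite (XB n); [|exact: Ftot Fy|exact: Ftot Fz].
move=> /eqP; rewrite subr_eq0 => /eqP Xyz.
have Dz : D (Uinv z) = D x.
  apply: UI; rewrite -(XU n); last exact: Ftot (FUi _ _ _ Fz).
  by rewrite -(XU n) ?UK//; exact: Ftot Fx.
exists 0, (Uinv z); split; last by rewrite add0r.
  have D0 : D 0 = 0.
    by have := DB (Ftot Fx) (Ftot Fx); rewrite !subrr.
  split; first exact: filtration0.
  by rewrite D0; exact: filtration0.
rewrite (_ : p + r - r + 1 = p + 1); last by rewrite addrK.
rewrite (_ : n + 1 - 1 = n); last by rewrite addrK.
split; first by apply: Fdecr (FUi _ _ _ Fz); rewrite lerD2l.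
rewrite Dz; apply: Fdecr FDx.
by rewrite -addrA lerD2l addrC subrK.
Qed.

Variable H : int -> subquot W.
Hypothesis Hcyc : forall n x, cyc (H n) x <-> Tot n x /\ D x = 0.
Hypothesis Hbnd : forall n x, bnd (H n) x <-> exists2 w, Tot (n - 1) w & x = D w.

(** In each total degree the filtration is finite. So for large [r] a cycle of the [r]-th page
    is a cycle of [D], and every boundary of [D] is hit from the elements that the page allows. *)
Lemma filtered_abuts : ss_abuts (R := R) D F H.
Proof.
move=> n; have [a Ha] := Ftop n; have [b Hb] := Fbot n.
have D0 : D 0 = 0 by have := DB (Ftot (filtration0 a n)) (Ftot (filtration0 a n)); rewrite !subrr.
have bnd0 : bnd (H n) 0.
  apply/Hbnd; exists 0 => //; have [a' Ha'] := Ftop (n - 1).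
  exact: Ftot (filtration0 a' _).
split.
  exists a, b; split=> [x /[dup] cx /Hcyc[tx Dx]|x [/Hb -> //]].
  by exists x; [split=> //; exact: Ha tx | rewrite subrr].
move=> p; have [b' Hb'] := Fbot (n + 1); have [a' Ha'] := Ftop (n - 1).
exists (Num.max (b' - p) (p + 1 - a')) => r; rewrite ge_max => /andP[r1 r2].
have Fr x : F (p + r) (n + 1) x -> x = 0 by apply: Hb'; rewrite -lerBlDl.
have cycE x : F p n x -> F (p + r) (n + 1) (D x) -> cyc (H n) x.
  by move=> Fx /Fr Dx; apply/Hcyc; split=> //; exact: Ftot Fx.
have bndY0 : bnd (ss_page D F r p n) 0.
  exists 0, 0; rewrite /ss_cyc /= D0 addr0; split=> //; split; exact: filtration0.
split=> [x [Fx /Hcyc[tx Dx]]|x y _ _|c x _ _|x [Fx cx]|y [Fy FDy]].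
- by split=> //; rewrite Dx; exact: filtration0.
- by rewrite subrr.
- by rewrite subrr.
- split=> [[y [z [[Fy FDy] [Fz FDz] xyz]]]|[_ [y [Fy /Hcyc[ty Dy]] /Hbnd[w tw xyw]]]].
    split; first by split.
    have cy : cyc (H n) y.
      apply/Hcyc; split; first exact: Ftot Fy.
      by apply: Fr; move: FDy; congr (F _ _ _); rewrite addrA addrAC addrK.
    exists y; first by split.
    by apply/Hbnd; exists z; [exact: Ftot Fz | rewrite xyz addrC addKr].
  exists y, w; split; last by rewrite -xyw addrC subrK.
    by split=> //; rewrite Dy; exact: filtration0.
  split; first by apply: Ha' => //; lia.
  rewrite -xyw (_ : p - r + 1 + (r - 1) = p); last by ring.
  rewrite (_ : n - 1 + 1 = n) ?subrK//; apply: filtrationB => //.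
  by apply: Fdecr Fy; rewrite lerDl.
- by exists y; [split=> //; exact: cycE | rewrite subrr].
Qed.

End filtered_complex.

(** * Laurent polynomials with coefficients in a module *)

Section laurent_module.
Context (R : realType) (V : lmodType R).
Implicit Types (a b : int -> V) (u v : V) (p q n : int) (U : set V).

Definition finsupp (T : zmodType) (a : int -> T) := finite_set [set p | a p != 0].

Lemma finsuppP (T : zmodType) (a : int -> T) :
  finsupp a -> exists2 r : seq int, uniq r & forall p, p \notin r -> a p = 0.
Proof.
move=> /finite_seqP[r ar]; exists (undup r) => [|p]; first exact: undup_uniq.
rewrite mem_undup => pr; apply/eqP; apply: contraNT pr => ap.
by have : [set` r] p by rewrite -ar.
Qed.

Lemma finsupp_seq (T : zmodType) (a : int -> T) (r : seq int) :
  (forall p, p \notin r -> a p = 0) -> finsupp a.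
Proof.
move=> H; apply: (sub_finite_set (B := [set` r])); last exact: finite_seq.
by move=> p /=; apply: contraNT => /H ->.
Qed.

Lemma finsupp0 (T : zmodType) : finsupp (0 : int -> T).
Proof. exact: (finsupp_seq (r := [::])). Qed.

Lemma finsuppD (T : zmodType) (a b : int -> T) : finsupp a -> finsupp b -> finsupp (a + b).
Proof.
move=> /finsuppP[r1 _ r1a] /finsuppP[r2 _ r2b].
apply: (finsupp_seq (r := r1 ++ r2)) => p; rewrite mem_cat negb_or => /andP[p1 p2].
by rewrite -[LHS]/(a p + b p) r1a// r2b// addr0.
Qed.

Lemma big_ord_truncate (N n : nat) (g : nat -> V) : (n <= N)%N ->
  (forall j, (n <= j < N)%N -> g j = 0) -> \sum_(j < N) g j = \sum_(j < n) g j.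
Proof.
move=> nN g0; rewrite -(big_mkord xpredT g) (big_cat_nat _ nN)//= big_mkord.
by rewrite [X in _ + X]big_nat [X in _ + X]big1 ?addr0.
Qed.

Lemma hmonE p v n : hmon p v n = if n == p then v else 0. Proof. by []. Qed.

Lemma hmonD p u v : hmon p (u + v) = hmon p u + hmon p v.
Proof.
apply/funext => n; rewrite -[RHS]/(hmon p u n + hmon p v n) !hmonE.
by case: ifP; rewrite ?addr0.
Qed.

Lemma hmonZ p (k : R) v : hmon p (k *: v) = k *: hmon p v.
Proof.
apply/funext => n; rewrite -[RHS]/(k *: hmon p v n) !hmonE.
by case: ifP; rewrite ?scaler0.
Qed.

Lemma hmon0 p : hmon p (0 : V) = 0.
Proof. by apply/funext => n; rewrite hmonE if_same. Qed.

Lemma finsupp_hmon p v : finsupp (hmon p v).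
Proof.
apply: (finsupp_seq (r := [:: p])) => n; rewrite inE hmonE.
by case: ifP.
Qed.

Lemma finsupp_decomp a : finsupp a -> exists2 r, uniq r & a = \sum_(p <- r) hmon p (a p).
Proof.
move=> /finsuppP[r ur ar]; exists r => //; apply/funext => n; rewrite fct_sumE.
have [nr|nr] := boolP (n \in r).
  rewrite (bigD1_seq n)//= hmonE eqxx big1 ?addr0// => p pn.
  by rewrite hmonE eq_sym (negbTE pn).
rewrite ar// big_seq big1// => p pr; rewrite hmonE.
by case: eqP => // E; rewrite E pr in nr.
Qed.

Lemma laurent_submodule U : submodule [set: R] *:%R U -> submodule [set: R] *:%R (laurent U).
Proof.
move=> [U0 UD UZ]; split.
- by split=> //; exact: finsupp0.
- by move=> x y [xU fx] [yU fy]; split=> [p|]; [exact: UD | exact: finsuppD].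
- move=> k x _ [xU /finsuppP[r1 _ r1x]]; split=> [p|]; first exact: UZ.
  by apply: (finsupp_seq (r := r1)) => p p1; rewrite -[LHS]/(k *: x p) r1x// scaler0.
Qed.

Lemma laurent_hmon U p u : U 0 -> U u -> laurent U (hmon p u).
Proof.
move=> U0 Uu; split; last exact: finsupp_hmon.
by move=> n; rewrite hmonE; case: ifP.
Qed.

Lemma laurent_ind U (Q : (int -> V) -> Prop) :
  Q 0 -> (forall a b, laurent U a -> laurent U b -> Q a -> Q b -> Q (a + b)) ->
  (forall p u, U u -> Q (hmon p u)) -> submodule [set: R] *:%R U ->
  forall a, laurent U a -> Q a.
Proof.
move=> Q0 QD Qh sU a [aU fa]; have [r _ ->] := finsupp_decomp fa.
have [L0 LD _] := laurent_submodule sU; have [U0 _ _] := sU.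
suff : laurent U (\sum_(p <- r) hmon p (a p)) /\ Q (\sum_(p <- r) hmon p (a p)) by case.
elim: r => [|p r [IH1 IH2]]; first by rewrite big_nil.
have Lp : laurent U (hmon p (a p)) by exact: laurent_hmon.
by rewrite big_cons; split; [exact: LD | apply: QD => //; exact: Qh].
Qed.

Lemma finsupp_ind (Q : (int -> V) -> Prop) :
  Q 0 -> (forall a b, finsupp a -> finsupp b -> Q a -> Q b -> Q (a + b)) ->
  (forall p v, Q (hmon p v)) -> forall a, finsupp a -> Q a.
Proof.
move=> Q0 QD Qh a fa; apply: (@laurent_ind [set: V] Q) => //.
by move=> x y [_ fx] [_ fy]; exact: QD.
Qed.

Lemma lscaleE (c : int -> R) a (r : seq int) n : uniq r ->
  (forall p, p \notin r -> c p = 0) ->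
  lscale c a n = \sum_(p <- r) c p *: a (n - p).
Proof.
move=> ur cr; rewrite /lscale (fsbigE r)//.
  by apply: eq_bigl => p; exact: classical_sets.in_setT.
by move=> p _ /cr->; rewrite scale0r.
Qed.

Lemma lscale_hmonl p (k : R) a : lscale (hmon p k) a = (fun n => k *: a (n - p)).
Proof.
apply/funext => n; rewrite (@lscaleE _ _ [:: p])// ?big_seq1 /hmon ?eqxx//.
by move=> q; rewrite inE => /negbTE->.
Qed.

Lemma lscale_hmon p q (k : R) v : lscale (hmon p k) (hmon q v) = hmon (p + q) (k *: v).
Proof.
rewrite lscale_hmonl; apply/funext => n; rewrite !hmonE subr_eq addrC.
by case: ifP; rewrite ?scaler0.
Qed.

Lemma lscaleDr (c : int -> R) a b : finsupp c -> lscale c (a + b) = lscale c a + lscale c b.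
Proof.
move=> /finsuppP[r ur cr]; apply/funext => n.
rewrite -[RHS]/(lscale c a n + lscale c b n) !(@lscaleE _ _ r)// -big_split.
by apply: eq_bigr => p _ /=; rewrite -scalerDr.
Qed.

Lemma lscaleDl (c c' : int -> R) a : finsupp c -> finsupp c' ->
  lscale (c + c') a = lscale c a + lscale c' a.
Proof.
move=> /finsuppP[r1 _ cr1] /finsuppP[r2 _ cr2]; apply/funext => n.
have ur := undup_uniq (r1 ++ r2).
have H1 p : p \notin undup (r1 ++ r2) -> c p = 0.
  by rewrite mem_undup mem_cat negb_or => /andP[/cr1].
have H2 p : p \notin undup (r1 ++ r2) -> c' p = 0.
  by rewrite mem_undup mem_cat negb_or => /andP[_ /cr2].
rewrite -[RHS]/(lscale c a n + lscale c' a n) !(lscaleE _ _ ur)// => [|p pr].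
  by rewrite -big_split; apply: eq_bigr => p _ /=; rewrite -scalerDl.
by rewrite -[LHS]/(c p + c' p) H1// H2// addr0.
Qed.

Lemma lscale0l a : lscale (0 : int -> R) a = 0.
Proof.
by apply/funext => n; rewrite (@lscaleE _ _ [::])// big_nil.
Qed.

Lemma lscale0r (c : int -> R) : finsupp c -> lscale c (0 : int -> V) = 0.
Proof.
move=> /finsuppP[r ur cr]; apply/funext => n; rewrite (lscaleE _ _ ur)//.
by apply: big1 => p _; exact: scaler0.
Qed.

End laurent_module.

Lemma laurent_setT (R : realType) (V : lmodType R) (a : int -> V) :
  laurent [set: V] a <-> finsupp a.
Proof. by split=> [[]|fa]. Qed.

Section laurent_bilinear.
Context (R : realType) (V W : lmodType R) (f : V -> V -> int -> W).
Hypothesis fDl : forall u u' v, f (u + u') v = f u v + f u' v.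
Hypothesis fDr : forall u v v', f u (v + v') = f u v + f u v'.

Lemma biadd0l v : f 0 v = 0.
Proof. by apply: (addrI (f 0 v)); rewrite -fDl !addr0. Qed.

Lemma biadd0r u : f u 0 = 0.
Proof. by apply: (addrI (f u 0)); rewrite -fDr !addr0. Qed.

Lemma lbilinE (a b : int -> V) (r1 r2 : seq int) n : uniq r1 -> uniq r2 ->
  (forall p, p \notin r1 -> a p = 0) -> (forall p, p \notin r2 -> b p = 0) ->
  lbilin f a b n = \sum_(p <- r1) \sum_(q <- r2) f (a p) (b q) (n - p - q).
Proof.
move=> u1 u2 ar br; rewrite /lbilin (fsbigE [seq (p, q) | p <- r1, q <- r2])//.
- rewrite (eq_bigl xpredT) => [|p]; last exact: classical_sets.in_setT.
  by rewrite big_allpairs.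
- by rewrite allpairs_uniq// => -[? ?] [? ?].
- move=> [p q] _ /=; have [pr|/ar->] := boolP (p \in r1); last by rewrite biadd0l.
  have [qr|/br->] := boolP (q \in r2); last by rewrite biadd0r.
  by rewrite allpairs_f.
Qed.

Lemma lbilinDl (a a' b : int -> V) : finsupp a -> finsupp a' -> finsupp b ->
  lbilin f (a + a') b = lbilin f a b + lbilin f a' b.
Proof.
move=> /finsuppP[r1 _ ar] /finsuppP[r2 _ ar'] /finsuppP[r ur br]; apply/funext => n.
have u12 := undup_uniq (r1 ++ r2).
have H1 p : p \notin undup (r1 ++ r2) -> a p = 0.
  by rewrite mem_undup mem_cat negb_or => /andP[/ar].
have H2 p : p \notin undup (r1 ++ r2) -> a' p = 0.
  by rewrite mem_undup mem_cat negb_or => /andP[_ /ar'].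
rewrite -[RHS]/(lbilin f a b n + lbilin f a' b n) !(lbilinE _ u12 ur)// => [|p pr].
  rewrite -big_split; apply: eq_bigr => p _ /=; rewrite -big_split; apply: eq_bigr => q _ /=.
  by rewrite -[(a + a') p]/(a p + a' p) fDl.
by rewrite -[LHS]/(a p + a' p) H1// H2// addr0.
Qed.

Lemma lbilinDr (a b b' : int -> V) : finsupp a -> finsupp b -> finsupp b' ->
  lbilin f a (b + b') = lbilin f a b + lbilin f a b'.
Proof.
move=> /finsuppP[r ur ar] /finsuppP[r1 _ br] /finsuppP[r2 _ br']; apply/funext => n.
have u12 := undup_uniq (r1 ++ r2).
have H1 p : p \notin undup (r1 ++ r2) -> b p = 0.
  by rewrite mem_undup mem_cat negb_or => /andP[/br].
have H2 p : p \notin undup (r1 ++ r2) -> b' p = 0.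
  by rewrite mem_undup mem_cat negb_or => /andP[_ /br'].
rewrite -[RHS]/(lbilin f a b n + lbilin f a b' n) !(lbilinE _ ur u12)// => [|p pr].
  rewrite -big_split; apply: eq_bigr => p _ /=; rewrite -big_split; apply: eq_bigr => q _ /=.
  by rewrite -[(b + b') q]/(b q + b' q) fDr.
by rewrite -[LHS]/(b p + b' p) H1// H2// addr0.
Qed.

Lemma lbilin_hmon p q u v n : lbilin f (hmon p u) (hmon q v) n = f u v (n - p - q).
Proof.
rewrite (@lbilinE _ _ [:: p] [:: q])// ?big_seq1 ?hmonE ?eqxx//;
  by move=> k; rewrite inE hmonE => /negbTE->.
Qed.

Lemma lbilin0l b : finsupp b -> lbilin f 0 b = 0.
Proof.
move=> fb; have f0 := @finsupp0 V; apply: (addrI (lbilin f 0 b)).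
by rewrite -lbilinDl// !addr0.
Qed.

Lemma lbilin0r a : finsupp a -> lbilin f a 0 = 0.
Proof.
move=> fa; have f0 := @finsupp0 V; apply: (addrI (lbilin f a 0)).
by rewrite -lbilinDr// !addr0.
Qed.

End laurent_bilinear.

(** * The quantum product is conjugate to the exterior product *)

Section divided_power_sums.
Context (R : realType) (V : lmodType R).
Implicit Types h : nat -> nat -> V.

(** The [s]-th divided power of a sum of two commuting operators, [h j k] being the result of
    applying the first one [j] times and the second one [k] times. *)
Definition dpsum s h : V := \sum_(j < s.+1) ((j`! * (s - j)`!)%:R)^-1 *: h j (s - j)%N.

Lemma eq_dpsum s h h' : (forall j k, h j k = h' j k) -> dpsum s h = dpsum s h'.
Proof. by move=> hh; apply: eq_bigr => j _; rewrite hh. Qed.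

Lemma dpsumD s h h' : dpsum s (fun j k => h j k + h' j k) = dpsum s h + dpsum s h'.
Proof. by rewrite /dpsum -big_split; apply: eq_bigr => j _ /=; rewrite scalerDr. Qed.

(** The Leibniz rule for divided powers. *)
Lemma dpsumS s h : s.+1%:R *: dpsum s.+1 h =
  dpsum s (fun j k => h j.+1 k) + dpsum s (fun j k => h j k.+1).
Proof.
rewrite /dpsum scaler_sumr.
rewrite (eq_bigr (fun j : 'I_s.+2 =>
   (j%:R / (j`! * (s.+1 - j)`!)%:R) *: h j (s.+1 - j)%N +
   ((s.+1 - j)%:R / (j`! * (s.+1 - j)`!)%:R) *: h j (s.+1 - j)%N)); last first.
  move=> j _; rewrite scalerA -scalerDl -mulrDl -natrD subnKC//.
  by rewrite -ltnS.
rewrite big_split /=; congr (_ + _).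
  rewrite big_ord_recl mul0r scale0r add0r; apply: eq_bigr => j _.
  rewrite lift0 subSS; congr (_ *: _).
  rewrite factS -mulnA natrM invfM mulrA mulfV ?mul1r//.
rewrite big_ord_recr /= subnn mul0r scale0r addr0; apply: eq_bigr => j _.
have js : (j <= s)%N by rewrite -ltnS.
rewrite subSn//; congr (_ *: _).
rewrite factS mulnCA natrM invfM mulrA mulfV ?mul1r//.
Qed.

End divided_power_sums.

Section quantum_product.
Context (R : realType) (m : nat) (M : topologicalType) (A : atlas R m M).
Variable omega : pform A.
Hypothesis sympl : symplectic omega.
Implicit Types (u v : pform A) (a b : int -> pform A).

Local Notation Lam := (wcontr omega).
Local Notation Lef := (fwedge omega).
Local Notation B := (wcontr_wedge omega).

Lemma fwedgeDl u u' v : fwedge (u + u') v = fwedge u v + fwedge u' v.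
Proof. by apply/funext => c; apply/funext => x; exact: ewedgeDl. Qed.

Lemma fwedgeDr u v v' : fwedge u (v + v') = fwedge u v + fwedge u v'.
Proof. exact: linearD. Qed.

Lemma fwedgeZl (k : R) u v : fwedge (k *: u) v = k *: fwedge u v.
Proof. by apply/funext => c; apply/funext => x; exact: ewedgeZl. Qed.

Lemma fwedgeZr (k : R) u v : fwedge u (k *: v) = k *: fwedge u v.
Proof. exact: linearZZ. Qed.

Lemma fwedgeA u v w : fwedge (fwedge u v) w = fwedge u (fwedge v w).
Proof. by apply/funext => c; apply/funext => x; exact: ewedgeA. Qed.

Lemma fwedge1l u : is_form u -> fwedge (@fone R m M A) u = u.
Proof.
move=> fu; apply: pform_eq => c x cx; rewrite /fwedge.
  by rewrite (form_out fu cx) linear0.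
by rewrite fone_in// ewedge1l.
Qed.

Lemma fwedge1r u : is_form u -> fwedge u (@fone R m M A) = u.
Proof.
move=> fu; apply: pform_eq => c x cx; rewrite /fwedge.
  by rewrite (form_out fu cx) ewedge0l.
by rewrite fone_in// ewedge1r.
Qed.

Lemma ecross_iterDl (w : 'M[R]_m) n (a a' b : ext R m) :
  ecross_iter w n (a + a') b = ecross_iter w n a b + ecross_iter w n a' b.
Proof.
elim: n a a' b => [|n IH] a a' b; first by rewrite !ecross_iter0 ewedgeDl.
rewrite !ecross_iterS -big_split; apply: eq_bigr => k _ /=; rewrite -big_split.
by apply: eq_bigr => l _ /=; rewrite -scalerDr -IH !econtrrE econtrlD linearD.
Qed.

Lemma ecross_iterDr (w : 'M[R]_m) n (a b b' : ext R m) :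
  ecross_iter w n a (b + b') = ecross_iter w n a b + ecross_iter w n a b'.
Proof.
elim: n a b b' => [|n IH] a b b'; first by rewrite !ecross_iter0 linearD.
rewrite !ecross_iterS -big_split; apply: eq_bigr => k _ /=; rewrite -big_split.
by apply: eq_bigr => l _ /=; rewrite -scalerDr -IH econtrlD.
Qed.

Lemma wcontr_wedgeDl n u u' v : B n (u + u') v = B n u v + B n u' v.
Proof. by apply/funext => c; apply/funext => x; exact: ecross_iterDl. Qed.

Lemma wcontr_wedgeDr n u v v' : B n u (v + v') = B n u v + B n u v'.
Proof. by apply/funext => c; apply/funext => x; exact: ecross_iterDr. Qed.

(** With [mu] the exterior product and [B] the bidifferential contraction,
    [Lam o mu = mu o (Lam x 1 + 1 x Lam - B)] where all the operators on the right commute.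
    Therefore [mu o exp (Lam x 1 + 1 x Lam) = exp Lam o mu o exp B], of which this is the
    part of order [s]. *)
Lemma exp_wcontr_wedge s u v : is_form u ->
  dpsum s (fun j k => iter j Lam (B k u v)) =
  dpsum s (fun j k => fwedge (iter j Lam u) (iter k Lam v)).
Proof.
elim: s u v => [|s IH] u v fu.
  by rewrite /dpsum !big_ord_recl !big_ord0 /= wcontr_wedge0.
have LD n u' v' : iter n Lam (u' + v') = iter n Lam u' + iter n Lam v'.
  by elim: n => //= n ->; rewrite linearD.
apply: (@scalerI _ _ s.+1%:R); first by rewrite pnatr_eq0.
rewrite !dpsumS -dpsumD.
rewrite (@eq_dpsum _ _ _ _ (fun j k => iter j Lam (B k (Lam u) v) + iter j Lam (B k u (Lam v)))).
  rewrite dpsumD !IH//; last exact: Lam_form.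
  by congr (_ + _); apply: eq_dpsum => j k; rewrite -iterSr.
move=> j k; rewrite iterSr -!LD; congr (iter j Lam _).
by rewrite Lam_wcontr_wedge// subrK.
Qed.

(** The exterior product as a map into Laurent polynomials, so that [lwedge] is its bilinear
    extension. *)
Definition fw0 u v : int -> pform A := hmon 0 (fwedge u v).

Definition lwedge := lbilin fw0.

Definition qcoef u v : int -> pform A :=
  fun n => if n is Posz n then (n`!%:R)^-1 *: B n u v else 0.

Lemma qwedgeE : qwedge omega = lbilin qcoef. Proof. by []. Qed.

Lemma fw0Dl u u' v : fw0 (u + u') v = fw0 u v + fw0 u' v.
Proof. by rewrite /fw0 fwedgeDl hmonD. Qed.

Lemma fw0Dr u v v' : fw0 u (v + v') = fw0 u v + fw0 u v'.
Proof. by rewrite /fw0 fwedgeDr hmonD. Qed.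

Lemma qcoefDl u u' v : qcoef (u + u') v = qcoef u v + qcoef u' v.
Proof.
apply/funext => -[n|n].
  by rewrite -[RHS]/(qcoef u v n%:Z + qcoef u' v n%:Z) /qcoef wcontr_wedgeDl scalerDr.
by rewrite -[RHS]/(0 + 0 : pform A) addr0.
Qed.

Lemma qcoefDr u v v' : qcoef u (v + v') = qcoef u v + qcoef u v'.
Proof.
apply/funext => -[n|n].
  by rewrite -[RHS]/(qcoef u v n%:Z + qcoef u v' n%:Z) /qcoef wcontr_wedgeDr scalerDr.
by rewrite -[RHS]/(0 + 0 : pform A) addr0.
Qed.

Lemma lwedge_hmon p q u v : lwedge (hmon p u) (hmon q v) = hmon (p + q) (fwedge u v).
Proof.
apply/funext => n; rewrite /lwedge (lbilin_hmon fw0Dl fw0Dr) /fw0 !hmonE.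
by rewrite -addrA -opprD subr_eq add0r.
Qed.

(** The operator [h Lam], which has degree 0 when [h] has degree 2. *)
Definition hLam a : int -> pform A := fun i => Lam (a (i - 1)).

Lemma hLam_is_linear : linear hLam.
Proof. by move=> k a b; apply/funext => i; exact: (linearP Lam). Qed.
HB.instance Definition _ := GRing.isLinear.Build R (int -> pform A) (int -> pform A) *:%R hLam hLam_is_linear.

Lemma iter_hLam n a i : iter n hLam a i = iter n Lam (a (i - n%:Z)).
Proof.
elim: n i => [|n IH] i; first by rewrite subr0.
by rewrite iterS /hLam IH -addrA -opprD -intS.
Qed.

Lemma hLam_nilpotent a : iter m.+1 hLam a = 0.
Proof.
apply/funext => i; rewrite iter_hLam; apply: iter_Lam.
by rewrite -addnn addSn ltnS leq_addr.
Qed.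

Definition expLam := nexp hLam m.+1.
Definition expLam_inv := ninv hLam m.+1.

Lemma iter_Lam0 n u : (m < n)%N -> iter n Lam u = 0.
Proof. by move=> mn; apply: iter_Lam; rewrite (leq_trans mn)// -addnn leq_addr. Qed.

Lemma expLamE a i (N : nat) : (m < N)%N ->
  expLam a i = \sum_(j < N) (j`!%:R)^-1 *: iter j Lam (a (i - j%:Z)).
Proof.
move=> mN; rewrite /expLam /nexp fct_sumE.
pose f j := (j`!%:R)^-1 *: iter j Lam (a (i - j%:Z)).
have fN n : (m < n)%N -> \sum_(j < n) f j = \sum_(j < m.+1) f j.
  move=> mn; apply: big_ord_truncate => // j /andP[mj _].
  by rewrite /f iter_Lam0 ?scaler0.
rewrite -/(\sum_(j < N) f j) (fN N)// -(fN m.+2)//; apply: eq_bigr => j _.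
by rewrite -[LHS]/((j`!%:R)^-1 *: iter j hLam a i) iter_hLam.
Qed.

Lemma expLam_hmon p u (N : nat) : (m < N)%N ->
  expLam (hmon p u) = \sum_(j < N) hmon (p + j%:Z) ((j`!%:R)^-1 *: iter j Lam u).
Proof.
move=> mN; apply/funext => i; rewrite (expLamE _ _ mN) [in RHS]fct_sumE.
apply: eq_bigr => j _; rewrite !hmonE subr_eq; case: ifP => // _.
suff -> : iter j Lam 0 = 0 by rewrite scaler0.
by elim: (j : nat) => //= k ->; rewrite linear0.
Qed.

Lemma finsupp_sum (I : finType) (F : I -> int -> pform A) :
  (forall i, finsupp (F i)) -> finsupp (\sum_i F i).
Proof. by move=> fF; apply: big_ind => //; [exact: finsupp0 | exact: finsuppD]. Qed.

Lemma finsupp_sum_morph (I : finType) (F : I -> int -> pform A) (g : (int -> pform A) -> int -> pform A) :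
  g 0 = 0 -> (forall a b, finsupp a -> finsupp b -> g (a + b) = g a + g b) ->
  (forall i, finsupp (F i)) -> g (\sum_i F i) = \sum_i g (F i).
Proof.
move=> g0 gD fF; suff [] : finsupp (\sum_i F i) /\ g (\sum_i F i) = \sum_i g (F i) by [].
apply: (big_ind2 (fun x y => finsupp x /\ g x = y)) => [|x y x' y' [fx <-] [fx' <-]|i _]; last by [].
- by split; [exact: finsupp0 | exact: g0].
- by split; [exact: finsuppD | exact: gD].
Qed.

Lemma lwedge_suml (I : finType) (F : I -> int -> pform A) b : (forall i, finsupp (F i)) -> finsupp b ->
  lwedge (\sum_i F i) b = \sum_i lwedge (F i) b.
Proof.
move=> fF fb; apply: (finsupp_sum_morph (g := lwedge^~ b)) => // [|a a' fa fa'].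
  exact: (lbilin0l fw0Dl fw0Dr).
exact: (lbilinDl fw0Dl fw0Dr).
Qed.

Lemma lwedge_sumr (I : finType) (F : I -> int -> pform A) a : (forall i, finsupp (F i)) -> finsupp a ->
  lwedge a (\sum_i F i) = \sum_i lwedge a (F i).
Proof.
move=> fF fa; apply: (finsupp_sum_morph (g := lwedge a)) => // [|b b' fb fb'].
  exact: (lbilin0r fw0Dl fw0Dr).
exact: (lbilinDr fw0Dl fw0Dr).
Qed.

(** In the coefficient of [h^n] only the terms with [n - p - q] contractions in all occur, and
    their sums are those of [exp_wcontr_wedge]. *)
Lemma expLam_qwedge_hmon p q u v : is_form u ->
  expLam (qwedge omega (hmon p u) (hmon q v)) = lwedge (expLam (hmon p u)) (expLam (hmon q v)).
Proof.
move=> fu; apply/funext => n; set i := n - p - q.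
have [s Es] : exists s : nat, (0 <= i -> i = s%:Z) by exists `|i|%N => i0; rewrite gez0_abs.
pose N := (m + s).+1; have mN : (m < N)%N by rewrite ltnS leq_addr.
have it0 k : iter k Lam 0 = 0 by elim: k => //= k ->; rewrite linear0.
rewrite (expLamE _ _ mN) (expLam_hmon _ _ mN) (expLam_hmon _ _ mN).
rewrite lwedge_suml => [|j|]; [|exact: finsupp_hmon|by apply: finsupp_sum => j; exact: finsupp_hmon].
under [X in _ = X n]eq_bigr => j _.
  rewrite lwedge_sumr; [|by move=> k; exact: finsupp_hmon|exact: finsupp_hmon].
  under eq_bigr => k _ do rewrite lwedge_hmon.
  over.
rewrite [in RHS]fct_sumE.
pose gl j := (j`!%:R)^-1 *: iter j Lam (qcoef u v (n - j%:Z - p - q)).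
pose gr (j : nat) := \sum_(k < N) if n == p + j%:Z + (q + k%:Z) then
   fwedge ((j`!%:R)^-1 *: iter j Lam u) ((k`!%:R)^-1 *: iter k Lam v) else 0.
transitivity (\sum_(j < N) gl j).
  by apply: eq_bigr => j _; rewrite qwedgeE (lbilin_hmon qcoefDl qcoefDr).
transitivity (\sum_(j < N) gr j); last first.
  by apply: eq_bigr => j _; rewrite [in RHS]fct_sumE.
have [i0|i0] := leP 0 i; last first.
  rewrite !big1// => j _.
    rewrite /gr big1// => k _; case: eqP => // E.
    by move: i0; rewrite /i E; lia.
  rewrite /gl; case E : (n - j%:Z - p - q) => [k|k] /=; last by rewrite it0 scaler0.
  by move: i0; rewrite /i; lia.
have iE := Es i0.
have sN : (s.+1 <= N)%N by rewrite ltnS leq_addl.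
rewrite (big_ord_truncate sN) => [|j /andP[sj _]]; last first.
  rewrite /gl; case E : (n - j%:Z - p - q) => [k|k] /=; last by rewrite it0 scaler0.
  by move: iE E; rewrite /i; lia.
rewrite (big_ord_truncate sN) => [|j /andP[sj _]]; last first.
  rewrite /gr big1// => k _; case: eqP => // E.
  by move: iE; rewrite /i E; lia.
transitivity (dpsum s (fun j k => iter j Lam (B k u v))).
  apply: eq_bigr => j _; have js : (j <= s)%N by rewrite -ltnS.
  rewrite /gl (_ : n - j%:Z - p - q = (s - j)%N%:Z); last by move: iE; rewrite /i; lia.
  rewrite /qcoef natrM invfM -scalerA; congr (_ *: _).
  have itZ k (t : R) w : iter k Lam (t *: w) = t *: iter k Lam w.
    by elim: k => //= k ->; rewrite linearZZ.
  by rewrite itZ.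
rewrite exp_wcontr_wedge//; apply: eq_bigr => j _; have js : (j <= s)%N by rewrite -ltnS.
have kN : (s - j < N)%N by rewrite ltnS (leq_trans (leq_subr _ _))// leq_addl.
rewrite /gr (bigD1 (Ordinal kN))//= big1 => [|k kj].
  rewrite ifT ?addr0; last by apply/eqP; move: iE; rewrite /i; lia.
  by rewrite fwedgeZl fwedgeZr scalerA natrM invfM.
case: eqP => // E; case/eqP: kj; apply: val_inj => /=.
by move: iE E; rewrite /i; lia.
Qed.

Local Notation form_laurent := (laurent (@is_form R m M A)).

Lemma form_submodule : submodule [set: R] *:%R (@is_form R m M A).
Proof. by split; [exact: is_form0 | exact: is_formD | move=> k u _; exact: is_formZ]. Qed.

Lemma hLam_laurent a : form_laurent a -> form_laurent (hLam a).
Proof.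
move=> [fa /finsuppP[r _ ra]]; split=> [p|]; first exact: Lam_form.
apply: (finsupp_seq (r := [seq p + 1 | p <- r])) => p pr.
rewrite /hLam ra ?linear0//; apply: contraNN pr => pr.
by apply/mapP; exists (p - 1); rewrite // subrK.
Qed.

Lemma expLam_laurent a : form_laurent a -> form_laurent (expLam a).
Proof.
have [L0 LD LZ] := laurent_submodule form_submodule.
by apply: nexp_stable => //; [move=> k b; exact: LZ | exact: hLam_laurent].
Qed.

Lemma expLam_inv_laurent a : form_laurent a -> form_laurent (expLam_inv a).
Proof.
have [L0 LD LZ] := laurent_submodule form_submodule.
by apply: ninv_stable => //; [move=> k b; exact: LZ | exact: hLam_laurent].
Qed.

Lemma expLamK a : expLam_inv (expLam a) = a.
Proof. by apply: ninv_nexp; exact: hLam_nilpotent. Qed.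

Lemma expLam_invK a : expLam (expLam_inv a) = a.
Proof. by apply: nexp_ninv; exact: hLam_nilpotent. Qed.

Lemma qwedgeDl a a' b : finsupp a -> finsupp a' -> finsupp b ->
  qwedge omega (a + a') b = qwedge omega a b + qwedge omega a' b.
Proof. exact: (lbilinDl qcoefDl qcoefDr). Qed.

Lemma qwedgeDr a b b' : finsupp a -> finsupp b -> finsupp b' ->
  qwedge omega a (b + b') = qwedge omega a b + qwedge omega a b'.
Proof. exact: (lbilinDr qcoefDl qcoefDr). Qed.

Lemma lwedgeDl a a' b : finsupp a -> finsupp a' -> finsupp b ->
  lwedge (a + a') b = lwedge a b + lwedge a' b.
Proof. exact: (lbilinDl fw0Dl fw0Dr). Qed.

Lemma lwedgeDr a b b' : finsupp a -> finsupp b -> finsupp b' ->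
  lwedge a (b + b') = lwedge a b + lwedge a b'.
Proof. exact: (lbilinDr fw0Dl fw0Dr). Qed.

Lemma lwedge0l b : finsupp b -> lwedge 0 b = 0.
Proof. exact: (lbilin0l fw0Dl fw0Dr). Qed.

Lemma lwedge0r a : finsupp a -> lwedge a 0 = 0.
Proof. exact: (lbilin0r fw0Dl fw0Dr). Qed.

Lemma qwedge0l b : finsupp b -> qwedge omega 0 b = 0.
Proof. exact: (lbilin0l qcoefDl qcoefDr). Qed.

Lemma qwedge0r a : finsupp a -> qwedge omega a 0 = 0.
Proof. exact: (lbilin0r qcoefDl qcoefDr). Qed.

(** Both sides are biadditive, which reduces the identity to monomials. *)
Lemma expLam_qwedge a b : form_laurent a -> form_laurent b ->
  expLam (qwedge omega a b) = lwedge (expLam a) (expLam b).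
Proof.
move=> La Lb; have fe c : form_laurent c -> finsupp (expLam c) by move=> /expLam_laurent[].
have eD c d : expLam (c + d) = expLam c + expLam d by exact: linearD.
have e0 : expLam 0 = 0 by exact: linear0.
move: a La; apply: (laurent_ind _ _ _ form_submodule) => [|a a' La La' IH IH'|p u fu].
- by case: (Lb) => _ fb; rewrite qwedge0l// e0 lwedge0l//; exact: fe.
- case: (La) (La') (Lb) => _ fa [_ fa'] [_ fb].
  rewrite (qwedgeDl fa fa' fb) (eD a a') (eD (qwedge omega a b) (qwedge omega a' b)) IH IH'.
  by rewrite lwedgeDl//; exact: fe.
have fh := finsupp_hmon p u.
have Lh : form_laurent (hmon p u) by apply: laurent_hmon => //; exact: is_form0.
move: b Lb; apply: (laurent_ind _ _ _ form_submodule) => [|b b' Lb Lb' IH IH'|q v fv].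
- by rewrite qwedge0r// e0 lwedge0r//; exact: fe.
- case: (Lb) (Lb') => _ fb [_ fb'].
  rewrite (qwedgeDr fh fb fb') (eD b b').
  rewrite (eD (qwedge omega (hmon p u) b) (qwedge omega (hmon p u) b')) IH IH'.
  by rewrite lwedgeDr//; exact: fe.
exact: expLam_qwedge_hmon.
Qed.

End quantum_product.

(** * The quantum differential is conjugate to both of its parts *)

Section conjugation.
Context (R : realType) (m : nat) (M : topologicalType) (A : atlas R m M).
Variable omega : pform A.
Hypothesis sympl : symplectic omega.
Implicit Types (u v : pform A) (a b : int -> pform A) (k n : int).

Local Notation Lam := (wcontr omega).
Local Notation Lef := (fwedge omega).

(** The projection onto the homogeneous part of degree [k]. *)
Definition fproj k : pform A -> pform A := fdiag (fun j => (j%:Z == k)%:R).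

Lemma kformP k u : is_kform k u <-> is_form u /\ fproj k u = u.
Proof.
split=> [[fu uk]|[fu <-]]; split=> //.
- apply/funext => c; apply/funext => x; apply/funext => I; rewrite /fproj /fdiag /ediag.
  have [->|/uk ->] := eqVneq (u c x I) 0; first by rewrite mulr0.
  by rewrite eqxx mul1r.
- exact: is_form_fdiag.
- move=> c x I; rewrite /fproj /fdiag /ediag; case: (eqVneq #|I|%:Z k) => // _.
  by rewrite mul0r eqxx.
Qed.

Lemma kform_form k u : is_kform k u -> is_form u. Proof. by case. Qed.

Lemma kform_fproj k u : is_form u -> is_kform k (fproj k u).
Proof.
move=> fu; split; first exact: is_form_fdiag.
move=> c x I; rewrite /fproj /fdiag /ediag; case: (eqVneq #|I|%:Z k) => // _.
by rewrite mul0r eqxx.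
Qed.

Lemma fproj_dform k u : is_form u -> fproj (k + 1) (dform u) = dform (fproj k u).
Proof.
move=> fu; rewrite /fproj dform_fdiag//.
suff -> : (fun j => (j%:Z == k + 1)%:R) \o succn = (fun j => (j%:Z == k)%:R) :> (nat -> R) by [].
by apply/funext => j /=; rewrite intS addrC (inj_eq (addIr 1)).
Qed.

Lemma fproj_Lam k u : fproj k (Lam u) = Lam (fproj (k + 2) u).
Proof.
apply/funext => c; apply/funext => x; rewrite /fproj wcontrE /fdiag elam_ediag.
suff -> : (fun j => (j%:Z == k + 2)%:R) \o succn \o succn = (fun j => (j%:Z == k)%:R) :> (nat -> R).
  by [].
by apply/funext => j /=; rewrite !intS addrA addrC (inj_eq (addIr (1 + 1))).
Qed.

Lemma fproj_delta k u : is_form u -> fproj k (delta omega u) = delta omega (fproj (k + 1) u).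
Proof.
move=> fu; have fL := Lam_form sympl fu.
have Ek : k + 2 = k + 1 + 1 by rewrite -addrA.
rewrite /delta [LHS]linearB /= -/(fproj k _) fproj_Lam Ek fproj_dform//; congr (_ - _).
have := fproj_dform (k - 1) fL; rewrite subrK /fproj => ->; congr dform; rewrite -/(fproj _ _).
by rewrite fproj_Lam (_ : k - 1 + 2 = k + 1)//; ring.
Qed.

Lemma kform_dform k u : is_kform k u -> is_kform (k + 1) (dform u).
Proof.
move=> /kformP[fu pu]; apply/kformP; split; first exact: is_form_dform.
by rewrite fproj_dform// pu.
Qed.

Lemma kform_Lam k u : is_kform (k + 2) u -> is_kform k (Lam u).
Proof.
move=> /kformP[fu pu]; apply/kformP; split; first exact: Lam_form.
by rewrite fproj_Lam pu.
Qed.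

Lemma kform_delta k u : is_kform (k + 1) u -> is_kform k (delta omega u).
Proof.
move=> /kformP[fu pu]; apply/kformP; split; first exact: delta_form.
by rewrite (fproj_delta k fu) pu.
Qed.

Lemma two_form_wedge_neq0 c x (a : ext R m) I : ewedge (omega c x) a I != 0 ->
  exists2 J, a J != 0 & #|I| = (#|J| + 2)%N.
Proof.
move=> nz; apply: contrapT => H; case/eqP: nz; rewrite ewedgeE big1// => J JI.
have [->|oJ] := eqVneq (omega c x J) 0; first by rewrite mulr0 mul0r.
have [->|aJ] := eqVneq (a (I :\: J)%SET) 0; first by rewrite mulr0.
case: H; exists (I :\: J)%SET => //.
have [J2] := omega_two sympl oJ.
by rewrite -(cardsID J I) (finset.setIidPr JI) J2 addnC.
Qed.

Lemma kform_Lef k u : is_kform k u -> is_kform (k + 2) (Lef u).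
Proof.
move=> [fu uk]; split; first exact: Lef_form.
move=> c x I /two_form_wedge_neq0[J /uk <- ->].
by rewrite PoszD.
Qed.

Lemma iter_Lef_eq0 (n : nat) u : (m < n.*2)%N -> iter n Lef u = 0.
Proof.
move=> mn; apply/funext => c; apply/funext => x; apply/funext => I.
suff H : iter n Lef u c x I != 0 -> (n.*2 <= #|I|)%N.
  apply/eqP; apply: contraTT mn => /H nI.
  by rewrite -leqNgt (leq_trans nI)// -[X in (_ <= X)%N](card_ord m) max_card.
elim: n I {mn} => [|n IH] I //.
rewrite iterS => /two_form_wedge_neq0[J /IH nJ ->].
by rewrite doubleS -addn2 leq_add2r.
Qed.

Lemma kform_eq0 k u : is_kform k u -> ~~ (0 <= k <= m%:Z) -> u = 0.
Proof.
move=> [_ uk] kn; apply/funext => c; apply/funext => x; apply/funext => I.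
apply/eqP; apply: contraNT kn => /uk <-; rewrite lez_nat /= -[X in (_ <= X)%N](card_ord m).
exact: max_card.
Qed.

Lemma kform_submodule k : submodule [set: R] *:%R (@is_kform R m M A k).
Proof.
split.
- by split=> [|c x I]; [exact: is_form0 | rewrite eqxx].
- move=> u v [fu uk] [fv vk]; split=> [|c x I]; first exact: is_formD.
  have [u0|/uk //] := eqVneq (u c x I) 0.
  by rewrite pformDK u0 add0r => /vk.
- move=> t u _ [fu uk]; split=> [|c x I]; first exact: is_formZ.
  by rewrite pformZK mulf_eq0 negb_or => /andP[_ /uk].
Qed.

Lemma kform0 k : @is_kform R m M A k 0. Proof. by have [] := kform_submodule k. Qed.

Lemma kformN k u : is_kform k u -> is_kform k (- u).
Proof. by have [_ _ Z] := kform_submodule k => ku; rewrite -scaleN1r; exact: Z. Qed.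

Lemma kformD k u v : is_kform k u -> is_kform k v -> is_kform k (u + v).
Proof. by have [_ D _] := kform_submodule k; exact: D. Qed.

(** The operator [Lef / h], again of degree 0. *)
Definition hLef a : int -> pform A := fun i => Lef (a (i + 1)).

Lemma hLef_is_linear : linear hLef.
Proof. by move=> k a b; apply/funext => i; exact: (linearP Lef). Qed.
HB.instance Definition _ := GRing.isLinear.Build R (int -> pform A) (int -> pform A) *:%R hLef hLef_is_linear.

Lemma iter_hLef (n : nat) a (i : int) : iter n hLef a i = iter n Lef (a (i + n%:Z)).
Proof.
elim: n i => [|n IH] i; first by rewrite addr0.
by rewrite iterS /hLef IH -addrA -intS.
Qed.

Lemma hLef_nilpotent a : iter m.+1 hLef a = 0.
Proof.
apply/funext => i; rewrite iter_hLef; apply: iter_Lef_eq0.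
by rewrite -addnn addSn ltnS leq_addr.
Qed.

Definition expLef := nexp hLef m.+1.

Definition all_forms : set (int -> pform A) := [set a | forall i, is_form (a i)].

Lemma d_hE a i : d_h omega a i = dform (a i) - delta omega (a (i - 1)).
Proof. by []. Qed.

Lemma all_formsD a b : all_forms a -> all_forms b -> all_forms (a + b).
Proof. by move=> fa fb i; exact: is_formD (fa i) (fb i). Qed.

Lemma all_formsZ (t : R) a : all_forms a -> all_forms (t *: a).
Proof. by move=> fa i; exact: is_formZ (fa i). Qed.

Lemma all_forms0 : all_forms 0. Proof. by move=> i; exact: is_form0. Qed.

Lemma ldformD a b : all_forms a -> all_forms b -> ldform (a + b) = ldform a + ldform b.
Proof. by move=> fa fb; apply/funext => i; exact: dformD (fa i) (fb i). Qed.

Lemma ldformZ (t : R) a : all_forms a -> ldform (t *: a) = t *: ldform a.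
Proof. by move=> fa; apply/funext => i; exact: dformZ (fa i). Qed.

Lemma lhdeltaD a b : all_forms a -> all_forms b ->
  lhdelta omega (a + b) = lhdelta omega a + lhdelta omega b.
Proof.
move=> fa fb; apply/funext => i.
rewrite -[RHS]/(- delta omega (a (i - 1)) - delta omega (b (i - 1))) -opprD.
by congr (- _); exact: deltaD (fa _) (fb _).
Qed.

Lemma lhdeltaZ (t : R) a : all_forms a -> lhdelta omega (t *: a) = t *: lhdelta omega a.
Proof.
move=> fa; apply/funext => i; rewrite -[RHS]/(t *: - delta omega (a (i - 1))) scalerN.
by congr (- _); exact: deltaZ (fa _).
Qed.

(** The bracket of [h Lam] with [d] is [h delta], with which [h Lam] commutes. *)
Lemma ldform_expLam a : all_forms a -> ldform (expLam omega a) = expLam omega (d_h omega a).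
Proof.
move=> fa; pose Y b : int -> pform A := fun i => delta omega (b (i - 1)).
have -> : d_h omega a = ldform a - Y a by [].
apply: (@nexp_conj R (int -> pform A) (hLam omega) m.+1 (@hLam_nilpotent _ _ _ _ omega) all_forms
  all_forms0 all_formsD all_formsZ _ (@ldform R m M A) Y ldformD ldformZ) => //.
- by move=> b fb i; exact: Lam_form.
- move=> b fb; apply/funext => i.
  by rewrite -[LHS]/(Lam (dform (b (i - 1)))) Lam_dform.
- by move=> b fb; apply/funext => i; exact: Lam_delta (fb _).
Qed.

(** The bracket of [Lef / h] with [- h delta] is [- d], with which [Lef / h] commutes. *)
Lemma lhdelta_expLef a : all_forms a -> lhdelta omega (expLef a) = expLef (d_h omega a).
Proof.
move=> fa; pose Y b : int -> pform A := fun i => - dform (b i).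
have -> : d_h omega a = lhdelta omega a - Y a.
  apply/funext => i; rewrite -[RHS]/(lhdelta omega a i - - dform (a i)) opprK.
  by rewrite addrC.
apply: (@nexp_conj R (int -> pform A) hLef m.+1 hLef_nilpotent all_forms
  all_forms0 all_formsD all_formsZ _ (lhdelta omega) Y lhdeltaD lhdeltaZ) => //.
- by move=> b fb i; exact: Lef_form.
- move=> b fb; apply/funext => i.
  rewrite -[LHS]/(Lef (- delta omega (b (i + 1 - 1)))) addrK.
  rewrite -[RHS]/(- delta omega (Lef (b (i - 1 + 1))) - dform (b i)) subrK -opprD -Lef_delta//.
  exact: (linearN Lef).
- move=> b fb; apply/funext => i.
  rewrite -[RHS]/(- dform (Lef (b (i + 1)))) dform_Lef//.
  exact: (linearN Lef).
Qed.

End conjugation.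

(** * The double complex and its filtrations *)

Section double_complex_sums.
Context (R : realType) (m : nat) (M : topologicalType) (A : atlas R m M).
Implicit Types (u v : pform A) (a b : int -> pform A) (k n i p : int).

(** Cochains of total degree [n]: as [h] has degree 2, the coefficient of [h^i] has degree
    [n - 2 i]. Only finitely many of these degrees lie between 0 and [m], so the cochain is
    automatically a Laurent polynomial. *)
Definition qtot n : set (int -> pform A) := [set a | forall i, is_kform (n - i - i) (a i)].

Lemma qtot_finsupp n a : qtot n a -> finsupp a.
Proof.
move=> ta; apply: (finsupp_seq (r := [seq ((n - j%:Z) %/ 2)%Z | j <- iota 0 m.+1])) => i.
move=> ir; apply: (kform_eq0 (ta i)); apply: contraNN ir => /andP[i0 im].
have [k Ek] : exists k : nat, n - i - i = k%:Z.
  by case: (n - i - i) i0 => // k _; exists k.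
rewrite Ek lez_nat in im; apply/mapP; exists k; first by rewrite mem_iota.
by rewrite -Ek (_ : n - (n - i - i) = i * 2) ?mulzK//; ring.
Qed.

Lemma fsbig_hmon (c : int -> int -> pform A) : finite_set [set p | c p != 0] ->
  (forall p i, i != p -> c p i = 0) ->
  \sum_(p \in [set: int]) c p = (fun i => c i i).
Proof.
move=> /finsuppP[r ur cr] cd; apply/funext => i.
rewrite (fsbigE r)//; last by move=> p _ /cr.
rewrite (eq_bigl xpredT) => [|p]; last exact: classical_sets.in_setT.
rewrite [in LHS]fct_sumE; have [ir|ir] := boolP (i \in r).
  by rewrite (bigD1_seq i)//= big1 ?addr0// => p pi; rewrite cd// eq_sym.
rewrite (cr i ir) big_seq big1// => p pr; apply: cd.
by apply: contraNneq ir => ->.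
Qed.

Lemma dc_sumE P n : dc_sum (qdc A) P n =
  [set a | qtot n a /\ forall i, a i != 0 -> P i].
Proof.
apply/seteqP; split => [a [c [cC cf cP ->]]|a [ta aP]].
  have cd p i : i != p -> c p i = 0.
    by move=> /negbTE ip; have [u _ <-] := cC p; rewrite hmonE ip.
  rewrite fsbig_hmon//; split=> i /=.
    by have [u ku <-] := cC i; rewrite hmonE eqxx.
  by move=> ci; apply: cP => /=; apply: contra_neq ci => ->.
exists (fun p => hmon p (a p)).
have nz p : hmon p (a p) != 0 -> a p != 0 by apply: contra_neq => ->; rewrite hmon0.
split.
- by move=> p; exists (a p) => //; exact: ta.
- by apply: sub_finite_set (qtot_finsupp ta) => p; exact: nz.
- by move=> p /= /nz; exact: aP.
- rewrite fsbig_hmon.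
  + by apply/funext => i; rewrite hmonE eqxx.
  + by apply: sub_finite_set (qtot_finsupp ta) => p; exact: nz.
  + by move=> p i /negbTE ip; rewrite hmonE ip.
Qed.

(** [s n i] is the filtration degree of the [h^i]-component in total degree [n]; it is [i] for
    the filtration by [p] and [n - i] for the filtration by [q]. *)
Definition qfilt (s : int -> int -> int) p n : set (int -> pform A) :=
  [set a | qtot n a /\ forall i, s n i < p -> a i = 0].

Lemma dc_totE n : dc_tot (qdc A) n = qtot n.
Proof. by rewrite /dc_tot dc_sumE; apply/seteqP; split => a; [case | split]. Qed.

Lemma dc_sum_qfilt s p n : dc_sum (qdc A) [set i | p <= s n i] n = qfilt s p n.
Proof.
rewrite dc_sumE; apply/seteqP; split=> a [ta H]; split=> // i.
  by move=> ip; apply/eqP; apply: contraTT ip => /H /=; rewrite -leNgt.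
by move=> ai /=; rewrite leNgt; apply: contra_neqN ai; exact: H.
Qed.

Lemma dc_filt1E : dc_filt1 (qdc A) = qfilt (fun n i => i).
Proof. by apply/funext => p; apply/funext => n; exact: (dc_sum_qfilt (fun n i => i)). Qed.

Lemma dc_filt2E : dc_filt2 (qdc A) = qfilt (fun n i => n - i).
Proof. by apply/funext => p; apply/funext => n; exact: (dc_sum_qfilt (fun n i => n - i)). Qed.

Lemma qtot_submodule n : submodule [set: R] *:%R (qtot n).
Proof.
split=> [i|a b ta tb i|t a _ ta i].
- exact: kform0.
- exact: kformD (ta i) (tb i).
- by have [_ _ Z] := kform_submodule A (n - i - i); exact: Z.
Qed.

Lemma qtot_forms n a : qtot n a -> all_forms a.
Proof. by move=> ta i; exact: kform_form (ta i). Qed.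

Lemma qtot_laurent n a : qtot n a -> laurent (@is_form R m M A) a.
Proof. by move=> ta; split; [exact: qtot_forms ta | exact: qtot_finsupp ta]. Qed.

(** The operator [h^t f]. *)
Definition hshift (t : int) (f : pform A -> pform A) a : int -> pform A :=
  fun i => f (a (i - t)).

Definition hshift2 e (f : pform A -> pform A) e' (g : pform A -> pform A) a : int -> pform A :=
  hshift e f a + hshift e' g a.

Section one_filtration.
Variables (s : int -> int -> int) (X0 Y0 : pform A -> pform A) (e e' : int).
Hypothesis s_inj : forall n i j, s n i = s n j -> i = j.
Hypothesis s_bound : forall n, exists lo hi, forall i, 0 <= n - i - i <= m%:Z -> lo <= s n i < hi.
Hypothesis sX : forall n i, s (n + 1) i = s n (i - e).
Hypothesis sY : forall n i, s (n + 1) i = s n (i - e') + 1.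
Hypothesis X0K : forall k u, is_kform k u -> is_kform (k + 1 - e - e) (X0 u).
Hypothesis Y0K : forall k u, is_kform k u -> is_kform (k + 1 - e' - e') (Y0 u).
Hypothesis X0B : forall u v, is_form u -> is_form v -> X0 (u - v) = X0 u - X0 v.
Hypothesis Y0B : forall u v, is_form u -> is_form v -> Y0 (u - v) = Y0 u - Y0 v.

Local Notation X := (hshift e X0).
Local Notation Y := (hshift e' Y0).
Local Notation D := (hshift2 e X0 e' Y0).
Local Notation F := (qfilt s).

Lemma X0_zero : X0 0 = 0.
Proof. by have := X0B (is_form0 A) (is_form0 A); rewrite !subrr. Qed.

Lemma Y0_zero : Y0 0 = 0.
Proof. by have := Y0B (is_form0 A) (is_form0 A); rewrite !subrr. Qed.

Lemma qtotX n a : qtot n a -> qtot (n + 1) (X a).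
Proof.
move=> ta i; rewrite (_ : n + 1 - i - i = n - (i - e) - (i - e) + 1 - e - e); last by ring.
exact/X0K/ta.
Qed.

Lemma qtotY n a : qtot n a -> qtot (n + 1) (Y a).
Proof.
move=> ta i; rewrite (_ : n + 1 - i - i = n - (i - e') - (i - e') + 1 - e' - e'); last by ring.
exact/Y0K/ta.
Qed.

Lemma qtot_hshift2 n a : qtot n a -> qtot (n + 1) (D a).
Proof. by move=> ta i; exact: kformD (qtotX ta i) (qtotY ta i). Qed.

Lemma qfilt_submodule p n : submodule [set: R] *:%R (F p n).
Proof.
have [t0 tD tZ] := qtot_submodule n; split=> [|a b [ta Fa] [tb Fb]|t a _ [ta Fa]].
- by split.
- by split=> [|i ip]; [exact: tD | rewrite -[LHS]/(a i + b i) Fa// Fb// addr0].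
- by split=> [|i ip]; [exact: tZ | rewrite -[LHS]/(t *: a i) Fa// scaler0].
Qed.

Lemma qfilt_decr p p' n : p <= p' -> F p' n `<=` F p n.
Proof. by move=> pp a [ta Fa]; split=> // i ip; apply: Fa; exact: lt_le_trans pp. Qed.

Lemma qfilt_top n : exists t : int, forall p, p <= t -> qtot n `<=` F p n.
Proof.
have [lo [hi H]] := s_bound n; exists lo => p plo a ta; split=> // i ip.
apply: (kform_eq0 (ta i)); apply/negP => /H /andP[+ _].
by rewrite leNgt (lt_le_trans ip).
Qed.

Lemma qfilt_bot n : exists t : int, forall p, t <= p -> F p n `<=` [set 0].
Proof.
have [lo [hi H]] := s_bound n; exists hi => p hip a [ta Fa]; apply/funext => i.
have [ip|ip] := ltP (s n i) p; first exact: Fa.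
apply: (kform_eq0 (ta i)); apply/negP => /H /andP[_].
by rewrite ltNge (le_trans hip).
Qed.

Lemma qfiltX p n a : F p n a -> F p (n + 1) (X a).
Proof.
move=> [ta Fa]; split=> [|i]; first exact: qtotX.
by rewrite sX /hshift => /Fa->; exact: X0_zero.
Qed.

Lemma qfiltY p n a : F p n a -> F (p + 1) (n + 1) (Y a).
Proof.
move=> [ta Fa]; split=> [|i]; first exact: qtotY.
by rewrite sY ltrD2r /hshift => /Fa->; exact: Y0_zero.
Qed.

Lemma qfiltD p n a : F p n a -> F p (n + 1) (D a).
Proof.
move=> Fa; have [_ FD _] := qfilt_submodule p (n + 1); apply: FD; first exact: qfiltX.
by apply: qfilt_decr (qfiltY Fa); rewrite lerDl.
Qed.

Lemma hshift2B n a b : qtot n a -> qtot n b -> D (a - b) = D a - D b.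
Proof.
move=> /qtot_forms fa /qtot_forms fb; apply/funext => i.
rewrite -[LHS]/(X0 (a (i - e) - b (i - e)) + Y0 (a (i - e') - b (i - e'))).
rewrite -[RHS]/(X0 (a (i - e)) + Y0 (a (i - e')) - (X0 (b (i - e)) + Y0 (b (i - e')))).
by rewrite X0B// Y0B// opprD addrACA.
Qed.

Lemma hshiftB n a b : qtot n a -> qtot n b -> X (a - b) = X a - X b.
Proof.
by move=> /qtot_forms fa /qtot_forms fb; apply/funext => i; exact: X0B (fa _) (fb _).
Qed.

(** The truncation of [y] to filtration degrees at least [t]. *)
Lemma qfilt_split p t n y : F p n y -> exists2 z, F t n z & F p n (y - z) /\
  (F t (n + 1) (X y) -> X (y - z) = 0).
Proof.
move=> [ty Fy]; pose z i := if s n i < t then 0 else y i.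
have tz : qtot n z by move=> i; rewrite /z; case: ifP => // _; exact: kform0.
exists z; first by split=> // i it; rewrite /z it.
split; [split=> [|i ip]|move=> [_ FX]].
- have [_ tD tZ] := qtot_submodule n; apply: tD => //.
  by rewrite -scaleN1r; exact: tZ.
- by rewrite -[LHS]/(y i - z i) /z Fy// if_same subrr.
- apply/funext => i; rewrite -[LHS]/(X0 (y (i - e) - z (i - e))) /z.
  case: ifP => [it|_]; last by rewrite subrr; exact: X0_zero.
  by rewrite subr0; apply: FX; rewrite sX.
Qed.

(** An element of filtration degree [s n p] is determined, modulo higher filtration, by its
    [h^p]-component, and modulo higher filtration the differential acts on this component
    by [X0] alone. *)
Lemma qfilt_page1 n p (Z B : set (pform A)) :
  (forall u, Z u <-> is_kform (n - p - p) u /\ X0 u = 0) ->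
  (forall u, B u <-> exists2 v, is_kform (n - 1 - (p - e) - (p - e)) v & u = X0 v) ->
  sq_iso [set: R] *:%R *:%R (sq_hmon p (SubQuot Z B)) (ss_page D F 1 (s n p) n) id.
Proof.
move=> HZ HB.
have D0 : D 0 = 0 by have [t0 _ _] := qtot_submodule n; have := hshift2B t0 t0; rewrite !subrr.
have F00 q k : F q k 0 by have [] := qfilt_submodule q k.
have bnd0 : bnd (ss_page D F 1 (s n p) n) 0.
  by exists 0, 0; split; rewrite /ss_cyc /= ?D0 ?addr0.
have sp : s n p = s (n - 1) (p - e) by rewrite -sX subrK.
have thm k q u : is_kform (k - q - q) u -> qtot k (hmon q u).
  by move=> ku i; rewrite hmonE; case: eqP => [->|_] //; exact: kform0.
have Fhm k q u : is_kform (k - q - q) u -> F (s k q) k (hmon q u).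
  move=> ku; split=> [|i iq]; first exact: thm.
  by rewrite hmonE; case: eqP => // E; rewrite E ltxx in iq.
have Xhm q u : X (hmon q u) = hmon (q + e) (X0 u).
  apply/funext => i; rewrite /hshift !hmonE subr_eq; case: ifP => // _; exact: X0_zero.
split=> [_ [u /HZ[ku Xu] <-]|x y _ _|c x _ _|_ [u /HZ[ku Xu] <-]|y [[ty Fy] [tDy FDy]]].
- split; first exact: Fhm.
  rewrite /hshift2 Xhm Xu hmon0 add0r; apply: qfiltY; exact: Fhm.
- by rewrite subrr.
- by rewrite subrr.
- split=> [[y [z [[[ty Fy] _] [[tz Fz] _] xyz]]]|[_ /HB[v kv ->] E]].
    exists u => //; apply/HB; exists (z (p - e)).
      by have := tz (p - e).
    have := congr1 (fun a => a p) xyz.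
    rewrite hmonE eqxx -[X in _ = X -> _]/(y p + (X0 (z (p - e)) + Y0 (z (p - e')))).
    rewrite Fy ?ltrDl// add0r (Fz (p - e')) ?Y0_zero ?addr0//.
    have := sY (n - 1) p; rewrite subrK subrK => ->.
    by rewrite ltrDl.
  have {E} E : hmon p (X0 v) = hmon p u by exact: E.
  have Fv : F (s n p) (n - 1) (hmon (p - e) v) by rewrite sp; exact: Fhm.
  have Y1 : F (s n p + 1) n (Y (hmon (p - e) v)) by rewrite -{2}(subrK 1 n); exact: qfiltY.
  have NY : F (s n p + 1) n (- Y (hmon (p - e) v)).
    by have [_ _ FZ'] := qfilt_submodule (s n p + 1) n; rewrite -scaleN1r; exact: FZ'.
  exists (- Y (hmon (p - e) v)), (hmon (p - e) v); split.
  + by split=> //; rewrite subrr addr0; exact: qfiltD.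
  + by rewrite /ss_cyc /= subrr addr0 subrK; split=> //; exact: qfiltD.
  + by rewrite /hshift2 Xhm subrK E addrC addrK.
- have XY : X0 (y p) = 0.
    have := FDy (p + e); rewrite sX addrK ltrDl => /(_ isT).
    rewrite -[LHS]/(X0 (y (p + e - e)) + Y0 (y (p + e - e'))) addrK.
    rewrite (Fy (p + e - e')) ?Y0_zero ?addr0//.
    have := sY n (p + e); rewrite sX addrK => ->.
    by rewrite ltrDl.
  have Zy : Z (y p) by apply/HZ; split=> //; exact: ty.
  exists (hmon p (y p)); first by exists (y p).
  have Fd : F (s n p + 1) n (y - hmon p (y p)).
    have [_ tD tZ] := qtot_submodule n; split=> [|i].
      by apply: tD => //; rewrite -scaleN1r; apply: tZ => //; apply: thm; exact: ty.
    rewrite ltzD1 le_eqVlt => /orP[/eqP/s_inj->|ip].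
      by rewrite -[LHS]/(y p - hmon p (y p) p) hmonE eqxx subrr.
    rewrite -[LHS]/(y i - hmon p (y p) i) hmonE Fy//; case: eqP => [E|_]; last by rewrite subrr.
    by rewrite E ltxx in ip.
  exists (y - hmon p (y p)), 0; split; last by rewrite D0 addr0.
    by split=> //; rewrite subrr addr0; exact: qfiltD.
  by split=> //; rewrite D0.
Qed.

End one_filtration.
End double_complex_sums.

(** * The two spectral sequences *)

Section spectral_sequences.
Context (R : realType) (m : nat) (M : topologicalType) (A : atlas R m M).
Variable omega : pform A.
Hypothesis sympl : symplectic omega.
Implicit Types (u v : pform A) (a b : int -> pform A) (k n i p q : int).

Local Notation ndelta := (fun u => - delta omega u).

Lemma ldform_shift : @ldform R m M A = hshift 0 (@dform R m M A).
Proof. by apply/funext => a; apply/funext => i; rewrite /hshift subr0. Qed.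

Lemma d_h_shift1 : d_h omega = hshift2 0 (@dform R m M A) 1 ndelta.
Proof. by apply/funext => a; rewrite /hshift2 -ldform_shift. Qed.

Lemma d_h_shift2 : d_h omega = hshift2 1 ndelta 0 (@dform R m M A).
Proof. by apply/funext => a; rewrite /hshift2 addrC -ldform_shift. Qed.

Lemma ndeltaB u v : is_form u -> is_form v ->
  - delta omega (u - v) = - delta omega u - - delta omega v.
Proof. by move=> fu fv; rewrite -opprD; congr (- _); exact: (adLamB sympl 1). Qed.

Lemma deltaN u : is_form u -> delta omega (- u) = - delta omega u.
Proof. by move=> fu; rewrite -(scaleN1r u) (deltaZ sympl _ fu) scaleN1r. Qed.

Lemma ndelta_kform k u : is_kform k u -> is_kform (k + 1 - 1 - 1) (- delta omega u).
Proof. by move=> ku; apply: kformN; rewrite addrK; apply: kform_delta; rewrite // subrK. Qed.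

Lemma dform_kform k u : is_kform k u -> is_kform (k + 1 - 0 - 0) (dform u).
Proof. by rewrite !subr0; exact: kform_dform. Qed.

Lemma degree_bound_p n : exists lo hi : int, forall i : int, 0 <= n - i - i <= m%:Z -> lo <= i < hi.
Proof.
have [n0|n0] := leP 0 n; first by exists (- m%:Z), (n + 1) => i; lia.
by exists (n - m%:Z), 1 => i; lia.
Qed.

Lemma degree_bound_q n : exists lo hi : int, forall i : int, 0 <= n - i - i <= m%:Z -> lo <= n - i < hi.
Proof.
have [n0|n0] := leP 0 n; first by exists 0, (n + m%:Z + 1) => i; lia.
by exists n, (m%:Z + 1) => i; lia.
Qed.

Local Notation F1 := (@qfilt R m M A (fun n i => i)).
Local Notation F2 := (@qfilt R m M A (fun n i => n - i)).

Lemma hLam_qfilt p n a : F1 p n a -> F1 p n (hLam omega a).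
Proof.
move=> [ta Fa]; split=> [i|i ip].
  by apply: kform_Lam => //; rewrite (_ : _ + 2 = n - (i - 1) - (i - 1)); [exact: ta | ring].
by rewrite /hLam Fa ?linear0//; lia.
Qed.

Lemma hLef_qfilt p n a : F2 p n a -> F2 p n (hLef omega a).
Proof.
move=> [ta Fa]; split=> [i|i ip].
  rewrite (_ : n - i - i = n - (i + 1) - (i + 1) + 2); last by ring.
  by apply: kform_Lef => //; exact: ta.
by rewrite /hLef Fa ?linear0//; lia.
Qed.

Lemma QHdRn_cyc n a : cyc (QHdRn omega n) a <-> qtot n a /\ d_h omega a = 0.
Proof.
rewrite /QHdRn dc_totE; split=> [[[_ Da] ta]|[ta Da]] //.
by split=> //; split=> //; exact: qtot_laurent ta.
Qed.

(** A boundary of degree [n] bounds a cochain of degree [n - 1], obtained by projecting the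
    coefficients of any primitive. *)
Lemma QHdRn_bnd n a : bnd (QHdRn omega n) a <-> exists2 b, qtot (n - 1) b & a = d_h omega b.
Proof.
rewrite /QHdRn dc_totE; split=> [[[b [fb _] <-] tD]|[b tb ->]]; last first.
  split; first by exists b => //; exact: qtot_laurent tb.
  rewrite -{1}(subrK 1 n) d_h_shift1; apply: qtot_hshift2 => //.
  - exact: dform_kform.
  - exact: ndelta_kform.
pose c i := fproj (n - 1 - i - i) (b i).
exists c; first by move=> i; exact: kform_fproj.
apply/funext => i; have /kformP[_ <-] := tD i; rewrite !d_hE.
have e1 : fproj (n - i - i) (dform (b i)) = dform (c i).
  rewrite (_ : n - i - i = n - 1 - i - i + 1); last by ring.
  exact: fproj_dform.
have e2 : fproj (n - i - i) (delta omega (b (i - 1))) = delta omega (c (i - 1)).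
  rewrite /c (_ : n - 1 - (i - 1) - (i - 1) = n - i - i + 1); last by ring.
  exact: fproj_delta.
by rewrite -e1 -e2; exact: linearB.
Qed.

Lemma qfilt_abuts (s : int -> int -> int) :
  (forall n, exists lo hi : int, forall i, 0 <= n - i - i <= m%:Z -> lo <= s n i < hi) ->
  ss_abuts (d_h omega) (@qfilt R m M A s) (QHdRn omega).
Proof.
move=> bound; apply: (@filtered_abuts _ _ _ _ (@qtot R m M A)).
- exact: qfilt_submodule.
- by move=> *; exact: qfilt_decr.
- by move=> p n a [].
- exact: (qfilt_top A bound).
- exact: (qfilt_bot A bound).
- by move=> n x y tx ty; rewrite d_h_shift1; apply: (hshift2B _ _ (@dformB _ _ _ _) ndeltaB tx ty).
- exact: QHdRn_cyc.
- exact: QHdRn_bnd.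
Qed.

Lemma qfilt_degenerates (s : int -> int -> int) (T : {linear (int -> pform A) -> (int -> pform A)}) X0 e :
  (forall a, iter m.+1 T a = 0) ->
  (forall p n a, qfilt s p n a -> qfilt s p n (T a)) ->
  (forall a, all_forms a -> hshift e X0 (nexp T m.+1 a) = nexp T m.+1 (d_h omega a)) ->
  (forall u v, is_form u -> is_form v -> X0 (u - v) = X0 u - X0 v) ->
  (forall n i, s (n + 1) i = s n (i - e)) ->
  ss_degenerates (d_h omega) (@qfilt R m M A s) 1.
Proof.
move=> T0 FT conj X0B sX.
apply: (@conjugate_degenerates _ _ (d_h omega) (hshift e X0) (nexp T m.+1) (ninv T m.+1) _ (@qtot R m M A)).
- exact: qfilt_submodule.
- by move=> *; exact: qfilt_decr.
- by move=> p n a [].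
- by move=> n x y tx ty; rewrite d_h_shift1; apply: (hshift2B _ _ (@dformB _ _ _ _) ndeltaB tx ty).
- move=> p n a; have [F0 FD FZ] := qfilt_submodule A s p n.
  by apply: nexp_stable => //; [move=> k b; exact: FZ | exact: FT].
- move=> p n a; have [F0 FD FZ] := qfilt_submodule A s p n.
  by apply: ninv_stable => //; [move=> k b; exact: FZ | exact: FT].
- by move=> x; exact: nexp_ninv.
- by move=> x y; exact: nexp_inj.
- by move=> n x /qtot_forms; exact: conj.
- by move=> n x y tx ty; apply: (hshiftB e X0B tx ty).
- by move=> p t n y; exact: qfilt_split.
Qed.

Lemma de_rham_spectral_sequence : ss_abuts (d_h omega) (dc_filt1 (qdc A)) (QHdRn omega) /\
  (forall p q : int, sq_iso [set: R] *:%R *:%R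
      (sq_hmon p (HdRk A (q - p))) (Epage omega 1 p q) id) /\
  ss_degenerates (d_h omega) (dc_filt1 (qdc A)) 1.
Proof.
rewrite /Epage dc_filt1E; split; [|split].
- exact: qfilt_abuts degree_bound_p.
- move=> p q; rewrite d_h_shift1.
  apply: (@qfilt_page1 R m M A (fun n i => i) (@dform R m M A) ndelta 0 1 _ _ _ _ _ _ _ (p + q) p).
  + by [].
  + by move=> n i; rewrite subr0.
  + by move=> n i; rewrite subrK.
  + exact: dform_kform.
  + exact: ndelta_kform.
  + exact: dformB.
  + exact: ndeltaB.
  + by move=> u; rewrite (_ : p + q - p - p = q - p); last by ring.
  + move=> u; rewrite (_ : p + q - 1 - (p - 0) - (p - 0) = q - p - 1); last by ring.
    by split=> [[v kv <-]|[v kv ->]]; exists v.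
- apply: (qfilt_degenerates (T := hLam omega) (X0 := @dform R m M A) (e := 0)).
  + exact: hLam_nilpotent.
  + exact: hLam_qfilt.
  + by move=> a; rewrite -ldform_shift; exact: ldform_expLam.
  + exact: dformB.
  + by move=> n i; rewrite subr0.
Qed.

Lemma poisson_spectral_sequence : ss_abuts (d_h omega) (dc_filt2 (qdc A)) (QHdRn omega) /\
  (forall p q : int, sq_iso [set: R] *:%R *:%R
      (sq_hmon p (PHk omega (q - p))) (Epage' omega 1 p q) id) /\
  ss_degenerates (d_h omega) (dc_filt2 (qdc A)) 1.
Proof.
rewrite /Epage' dc_filt2E; split; [|split].
- exact: qfilt_abuts degree_bound_q.
- move=> p q; rewrite d_h_shift2.
  have {2}-> : q = p + q - p by rewrite addrAC subrr add0r.
  apply: (@qfilt_page1 R m M A (fun n i => n - i) ndelta (@dform R m M A) 1 0 _ _ _ _ _ _ _ (p + q) p).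
  + by move=> n i j /addrI/oppr_inj.
  + by move=> n i; ring.
  + by move=> n i; ring.
  + exact: ndelta_kform.
  + exact: dform_kform.
  + exact: ndeltaB.
  + exact: dformB.
  + move=> u; rewrite (_ : p + q - p - p = q - p); last by ring.
    by split=> -[ku /eqP E]; split=> //; apply/eqP; move: E; rewrite oppr_eq0.
  + move=> u; rewrite (_ : p + q - 1 - (p - 1) - (p - 1) = q - p + 1); last by ring.
    split=> [[v kv <-]|[v kv ->]].
      exists (- v); first exact: kformN.
      by rewrite (deltaN (kform_form kv)) opprK.
    by exists (- v); [exact: kformN | exact: deltaN (kform_form kv)].
- apply: (qfilt_degenerates (T := hLef omega) (X0 := ndelta) (e := 1)).
  + exact: hLef_nilpotent.
  + exact: hLef_qfilt.
  + exact: lhdelta_expLef.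
  + exact: ndeltaB.
  + by move=> n i; ring.
Qed.

Lemma quantum_double_complex : double_complex (qdc A) (lhdelta omega) (@ldform R m M A).
Proof.
move=> p q; have [K0 KD KZ] := kform_submodule A (q - p).
have form k u : is_kform k u -> is_form u by exact: kform_form.
have dE r u : ldform (hmon r u) = hmon r (dform u).
  by apply/funext => i; rewrite /ldform !hmonE; case: ifP => // _; exact: dform0.
have delta0 : delta omega 0 = 0.
  by have := ndeltaB (is_form0 A) (is_form0 A); rewrite !subrr => /eqP; rewrite oppr_eq0 => /eqP.
have sE r u : lhdelta omega (hmon r u) = hmon (r + 1) (- delta omega u).
  apply/funext => i; rewrite /lhdelta !hmonE subr_eq; case: ifP => // _.
  by rewrite delta0 oppr0.
have afm u : is_form u -> all_forms (hmon p u).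
  by move=> fu i; rewrite hmonE; case: ifP => // _; exact: is_form0.
split.
- split=> [|_ _ [u ku <-] [v kv <-]|t _ _ [u ku <-]].
  + by exists 0; rewrite ?hmon0.
  + by exists (u + v); rewrite ?hmonD//; exact: KD.
  + by exists (t *: u); rewrite ?hmonZ//; exact: KZ.
- move=> t _ _ [u /form fu <-] [v /form fv <-].
  have zu : all_forms (t *: hmon p u) by apply/all_formsZ/afm.
  split; first by rewrite lhdeltaD// ?lhdeltaZ//; exact: afm.
  by rewrite ldformD// ?ldformZ//; exact: afm.
- move=> _ [u ku <-]; rewrite sE dE; split.
    exists (- delta omega u) => //; apply: kformN; apply: kform_delta => //.
    by rewrite (_ : q - (p + 1) + 1 = q - p)//; ring.
  exists (dform u) => //; rewrite (_ : q + 1 - p = q - p + 1); last by ring.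
  exact: kform_dform.
- move=> _ [u /form fu <-]; rewrite !sE !dE !sE; split.
  + have du : is_form (delta omega u) by exact: delta_form.
    by rewrite (deltaN du) delta_delta// !oppr0 hmon0.
  + by rewrite dform_dform// hmon0.
  + rewrite -hmonD delta_dform// opprK.
    have -> : dform (- delta omega u) = - dform (delta omega u).
      by rewrite -scaleN1r dformZ ?scaleN1r//; exact: delta_form.
    by rewrite subrr hmon0.
Qed.

End spectral_sequences.

(** * Algebra structures on subquotients *)

Section subquotient_algebras.
Context (K : Type) (S : set K).

(** Products of differential forms satisfy the laws of an algebra on representatives, not
    only up to boundaries. *)
Lemma sq_algebra_exact (V : zmodType) (act : K -> V -> V) (X : subquot V) (mul : V -> V -> V) (e : V) :
  sq_module S act X ->
  (forall x y, cyc X x -> cyc X y -> cyc X (mul x y)) ->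
  (forall x y, bnd X x -> cyc X y -> bnd X (mul x y) /\ bnd X (mul y x)) ->
  (forall x y z, cyc X x -> cyc X y -> cyc X z ->
     mul (x + y) z = mul x z + mul y z /\ mul z (x + y) = mul z x + mul z y) ->
  (forall c x y, S c -> cyc X x -> cyc X y ->
     mul (act c x) y = act c (mul x y) /\ mul x (act c y) = act c (mul x y)) ->
  (forall x y z, cyc X x -> cyc X y -> cyc X z -> mul (mul x y) z = mul x (mul y z)) ->
  cyc X e -> (forall x, cyc X x -> mul e x = x /\ mul x e = x) ->
  sq_algebra S act X mul.
Proof.
move=> Xm XX hshiftB XD XZ XA Xe Xu; have [_ [B0 _ _] _] := Xm.
split=> //; last 2 first.
- by move=> x y z cx cy cz; rewrite XA// subrr.
- by exists e => // x /Xu[-> ->]; rewrite subrr.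
split=> // [x y z cx cy cz|c x y Sc cx cy].
- by have [-> ->] := XD x y z cx cy cz; rewrite !subrr.
- by have [-> ->] := XZ c x y Sc cx cy; rewrite !subrr.
Qed.

(** Structure is transported through an additive bijection that matches cycles and boundaries
    and is compatible with the operations on cycles. *)
Lemma sq_algebra_transport (V W : zmodType) (actV : K -> V -> V) (actW : K -> W -> W)
    (X : subquot V) (mulX : V -> V -> V) (E : subquot W) (mulE : W -> W -> W)
    (f : {additive W -> V}) (g : V -> W) :
  cancel g f ->
  (forall x, cyc E x <-> cyc X (f x)) -> (forall x, bnd E x <-> bnd X (f x)) ->
  (forall c x, S c -> cyc E x -> f (actW c x) = actV c (f x)) ->
  (forall x y, cyc E x -> cyc E y -> f (mulE x y) = mulX (f x) (f y)) ->
  sq_algebra S actV X mulX -> sq_algebra S actW E mulE.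
Proof.
move=> gK fc fb fZ fM [[[Z0 ZD ZZ] [B0 BD BZ] BZs] [MM MB MD MZ] MA [e ce Xe]].
have cb x : bnd E x -> cyc E x by move=> /fb/BZs/fc.
have cM x y : cyc E x -> cyc E y -> cyc E (mulE x y).
  by move=> cx cy; apply/fc; rewrite fM//; apply: MM; exact/fc.
have cA c x : S c -> cyc E x -> cyc E (actW c x).
  by move=> Sc cx; apply/fc; rewrite fZ//; apply: ZZ => //; exact/fc.
have cD x y : cyc E x -> cyc E y -> cyc E (x + y).
  by move=> /fc cx /fc cy; apply/fc; rewrite raddfD; exact: ZD.
split.
- split=> //; split=> //.
  + by apply/fc; rewrite raddf0.
  + by apply/fb; rewrite raddf0.
  + by move=> x y /fb bx /fb byy; apply/fb; rewrite raddfD; exact: BD.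
  + move=> c x Sc bx; apply/fb; rewrite fZ//; last exact: cb.
    by apply: BZ => //; exact/fb.
- split=> // [x y bx cy|x y z cx cy cz|c x y Sc cx cy].
  + have cx := cb _ bx; have [h1 h2] := MB _ _ (proj1 (fb x) bx) (proj1 (fc y) cy).
    by split; apply/fb; rewrite fM.
  + have [h1 h2] := MD _ _ _ (proj1 (fc x) cx) (proj1 (fc y) cy) (proj1 (fc z) cz).
    have cxy := cD _ _ cx cy.
    by split; apply/fb; rewrite raddfB raddfD/= !fM// raddfD.
  + have [h1 h2] := MZ _ _ _ Sc (proj1 (fc x) cx) (proj1 (fc y) cy).
    have := cA c x Sc cx; have := cA c y Sc cy; have := cM x y cx cy => cxy cAy cAx.
    by split; apply/fb; rewrite raddfB/= !fM// !fZ// fM.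
- move=> x y z cx cy cz; apply/fb; have cxy := cM x y cx cy; have cyz := cM y z cy cz.
  by rewrite raddfB/= !fM//; apply: MA; exact/fc.
- have cge : cyc E (g e) by apply/fc; rewrite gK.
  exists (g e) => // x cx; have [h1 h2] := Xe _ (proj1 (fc x) cx).
  by split; apply/fb; rewrite raddfB/= fM// gK.
Qed.

End subquotient_algebras.

(** * The Laurent deformation *)

Section laurent_algebra.
Context (R : realType) (V : lmodType R).
Local Notation scalars := (laurent [set: R^o]).
Local Notation rsub := (submodule [set: R] *:%R).

Lemma laurent_lscale (U : set V) c a : rsub U -> scalars c -> laurent U a -> laurent U (lscale c a).
Proof.
move=> sU /laurent_setT fc La; have [U0 UD UZ] := sU; have [L0 LD LZ] := laurent_submodule sU.
have [aU /finsuppP[r _ ra]] := La.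
move: c fc; apply: (@finsupp_ind R R^o) => [|c c' fc fc' Lc Lc'|p k].
- by rewrite lscale0l.
- by rewrite lscaleDl//; exact: LD.
- rewrite lscale_hmonl; split=> [n|]; first exact: UZ.
  apply: (finsupp_seq (r := [seq q + p | q <- r])) => n nr.
  rewrite ra ?scaler0//; apply: contraNN nr => nr.
  by apply/mapP; exists (n - p) => //; rewrite subrK.
Qed.

Lemma laurent_lsubmodule (U : set V) : rsub U -> submodule scalars (@lscale R V) (laurent U).
Proof.
move=> sU; have [L0 LD LZ] := laurent_submodule sU.
by split=> // c a sc; exact: laurent_lscale.
Qed.

End laurent_algebra.

Lemma finsupp_lscale (R : realType) (V : lmodType R) (c : int -> R) (a : int -> V) :
  finsupp c -> finsupp a -> finsupp (lscale c a).
Proof.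
by move=> fc fa; have [] : laurent [set: V] (lscale c a) by exact: laurent_lscale.
Qed.

Section laurent_product.
Context (R : realType) (m : nat) (M : topologicalType) (A : atlas R m M).
Implicit Types (u v : pform A) (a b c : int -> pform A).
Local Notation scalars := (laurent [set: R^o]).
Local Notation lwedge := (@lwedge R m M A).

Lemma lscale_lwedge (k : int -> R) a b : finsupp k -> finsupp a -> finsupp b ->
  lwedge (lscale k a) b = lscale k (lwedge a b) /\ lwedge a (lscale k b) = lscale k (lwedge a b).
Proof.
move=> fk fa fb; move: a fa; apply: finsupp_ind => [|a a' fa fa' [Q1 Q2] [Q1' Q2']|p u].
- by rewrite lscale0r// !lwedge0l ?lscale0r//; exact: finsupp_lscale.
- have fka := finsupp_lscale fk fa; have fka' := finsupp_lscale fk fa'.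
  have fkb := finsupp_lscale fk fb.
  rewrite lscaleDr// !lwedgeDl// Q1 Q1' Q2 Q2'.
  by split; exact: esym (lscaleDr _ _ fk).
have fu := finsupp_hmon p u.
move: b fb; apply: finsupp_ind => [|b b' fb fb' [Q1 Q2] [Q1' Q2']|q v].
- by rewrite lscale0r// !lwedge0r ?lscale0r//; exact: finsupp_lscale.
- have fkb := finsupp_lscale fk fb; have fkb' := finsupp_lscale fk fb'.
  have fku := finsupp_lscale fk fu.
  rewrite lscaleDr// !lwedgeDr// Q1 Q1' Q2 Q2'.
  by split; exact: esym (lscaleDr _ _ fk).
have fv := finsupp_hmon q v.
move: k fk; apply: (@finsupp_ind R R^o) => [|k k' fk fk' [Q1 Q2] [Q1' Q2']|r k].
- by rewrite !lscale0l lwedge0l// lwedge0r.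
- have := finsupp_lscale fk fu; have := finsupp_lscale fk' fu => f1 f2.
  have := finsupp_lscale fk fv; have := finsupp_lscale fk' fv => f3 f4.
  by rewrite !lscaleDl// lwedgeDl// lwedgeDr// Q1 Q1' Q2 Q2'.
- rewrite !lscale_hmon !lwedge_hmon lscale_hmon fwedgeZl fwedgeZr addrA.
  by split=> //; rewrite (addrCA p) addrA.
Qed.

Lemma laurent_lwedge (U U' U'' : set (pform A)) :
  submodule [set: R] *:%R U -> submodule [set: R] *:%R U' -> submodule [set: R] *:%R U'' ->
  (forall u v, U u -> U' v -> U'' (fwedge u v)) ->
  forall a b, laurent U a -> laurent U' b -> laurent U'' (lwedge a b).
Proof.
move=> sU sU' sU'' UU a b La Lb; have [L0 LD _] := laurent_submodule sU''.
have [[U0 _ _] [U0' _ _] [U0'' _ _]] := And3 sU sU' sU''.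
case: (Lb) => _ fb.
move: a La; apply: (laurent_ind _ _ _ sU) => [|a a' [_ fa] [_ fa'] Q1 Q2|p u Uu].
- by rewrite lwedge0l.
- by rewrite lwedgeDl//; exact: LD.
have fu := finsupp_hmon p u; clear fb.
move: b Lb; apply: (laurent_ind _ _ _ sU') => [|b b' [_ fb] [_ fb'] Q1 Q2|q v Uv].
- by rewrite lwedge0r.
- by rewrite lwedgeDr//; exact: LD.
- by rewrite lwedge_hmon; apply: laurent_hmon => //; exact: UU.
Qed.

Lemma finsupp_lwedge a b : finsupp a -> finsupp b -> finsupp (lwedge a b).
Proof.
move=> fa fb; have sT : submodule [set: R] *:%R [set: pform A] by [].
by have [] : laurent setT (lwedge a b) by exact: (laurent_lwedge sT sT sT).
Qed.

Lemma lwedgeA a b c : finsupp a -> finsupp b -> finsupp c ->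
  lwedge (lwedge a b) c = lwedge a (lwedge b c).
Proof.
move=> fa fb fc; have fbc := finsupp_lwedge fb fc.
move: a fa; apply: finsupp_ind => [|a a' fa fa' Q1 Q2|p u].
- by rewrite !lwedge0l.
- have f1 := finsupp_lwedge fa fb; have f2 := finsupp_lwedge fa' fb.
  by rewrite !lwedgeDl// Q1 Q2.
have fu := finsupp_hmon p u; clear fbc.
move: b fb; apply: finsupp_ind => [|b b' fb fb' Q1 Q2|q v].
- by rewrite !(lwedge0r, lwedge0l).
- have f1 := finsupp_lwedge fu fb; have f2 := finsupp_lwedge fu fb'.
  have f3 := finsupp_lwedge fb fc; have f4 := finsupp_lwedge fb' fc.
  by rewrite !(lwedgeDl, lwedgeDr)// Q1 Q2.
have fv := finsupp_hmon q v; have fuv := finsupp_lwedge fu fv.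
move: c fc; apply: finsupp_ind => [|c c' fc fc' Q1 Q2|r w].
- by rewrite !lwedge0r.
- have f1 := finsupp_lwedge fv fc; have f2 := finsupp_lwedge fv fc'.
  by rewrite !lwedgeDr// Q1 Q2.
- by rewrite !lwedge_hmon fwedgeA addrA.
Qed.

End laurent_product.

Section deformation.
Context (R : realType) (m : nat) (M : topologicalType) (A : atlas R m M).
Implicit Types (u v : pform A) (a b c : int -> pform A).
Local Notation scalars := (laurent [set: R^o]).
Local Notation lwedge := (@lwedge R m M A).

Lemma fwedge0l v : fwedge (0 : pform A) v = 0.
Proof. by apply/funext => c; apply/funext => x; exact: ewedge0l. Qed.

Lemma fwedge0r v : fwedge v (0 : pform A) = 0.
Proof. exact: linear0. Qed.

Lemma dform_fsigma u : is_form u -> dform u = 0 -> dform (fsigma u) = 0.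
Proof.
move=> fu du; have := dform_fdiag (fun n => - (-1) ^+ n) fu.
rewrite du linear0 => E; rewrite [RHS]E; congr dform.
rewrite /fsigma /fdiag /sigma; apply/funext => c; apply/funext => x.
by congr ediag; apply/funext => n /=; rewrite exprS mulN1r opprK.
Qed.

Lemma HdR_module : sq_module [set: R] *:%R (HdR A).
Proof.
split.
- split=> [|x y [fx dx] [fy dy]|k x _ [fx dx]].
  + by split; [exact: is_form0 | exact: dform0].
  + by split; [exact: is_formD | rewrite dformD// dx dy addr0].
  + by split; [exact: is_formZ | rewrite dformZ// dx scaler0].
- split=> [|_ _ [x fx <-] [y fy <-]|k _ _ [x fx <-]].
  + by exists 0; [exact: is_form0 | exact: dform0].
  + by exists (x + y); [exact: is_formD | rewrite dformD].
  + by exists (k *: x); [exact: is_formZ | rewrite dformZ].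
- by move=> _ [x fx <-]; split; [exact: is_form_dform | exact: dform_dform].
Qed.

Lemma HdR_fwedge u v : cyc (HdR A) u -> cyc (HdR A) v -> cyc (HdR A) (fwedge u v).
Proof.
move=> [fu du] [fv dv]; split; first exact: is_form_fwedge.
have := dform_fwedge fu fv; rewrite du dv => ->.
by rewrite fwedge0l fwedge0r addr0.
Qed.

(** [d (x /\ v) = dx /\ v] and [d (sigma v /\ x) = v /\ dx] for [v] closed. *)
Lemma HdR_bnd_fwedge u v : bnd (HdR A) u -> cyc (HdR A) v ->
  bnd (HdR A) (fwedge u v) /\ bnd (HdR A) (fwedge v u).
Proof.
move=> [x fx <-] [fv dv]; have fs : is_form (fsigma v) by exact: is_form_fdiag.
split.
  exists (fwedge x v); first exact: is_form_fwedge.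
  rewrite dform_fwedge// dv -[RHS]addr0; congr (_ + _); exact: linear0.
exists (fwedge (fsigma v) x); first exact: is_form_fwedge.
rewrite dform_fwedge// dform_fsigma//.
have -> : fsigma (fsigma v) = v.
  by apply/funext => c; apply/funext => y; exact: sigmaK.
by rewrite fwedge0l add0r.
Qed.

Lemma HdR_fone : cyc (HdR A) (@fone R m M A).
Proof. by split; [exact: is_form_fone | exact: dform_fone]. Qed.

Lemma HdR_algebra : sq_algebra [set: R] *:%R (HdR A) (@fwedge R m M A).
Proof.
apply: (@sq_algebra_exact R [set: R] (pform A) *:%R (HdR A) _ (@fone R m M A)).
- exact: HdR_module.
- exact: HdR_fwedge.
- exact: HdR_bnd_fwedge.
- by move=> *; rewrite fwedgeDl fwedgeDr.
- by move=> *; rewrite fwedgeZl fwedgeZr.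
- by move=> *; exact: fwedgeA.
- exact: HdR_fone.
- by move=> x [fx _]; rewrite fwedge1l// fwedge1r.
Qed.

Lemma lwedge1 a : laurent (@is_form R m M A) a ->
  lwedge (hmon 0 (@fone R m M A)) a = a /\ lwedge a (hmon 0 (@fone R m M A)) = a.
Proof.
have f1 := finsupp_hmon 0 (@fone R m M A).
move: a; apply: (laurent_ind _ _ _ (form_submodule A)) => [|a a' [_ fa] [_ fa'] [Q1 Q2] [Q1' Q2']|p u fu].
- by rewrite lwedge0r// lwedge0l.
- by rewrite lwedgeDr// lwedgeDl// Q1 Q2 Q1' Q2'.
- by rewrite !lwedge_hmon fwedge1l// fwedge1r// add0r addr0.
Qed.

Lemma laurent_sub (U U' : set (pform A)) : U `<=` U' -> laurent U `<=` laurent U'.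
Proof. by move=> UU a [aU fa]; split=> // p; exact: UU. Qed.

Lemma laurent_HdR_algebra : sq_algebra scalars (@lscale R _) (sq_laurent (HdR A)) lwedge.
Proof.
have [sZ sB BZ] := HdR_module.
have fin x : cyc (sq_laurent (HdR A)) x -> finsupp x by case.
apply: (@sq_algebra_exact (int -> R) scalars (int -> pform A) _ _ _ (hmon 0 (@fone R m M A))).
- by split; [exact: laurent_lsubmodule | exact: laurent_lsubmodule | exact: laurent_sub].
- by move=> x y; apply: laurent_lwedge => //; exact: HdR_fwedge.
- move=> x y bx cy; split; first by apply: laurent_lwedge bx cy => // u v bu cv; have [] := HdR_bnd_fwedge bu cv.
  by apply: laurent_lwedge cy bx => // u v cu bv; have [] := HdR_bnd_fwedge bv cu.
- by move=> x y z /fin fx /fin fy /fin fz; rewrite lwedgeDl// lwedgeDr.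
- by move=> k x y /laurent_setT fk /fin fx /fin fy; exact: lscale_lwedge.
- by move=> x y z /fin fx /fin fy /fin fz; exact: lwedgeA.
- by apply: laurent_hmon; [case: sZ | exact: HdR_fone].
- by move=> x cx; apply: lwedge1; apply: laurent_sub cx => u [].
Qed.

Variable omega : pform A.
Hypothesis sympl : symplectic omega.

Lemma expLam_lscale (k : int -> R) a : finsupp k ->
  expLam omega (lscale k a) = lscale k (expLam omega a).
Proof.
have eD x y : expLam omega (x + y) = expLam omega x + expLam omega y by exact: linearD.
move: k; apply: (@finsupp_ind R R^o) => [|k k' fk fk' Q1 Q2|p k].
- by rewrite !lscale0l; exact: linear0.
- by rewrite !lscaleDl// eD Q1 Q2.
rewrite !lscale_hmonl; apply/funext => n.
rewrite !(expLamE _ _ _ (ltnSn m)) scaler_sumr; apply: eq_bigr => j _.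
rewrite addrAC !scalerA (mulrC k) -scalerA; congr (_ *: _).
move: (a _) => u.
by elim: (j : nat) => //= i ->; exact: linearZZ.
Qed.

Lemma expLam_inj : injective (expLam omega).
Proof. exact: can_inj (expLamK omega). Qed.

Lemma laurent_expLam a :
  laurent (@is_form R m M A) (expLam omega a) <-> laurent (@is_form R m M A) a.
Proof.
split=> [La|]; last exact: expLam_laurent.
by rewrite -(expLamK omega a); exact: expLam_inv_laurent.
Qed.

Lemma expLam_cyc a : cyc (QHdR omega) a <-> cyc (sq_laurent (HdR A)) (expLam omega a).
Proof.
split=> [[La Da]|Ca].
  have [fe fin] := proj2 (laurent_expLam a) La.
  split=> // p; split; first exact: fe.
  have := ldform_expLam sympl (proj1 La); rewrite Da => /(congr1 (fun b => b p)).
  by move=> E; rewrite [LHS]E -[RHS]/((0 : int -> pform A) p); congr (_ p); exact: linear0.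
have La : laurent (@is_form R m M A) a.
  by apply/laurent_expLam; apply: laurent_sub Ca => u [].
split=> //; apply: expLam_inj; rewrite -(ldform_expLam sympl (proj1 La)).
transitivity (0 : int -> pform A); last by apply: esym; exact: linear0.
by apply/funext => p; have [/(_ p)[]] := Ca.
Qed.

(** Coefficientwise primitives are chosen to be zero wherever the coefficient is, so that they
    form a Laurent polynomial. *)
Lemma expLam_bnd a : bnd (QHdR omega) a <-> bnd (sq_laurent (HdR A)) (expLam omega a).
Proof.
split=> [[b Lb <-]|[ea /finsuppP[r _ fa]]].
  have Le := expLam_laurent sympl Lb; rewrite -(ldform_expLam sympl (proj1 Lb)); split=> [p|].
    by exists (expLam omega b p) => //; case: Le.
  case: Le => _ /finsuppP[r _ fb]; apply: (finsupp_seq (r := r)) => p /fb E.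
  by rewrite /ldform E dform0.
have /choice[c cP] : forall p, exists u : pform A,
    is_form u /\ dform u = expLam omega a p /\ (p \notin r -> u = 0).
  move=> p.
  have [pr|pr] := boolP (p \in r); first by have [u fu <-] := ea p; exists u.
  by exists 0; rewrite fa// dform0; split=> //; exact: is_form0.
have Lc : laurent (@is_form R m M A) c.
  split=> [p|]; first by have [] := cP p.
  by apply: (finsupp_seq (r := r)) => p; have [_ []] := cP p.
exists (expLam_inv omega c); first exact: expLam_inv_laurent.
apply: expLam_inj; rewrite -(ldform_expLam sympl) ?expLam_invK.
  by apply/funext => p; have [_ []] := cP p.
by case: (expLam_inv_laurent sympl Lc).
Qed.

Lemma expLam_mul a b : cyc (QHdR omega) a -> cyc (QHdR omega) b ->
  expLam omega (qwedge omega a b) = lwedge (expLam omega a) (expLam omega b).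
Proof. by move=> [La _] [Lb _]; exact: expLam_qwedge. Qed.

Lemma QHdR_algebra : sq_algebra scalars (@lscale R _) (QHdR omega) (qwedge omega).
Proof.
apply: (@sq_algebra_transport _ scalars _ _ (@lscale R _) _ (sq_laurent (HdR A)) lwedge _ _
  (expLam omega) (expLam_inv omega)).
- exact: expLam_invK.
- exact: expLam_cyc.
- exact: expLam_bnd.
- by move=> k x /laurent_setT fk _; exact: expLam_lscale.
- exact: expLam_mul.
- exact: laurent_HdR_algebra.
Qed.

(** The inverse of [exp (h Lam)] is the isomorphism of modules. Since [exp (h Lam)] is
    multiplicative, the product read through it is the exterior product itself. *)
Lemma quantum_laurent_deformation :
  laurent_deformation (HdR A) (@fwedge R m M A) (QHdR omega) (qwedge omega).
Proof.
have [sZ sB BZ] := HdR_module.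
have [L0 _ _] := laurent_submodule sB.
have [[_ [E0 _ _] _] _ _ _] := QHdR_algebra.
have invK := expLam_invK omega; have K := expLamK omega.
have iD (x y : int -> pform A) : expLam_inv omega (x + y) = expLam_inv omega x + expLam_inv omega y.
  apply: expLam_inj; apply: etrans (invK _) (esym _).
  exact: etrans (linearD (expLam omega) _ _) (congr2 +%R (invK x) (invK y)).
have iZ k (x : int -> pform A) : finsupp k ->
    expLam_inv omega (lscale k x) = lscale k (expLam_inv omega x).
  move=> fk; apply: expLam_inj; apply: etrans (invK _) (esym _).
  exact: etrans (expLam_lscale _ fk) (congr1 _ (invK x)).
have cP x : cyc (sq_laurent (HdR A)) x -> cyc (QHdR omega) (expLam_inv omega x).
  by move=> cx; apply/expLam_cyc; rewrite invK.
split; [exact: HdR_algebra | exact: QHdR_algebra |].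
exists (expLam_inv omega), (@fw0 R m M A); split.
- split=> // [x y cx cy|k x /laurent_setT fk cx|x cx|y cy].
  + by rewrite iD subrr; exact: E0.
  + by rewrite iZ// subrr; exact: E0.
  + by rewrite expLam_bnd invK.
  + exists (expLam omega y); first exact/expLam_cyc.
    by rewrite K subrr.
- have B0 : bnd (HdR A) 0 by case: sB.
  have Z0 : cyc (HdR A) 0 by case: sZ.
  split=> [x y cx cy|x y bx cy|x y z _ _ _|k x y _ _ _].
  + by apply: laurent_hmon => //; exact: HdR_fwedge.
  + by have [h1 h2] := HdR_bnd_fwedge bx cy; split; exact: laurent_hmon.
  + by rewrite fw0Dl fw0Dr !subrr.
  + by rewrite /fw0 fwedgeZl fwedgeZr hmonZ !subrr.
- by move=> x y cx cy; rewrite /fw0 hmonE eqxx subrr; case: sB.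
- move=> x y cx cy; have [Z0 _ _] := sZ.
  have chx : cyc (QHdR omega) (expLam_inv omega (hmon 0 x)) by apply/cP/laurent_hmon.
  have chy : cyc (QHdR omega) (expLam_inv omega (hmon 0 y)) by apply/cP/laurent_hmon.
  have E : expLam omega (qwedge omega (expLam_inv omega (hmon 0 x)) (expLam_inv omega (hmon 0 y))) =
      expLam omega (expLam_inv omega (fw0 x y)).
    apply: etrans (expLam_mul chx chy) (etrans (congr2 _ (invK _) (invK _)) _).
    by rewrite lwedge_hmon; exact: esym (invK _).
  by rewrite (expLam_inj E) subrr; exact: E0.
Qed.

End deformation.

Theorem theorem3p4 (R : realType) (m : nat) (M : topologicalType)
    (A : atlas R m M) (omega : pform A)
    (hausM : hausdorff_space M) (secM : @second_countable M)
    (compM : compact [set: M]) (sympl : symplectic omega) :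
  (double_complex (qdc A) (lhdelta omega) (@ldform R m M A)) /\
  (ss_abuts (d_h omega) (dc_filt1 (qdc A)) (QHdRn omega) /\
   (forall p q : int, sq_iso [set: R] *:%R *:%R
      (sq_hmon p (HdRk A (q - p))) (Epage omega 1 p q) id) /\
   ss_degenerates (d_h omega) (dc_filt1 (qdc A)) 1) /\
  (ss_abuts (d_h omega) (dc_filt2 (qdc A)) (QHdRn omega) /\
   (forall p q : int, sq_iso [set: R] *:%R *:%R
      (sq_hmon p (PHk omega (q - p))) (Epage' omega 1 p q) id) /\
   ss_degenerates (d_h omega) (dc_filt2 (qdc A)) 1) /\
  laurent_deformation (HdR A) (@fwedge R m M A) (QHdR omega) (qwedge omega).
Proof.
split; first exact: quantum_double_complex.
split; first exact: de_rham_spectral_sequence.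
split; first exact: poisson_spectral_sequence.
exact: quantum_laurent_deformation.
Qed.
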